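(* Let $\mathcal{E}$, $\mathcal{F}$, $\mathcal{G}$ be saturated categorical Fell bundles over étale groupoids $G$, $H$, $K$ with locally compact Hausdorff unit spaces, and let $A:\mathcal{E}\curvearrowright\mathcal{F}$ and $B:\mathcal{F}\curvearrowright\mathcal{G}$ be proper saturated Fell actors with underlying actors $h:G\curvearrowright H$ and $k:H\curvearrowright K$. Let $\Phi^0_A:\mathcal{C}_c(G,\mathcal{E})\to\mathcal{C}_c(H,\mathcal{F})$, $\Phi^0_B:\mathcal{C}_c(H,\mathcal{F})\to\mathcal{C}_c(K,\mathcal{G})$ and $\Phi^0_{BA}:\mathcal{C}_c(G,\mathcal{E})\to\mathcal{C}_c(K,\mathcal{G})$ be the ${}^*$-homomorphisms induced by $A$, $B$ and $BA$ respectively. Then $\Phi^0_{BA}=\Phi^0_B\circ\Phi^0_A$, and so the extensions to the full Fell bundle $C^*$-algebras satisfy $\Phi_B\circ\Phi_A=\Phi_{BA}$. In particular, there is a functor taking saturated categorical Fell bundles and saturated proper Fell actors to $C^*$-algebras and ${}^*$-homomorphisms.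
   Context: Groupoids are étale with locally compact Hausdorff unit space, not necessarily Hausdorff. An actor $h:G\curvearrowright H$ consists of a continuous anchor map $\rho_h:H\to G^{(0)}$ and a continuous multiplication $\{(\gamma,x)\in G\times H: s(\gamma)=\rho_h(x)\}\to H$, $(\gamma,x)\mapsto\gamma\cdot x$, such that $\rho_h(\gamma\cdot x)=r(\gamma)$; $\gamma_1\cdot(\gamma_2\cdot x)=(\gamma_1\gamma_2)\cdot x$ whenever $s(\gamma_1)=r(\gamma_2)$, $s(\gamma_2)=\rho_h(x)$; $\rho_h(x)\cdot x=x$; and, whenever $s(\gamma)=\rho_h(x)$ and $(x,y)\in H^{(2)}$, $\rho_h(xy)=\rho_h(x)$, $s(\gamma\cdot x)=s(x)$, $\gamma\cdot(xy)=(\gamma\cdot x)y$. It is proper if $\rho_h|_{H^{(0)}}$ is a proper map. The composite $kh:G\curvearrowright K$ has anchor $\rho_h\circ\rho_k$ and multiplication $\gamma\cdot_{kh}x=(\gamma\cdot_h\rho_k(x))\cdot_k x$. A Fell bundle $p:\mathcal{E}\to G$ is an upper-semicontinuous Banach bundle with the usual continuous, associative, submultiplicative fibrewise bilinear multiplication $\mathcal{E}_\gamma\times\mathcal{E}_\eta\to\mathcal{E}_{\gamma\eta}$ and continuous isometric conjugate-linear involution $\mathcal{E}_\gamma\to\mathcal{E}_{\gamma^{-1}}$ reversing products, with $\|a^*a\|=\|a\|^2$ and $a^*a\geq 0$ in $\mathcal{E}_{s(p(a))}$. It is saturated if $\mathcal{E}_\gamma\cdot\mathcal{E}_\eta$ spans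 a dense subspace of $\mathcal{E}_{\gamma\eta}$ for all composable $(\gamma,\eta)$. It is categorical if it forms a topological category under its multiplication; concretely, the fibres over units are unital $C^*$-algebras whose units $1_y$ act as identities and the maps $\xi\mapsto 1_{s(p(\xi))}$, $\xi\mapsto 1_{r(p(\xi))}$ are continuous. A Fell actor $A:\mathcal{E}\curvearrowright\mathcal{F}$ consists of an actor $h:G\curvearrowright H$ with anchor $\rho$ and a continuous map $M^A:\{(\xi,f)\in\mathcal{E}\times\mathcal{F}: s(p(\xi))=\rho(p(f))\}\to\mathcal{F}$ such that: (1) it restricts to bilinear maps $M^A_{\gamma,x}:\mathcal{E}_\gamma\times\mathcal{F}_x\to\mathcal{F}_{\gamma\cdot x}$; (2) $M^A(\xi\zeta,f)=M^A(\xi,M^A(\zeta,f))$; (3) $M^A(\xi,fg)=M^A(\xi,f)g$ (for composable elements); (4) $M^A_{\gamma,x}(\xi,f)^*g=f^*M^A_{\gamma^{-1},y}(\xi^*,g)$ for $\xi\in\mathcal{E}_\gamma$, $f\in\mathcal{F}_x$, $g\in\mathcal{F}_y$ with $s(\gamma)=\rho(x)$, $r(y)=r(\gamma\cdot x)$. It is saturated if the image of each $M^A_{\gamma,x}$ spans a dense subspace of $\mathcal{F}_{\gamma\cdot x}$. Each $\nabla_{\gamma,x}(\xi):=M^A_{\gamma,x}(\xi,\cdot)$ is an adjointable operator $\mathcal{F}_x\to\mathcal{F}_{\gamma\cdot x}$ of right Hilbert $\mathcal{F}_{s(x)}$-modules. $A$ is proper if $h$ is proper and every $\nabla_{\gamma,x}$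 takes values in the compact operators $\mathcal{K}(\mathcal{F}_x,\mathcal{F}_{\gamma\cdot x})$. The composite $BA$ has underlying actor $kh$ and multiplication $M^{BA}_{\gamma,t}(\xi,\zeta)=M^B_{\gamma\cdot\rho_k(t),t}(M^A_{\gamma,\rho_k(t)}(\xi,1_{\rho_k(t)}),\zeta)$. For an open bisection $U\subseteq G$, $\mathcal{C}_c(U,\mathcal{E})$ is the space of continuous compactly supported sections $U\to\mathcal{E}$ extended by zero; $\mathcal{C}_c(G,\mathcal{E})$ is the linear span of these over all open bisections, with convolution $(f*g)(\gamma)=\sum_{\eta\in G_{r(\gamma)}}f(\eta^{-1})g(\eta\gamma)$ (where $G_y=s^{-1}(\{y\})$) and involution $f^*(\gamma)=f(\gamma^{-1})^*$. $C^*(\mathcal{E})$ is its completion in the maximal $C^*$-norm. For a proper Fell actor $A$ and $f\in\mathcal{C}_c(G,\mathcal{E})$, $\Phi^0_A(f)\in\mathcal{C}_c(H,\mathcal{F})$ is the section whose left convolution is given by $$[\Phi^0_A(f)g](x)=\sum_{\gamma\in G_{\rho(x)}}M^A_{\gamma^{-1},\gamma\cdot x}(f(\gamma^{-1}),g(\gamma\cdot x)),\qquad g\in\mathcal{C}_c(H,\mathcal{F}).$$ $\Phi_A:C^*(\mathcal{E})\to C^*(\mathcal{F})$ is the continuous extension of the ${}^*$-homomorphism $f\mapsto\Phi^0_A(f)$. The functor sends $\mathcal{E}$ to $C^*(\mathcal{E})$ and $A$ to $\Phi_A$. *)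

(* Defs.v *)
From mathcomp Require Import all_boot all_order all_algebra.
From mathcomp Require Import all_classical all_reals all_analysis.
From mathcomp Require Import complex.

Set Implicit Arguments.
Unset Strict Implicit.
Unset Printing Implicit Defensive.

Import Order.TTheory GRing.Theory Num.Theory.
Import numFieldNormedType.Exports.

Local Open Scope classical_set_scope.
Local Open Scope complex_scope.
Local Open Scope ring_scope.

Definition local_homeomorphism (X Y : topologicalType) (B : set Y)
    (f : X -> Y) : Prop :=
  [/\ continuous f, forall x, B (f x) &
      forall x, exists U : set X,
        [/\ open U, U x, set_inj U f &
            forall V, open V -> V `<=` U ->
              exists2 W, open W & f @` V = W `&` B]].

Definition lspan (K : pzRingType) (V : lmodType K) (A : set V) : set V :=
  [set v | exists n (c : 'I_n -> K) (a : 'I_n -> V),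
     (forall i, A (a i)) /\ v = \sum_(i < n) c i *: a i].

Definition is_bilinear (K : pzRingType) (U V W : lmodType K)
    (f : U -> V -> W) : Prop :=
  (forall v, linear (f^~ v)) /\ (forall u, linear (f u)).

Definition is_conj_linear (K : numClosedFieldType) (V W : lmodType K)
    (f : V -> W) : Prop :=
  forall (z : K) (u v : V), f (z *: u + v) = z^* *: f u + f v.

(* Partial operations (composition of arrows, products in a bundle, actions)
   are represented by total functions.  Their values at non-composable
   arguments carry no meaning and the axioms only concern composable
   arguments. *)

Record groupoidData := GroupoidData {
  garr :> topologicalType ;
  gs : garr -> garr ;
  gr : garr -> garr ;
  gmul : garr -> garr -> garr ;
  ginv : garr -> garr }.

Definition units (G : groupoidData) : set G := [set x | gs x = x].
Arguments units : clear implicits.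

Definition composable (G : groupoidData) (g h : G) : Prop := gs g = gr h.

Record is_etale_groupoid (G : groupoidData) : Prop := IsEtaleGroupoid {
  gs_gs : forall g : G, gs (gs g) = gs g ;
  gr_gs : forall g : G, gr (gs g) = gs g ;
  gs_gr : forall g : G, gs (gr g) = gr g ;
  gr_gr : forall g : G, gr (gr g) = gr g ;
  gs_mul : forall g h : G, composable g h -> gs (gmul g h) = gs h ;
  gr_mul : forall g h : G, composable g h -> gr (gmul g h) = gr g ;
  gmulA : forall g h k : G, composable g h -> composable h k ->
    gmul g (gmul h k) = gmul (gmul g h) k ;
  gmul_gs : forall g : G, gmul g (gs g) = g ;
  gmul_gr : forall g : G, gmul (gr g) g = g ;
  gs_inv : forall g : G, gs (ginv g) = gr g ;
  gr_inv : forall g : G, gr (ginv g) = gs g ;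
  gmulVg : forall g : G, gmul (ginv g) g = gs g ;
  gmulgV : forall g : G, gmul g (ginv g) = gr g ;
  gmul_continuous :
    {within [set q : G * G | composable q.1 q.2],
      continuous (fun q : G * G => gmul q.1 q.2)} ;
  ginv_continuous : continuous (@ginv G) ;
  gs_etale : local_homeomorphism (units G) (@gs G) ;
  gr_etale : local_homeomorphism (units G) (@gr G) ;
  units_hausdorff : hausdorff_space (units G) ;
  units_locally_compact : locally_compact [set: units G] }.

Record etaleGroupoid := EtaleGroupoid {
  egroupoid :> groupoidData ;
  egroupoidP : is_etale_groupoid egroupoid }.

Definition open_bisection (G : groupoidData) (U : set G) : Prop :=
  [/\ open U, set_inj U (@gs G) & set_inj U (@gr G)].

(* [act] is normalised to be the second projection off its domain, so that two
   actors are equal as soon as their anchors and multiplications are. *)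
Record actor (G H : etaleGroupoid) := Actor {
  rho : H -> G ;
  act : G -> H -> H ;
  rho_units : forall x, units G (rho x) ;
  rho_continuous : continuous rho ;
  act_continuous :
    {within [set q : G * H | gs q.1 = rho q.2],
      continuous (fun q : G * H => act q.1 q.2)} ;
  rho_act : forall g x, gs g = rho x -> rho (act g x) = gr g ;
  actA : forall g1 g2 x, composable g1 g2 -> gs g2 = rho x ->
    act g1 (act g2 x) = act (gmul g1 g2) x ;
  act_rho : forall x, act (rho x) x = x ;
  rho_mul : forall g x y, gs g = rho x -> composable x y ->
    rho (gmul x y) = rho x ;
  gs_act : forall g x, gs g = rho x -> gs (act g x) = gs x ;
  act_mul : forall g x y, gs g = rho x -> composable x y ->
    act g (gmul x y) = gmul (act g x) y ;
  act_out : forall g x, gs g <> rho x -> act g x = x }.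

Definition proper_actor (G H : etaleGroupoid) (h : actor G H) : Prop :=
  forall K : set G, compact K -> K `<=` units G ->
    compact (units H `&` rho h @^-1` K).

Section Cstar.
Variable R : realType.
Local Notation C := R[i].

Record cstarAlgebra := CstarAlgebra {
  cstar_space :> completeNormedModType C ;
  cmul : cstar_space -> cstar_space -> cstar_space ;
  cstar : cstar_space -> cstar_space ;
  cmul_bilinear : is_bilinear cmul ;
  cmulA : associative cmul ;
  cmul_norm : forall a b, `|cmul a b| <= `|a| * `|b| ;
  cstar_conj_linear : is_conj_linear cstar ;
  cstarK : involutive cstar ;
  cstarM : forall a b, cstar (cmul a b) = cmul (cstar b) (cstar a) ;
  cstar_identity : forall a, `|cmul (cstar a) a| = `|a| ^+ 2 }.

Record starHom (A B : cstarAlgebra) := StarHom {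
  star_hom :> A -> B ;
  star_hom_linear : linear star_hom ;
  star_hom_mul : forall a b, star_hom (cmul a b) = cmul (star_hom a) (star_hom b) ;
  star_hom_star : forall a, star_hom (cstar a) = cstar (star_hom a) }.

Definition starHom_id (A : cstarAlgebra) : starHom A A :=
  @StarHom A A idfun (fun _ _ _ => erefl) (fun _ _ => erefl) (fun _ => erefl).

Section StarHomComp.
Variables (A B D : cstarAlgebra) (f : starHom A B) (g : starHom B D).

Lemma starHom_comp_linear : linear (g \o f).
Proof. by move=> z a b /=; rewrite !star_hom_linear. Qed.

Lemma starHom_comp_mul a b : (g \o f) (cmul a b) = cmul ((g \o f) a) ((g \o f) b).
Proof. by rewrite /= !star_hom_mul. Qed.

Lemma starHom_comp_star a : (g \o f) (cstar a) = cstar ((g \o f) a).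
Proof. by rewrite /= !star_hom_star. Qed.

Definition starHom_comp : starHom A D :=
  @StarHom A D (g \o f) starHom_comp_linear starHom_comp_mul starHom_comp_star.

End StarHomComp.

(* The fibre over [x] is presented as a Banach space [fib x] identified with
   [bproj @^-1` [set x]] through the mutually inverse maps [inc x] and
   [fibcoord x]; [fibcoord x e] is meaningless when [bproj e <> x]. *)
Record bundle (X : topologicalType) := Bundle {
  btot :> topologicalType ;
  bproj : btot -> X ;
  fib : X -> completeNormedModType C ;
  inc : forall x, fib x -> btot ;
  fibcoord : forall x, btot -> fib x ;
  bproj_inc : forall x (v : fib x), bproj (inc v) = x ;
  incK : forall x (v : fib x), fibcoord x (inc v) = v ;
  coordK : forall x e, bproj e = x -> inc (fibcoord x e) = e }.

Definition bnorm (X : topologicalType) (E : bundle X) (e : E) : C :=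
  `|fibcoord (bproj e) e|.

Definition badd (X : topologicalType) (E : bundle X) (e e' : E) : E :=
  inc (fibcoord (bproj e) e + fibcoord (bproj e) e').

Definition bscale (X : topologicalType) (E : bundle X) (z : C) (e : E) : E :=
  inc (z *: fibcoord (bproj e) e).

Record is_usc_banach_bundle (X : topologicalType) (E : bundle X) : Prop :=
    IsUscBanachBundle {
  bproj_continuous : continuous (@bproj X E) ;
  bproj_open : forall U : set E, open U -> open (@bproj X E @` U) ;
  bnorm_usc : forall a : C, open [set e : E | bnorm e < a] ;
  badd_continuous :
    {within [set q : E * E | bproj q.1 = bproj q.2],
      continuous (fun q : E * E => badd q.1 q.2)} ;
  bscale_continuous : forall z : C, continuous (@bscale X E z) ;
  zero_limit : forall (F : set_system E) (x : X), ProperFilter F ->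
    @bproj X E @ F --> x -> (fun e : E => bnorm e : C^o) @ F --> (0 : C^o) ->
    F --> inc (0 : fib E x) }.

Record fellData (G : etaleGroupoid) := FellData {
  fell_bundle :> bundle G ;
  fmul : fell_bundle -> fell_bundle -> fell_bundle ;
  fstar : fell_bundle -> fell_bundle }.

Definition fibmul (G : etaleGroupoid) (E : fellData G) (g h : G)
    (v : fib E g) (w : fib E h) : fib E (gmul g h) :=
  fibcoord (gmul g h) (fmul (inc v) (inc w)).

Definition fibstar (G : etaleGroupoid) (E : fellData G) (g : G)
    (v : fib E g) : fib E (ginv g) :=
  fibcoord (ginv g) (fstar (inc v)).

Definition bcomposable (G : etaleGroupoid) (E : fellData G) (a b : E) : Prop :=
  composable (bproj a) (bproj b).

Record is_fell_bundle (G : etaleGroupoid) (E : fellData G) : Prop :=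
    IsFellBundle {
  fell_usc : is_usc_banach_bundle E ;
  bproj_mul : forall a b : E, bcomposable a b ->
    bproj (fmul a b) = gmul (bproj a) (bproj b) ;
  fibmul_bilinear : forall g h : G, composable g h ->
    is_bilinear (@fibmul G E g h) ;
  fmulA : forall a b c : E, bcomposable a b -> bcomposable b c ->
    fmul a (fmul b c) = fmul (fmul a b) c ;
  fmul_norm : forall a b : E, bcomposable a b ->
    bnorm (fmul a b) <= bnorm a * bnorm b ;
  fmul_continuous :
    {within [set q : E * E | bcomposable q.1 q.2],
      continuous (fun q : E * E => fmul q.1 q.2)} ;
  bproj_star : forall a : E, bproj (fstar a) = ginv (bproj a) ;
  fibstar_conj_linear : forall g : G, is_conj_linear (@fibstar G E g) ;
  fstarK : forall a : E, fstar (fstar a) = a ;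
  fstar_norm : forall a : E, bnorm (fstar a) = bnorm a ;
  fstarM : forall a b : E, bcomposable a b ->
    fstar (fmul a b) = fmul (fstar b) (fstar a) ;
  fstar_continuous : continuous (@fstar G E) ;
  fell_identity : forall a : E, bnorm (fmul (fstar a) a) = bnorm a ^+ 2 ;
  (* positivity in the C*-algebra over the unit [gs (bproj a)] *)
  fell_positive : forall a : E, exists2 c : E, bproj c = gs (bproj a) &
    fmul (fstar a) a = fmul (fstar c) c }.

Definition saturated_fell (G : etaleGroupoid) (E : fellData G) : Prop :=
  forall g h : G, composable g h ->
    dense (lspan [set u | exists v w, u = @fibmul G E g h v w]).

(* [one y] is the unit of the fibre over [y]; only its values at [y] in
   [units G] matter. *)
Record is_categorical (G : etaleGroupoid) (E : fellData G) (one : G -> E)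
    : Prop := IsCategorical {
  bproj_one : forall y, units G y -> bproj (one y) = y ;
  mul1 : forall e : E, fmul (one (gr (bproj e))) e = e ;
  mul_1 : forall e : E, fmul e (one (gs (bproj e))) = e ;
  one_gs_continuous : continuous (fun e : E => one (gs (bproj e))) ;
  one_gr_continuous : continuous (fun e : E => one (gr (bproj e))) }.

Record scFellBundle := ScFellBundle {
  sc_base : etaleGroupoid ;
  sc_data :> fellData sc_base ;
  sc_fell : is_fell_bundle sc_data ;
  sc_saturated : saturated_fell sc_data ;
  sc_one : sc_base -> sc_data ;
  sc_categorical : is_categorical sc_one }.

Record fellActorData (G H : etaleGroupoid) (E : fellData G) (F : fellData H) :=
    FellActorData {
  under :> actor G H ;
  fam : E -> F -> F }.

Section FellActor.
Variables (G H : etaleGroupoid) (E : fellData G) (F : fellData H).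
Variable A : fellActorData E F.

Definition fa_dom (xi : E) (f : F) : Prop :=
  gs (bproj xi) = rho A (bproj f).

Definition nabla (g : G) (x : H) (xi : fib E g) (f : fib F x)
    : fib F (act A g x) :=
  fibcoord (act A g x) (fam A (inc xi) (inc f)).

(* As for [act], the last axiom normalises [fam] off its domain. *)
Record is_fell_actor : Prop := IsFellActor {
  fam_continuous :
    {within [set q : E * F | fa_dom q.1 q.2],
      continuous (fun q : E * F => fam A q.1 q.2)} ;
  bproj_fam : forall xi f, fa_dom xi f ->
    bproj (fam A xi f) = act A (bproj xi) (bproj f) ;
  nabla_bilinear : forall g x, gs g = rho A x -> is_bilinear (@nabla g x) ;
  famM : forall xi zeta f, bcomposable xi zeta -> fa_dom zeta f ->
    fam A (fmul xi zeta) f = fam A xi (fam A zeta f) ;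
  fam_mul : forall xi f g, fa_dom xi f -> bcomposable f g ->
    fam A xi (fmul f g) = fmul (fam A xi f) g ;
  fam_adjoint : forall (xi : E) (f g : F), fa_dom xi f ->
    gr (bproj g) = gr (act A (bproj xi) (bproj f)) ->
    fmul (fstar (fam A xi f)) g = fmul (fstar f) (fam A (fstar xi) g) ;
  fam_out : forall xi f, ~ fa_dom xi f -> fam A xi f = f }.

Definition saturated_fell_actor : Prop :=
  forall g x, gs g = rho A x ->
    dense (lspan [set u | exists xi f, u = @nabla g x xi f]).

(* [T : F_x -> F_y] lies in the operator-norm closure of the span of the
   rank-one operators [c |-> a <b, c> = a (b^* c)], [a] in [F_y],
   [b] in [F_x]. *)
Definition compact_operator (x y : H) (T : fib F x -> fib F y) : Prop :=
  forall eps : C, 0 < eps ->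
    exists n (a : 'I_n -> fib F y) (b : 'I_n -> fib F x),
      forall c : fib F x,
        `|T c - \sum_(i < n)
            fibcoord y (fmul (inc (a i)) (fmul (fstar (inc (b i))) (inc c)))|
          <= eps * `|c|.

Definition proper_fell_actor : Prop :=
  proper_actor A /\
  forall g x (xi : fib E g), gs g = rho A x -> compact_operator (@nabla g x xi).

End FellActor.

Record psFellActor (E F : scFellBundle) := PsFellActor {
  ps_data :> fellActorData E F ;
  ps_fell_actor : is_fell_actor ps_data ;
  ps_saturated : saturated_fell_actor ps_data ;
  ps_proper : proper_fell_actor ps_data }.

Definition is_composite (E F D : scFellBundle)
    (A : psFellActor E F) (B : psFellActor F D) (BA : psFellActor E D) : Prop :=
  [/\ forall t, rho BA t = rho A (rho B t),
      forall g t, gs g = rho A (rho B t) ->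
        act BA g t = act B (act A g (rho B t)) t &
      forall (xi : E) (zeta : D), gs (bproj xi) = rho A (rho B (bproj zeta)) ->
        fam BA xi zeta =
        fam B (fam A xi (sc_one (rho B (bproj zeta)))) zeta].

Section Sections.
Variables (G : etaleGroupoid) (E : fellData G).

Definition sections : Type := forall g : G, fib E g.

Definition in_CcU (U : set G) (f : sections) : Prop :=
  {within U, continuous (fun g => inc (f g))} /\
  exists K, [/\ compact K, K `<=` U & forall g, ~ K g -> f g = 0].

Definition in_Cc (f : sections) : Prop :=
  exists n (U : 'I_n -> set G) (c : 'I_n -> C) (u : 'I_n -> sections),
    (forall i, open_bisection (U i) /\ in_CcU (U i) (u i)) /\
    forall g, f g = \sum_(i < n) c i *: u i g.

Definition sec_lin (z : C) (f u : sections) : sections :=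
  fun g => z *: f g + u g.

Definition convolution (f u : sections) : sections := fun g =>
  \sum_(h \in [set h : G | gs h = gr g])
    fibcoord g (fmul (inc (f (ginv h))) (inc (u (gmul h g)))).

Definition sec_star (f : sections) : sections := fun g =>
  fibcoord g (fstar (inc (f (ginv g)))).

Record is_cstar_seminorm (N : sections -> R) : Prop := IsCstarSeminorm {
  sn_ge0 : forall f, in_Cc f -> 0 <= N f ;
  sn_add : forall f u, in_Cc f -> in_Cc u -> N (sec_lin 1 f u) <= N f + N u ;
  sn_scale : forall (z : C) f, in_Cc f ->
    (N (fun g => z *: f g))%:C = `|z| * (N f)%:C ;
  sn_mul : forall f u, in_Cc f -> in_Cc u -> N (convolution f u) <= N f * N u ;
  sn_star : forall f, in_Cc f -> N (sec_star f) = N f ;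
  sn_identity : forall f, in_Cc f -> N (convolution (sec_star f) f) = N f ^+ 2 }.

(* The maximal C*-norm is taken as the largest C*-seminorm, the supremum over
   all *-representations; that it separates [in_Cc] is not required. *)
Definition is_maximal_cstar_seminorm (N : sections -> R) : Prop :=
  is_cstar_seminorm N /\
  forall N', is_cstar_seminorm N' -> forall f, in_Cc f -> N' f <= N f.

Record is_full_cstar (D : cstarAlgebra) (iota : sections -> D) : Prop :=
    IsFullCstar {
  iota_linear : forall (z : C) f u, in_Cc f -> in_Cc u ->
    iota (sec_lin z f u) = z *: iota f + iota u ;
  iota_mul : forall f u, in_Cc f -> in_Cc u ->
    iota (convolution f u) = cmul (iota f) (iota u) ;
  iota_star : forall f, in_Cc f -> iota (sec_star f) = cstar (iota f) ;
  iota_norm : exists2 N, is_maximal_cstar_seminorm N &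
    forall f, in_Cc f -> `|iota f| = (N f)%:C ;
  iota_dense : dense (iota @` in_Cc) }.

End Sections.

(* A map [Cc(G, E) -> Cc(H, F)] is represented by a function on all sections,
   of which only the restriction to [in_Cc] matters. *)
Record is_Cc_star_hom (G H : etaleGroupoid) (E : fellData G) (F : fellData H)
    (Phi : sections E -> sections F) : Prop := IsCcStarHom {
  Cc_hom_Cc : forall f, in_Cc f -> in_Cc (Phi f) ;
  Cc_hom_linear : forall (z : C) f u, in_Cc f -> in_Cc u ->
    Phi (sec_lin z f u) = sec_lin z (Phi f) (Phi u) ;
  Cc_hom_mul : forall f u, in_Cc f -> in_Cc u ->
    Phi (convolution f u) = convolution (Phi f) (Phi u) ;
  Cc_hom_star : forall f, in_Cc f -> Phi (sec_star f) = sec_star (Phi f) }.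

Definition is_Phi0 (E F : scFellBundle) (A : psFellActor E F)
    (Phi0 : sections E -> sections F) : Prop :=
  is_Cc_star_hom Phi0 /\
  forall (f : sections E) (u : sections F), in_Cc f -> in_Cc u ->
    forall x, convolution (Phi0 f) u x =
      \sum_(g \in [set g : sc_base E | gs g = rho A x])
        fibcoord x (fam A (inc (f (ginv g))) (inc (u (act A g x)))).

Definition is_extension (E F : scFellBundle)
    (CE CF : cstarAlgebra) (iE : sections E -> CE) (iF : sections F -> CF)
    (Phi0 : sections E -> sections F) (Phi : starHom CE CF) : Prop :=
  continuous Phi /\ forall f, in_Cc f -> Phi (iE f) = iF (Phi0 f).

End Cstar.

Record is_category (Ob : Type) (Hom : Ob -> Ob -> Type)
    (idm : forall X, Hom X X)
    (comp : forall X Y Z, Hom X Y -> Hom Y Z -> Hom X Z) : Prop := IsCategory {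
  comp_id_l : forall X Y (f : Hom X Y), comp _ _ _ (idm X) f = f ;
  comp_id_r : forall X Y (f : Hom X Y), comp _ _ _ f (idm Y) = f ;
  comp_assoc : forall X Y Z W (f : Hom X Y) (g : Hom Y Z) (h : Hom Z W),
    comp _ _ _ f (comp _ _ _ g h) = comp _ _ _ (comp _ _ _ f g) h }.

Record is_functor (Ob Ob' : Type)
    (Hom : Ob -> Ob -> Type) (idm : forall X, Hom X X)
    (comp : forall X Y Z, Hom X Y -> Hom Y Z -> Hom X Z)
    (Hom' : Ob' -> Ob' -> Type) (idm' : forall X, Hom' X X)
    (comp' : forall X Y Z, Hom' X Y -> Hom' Y Z -> Hom' X Z)
    (obF : Ob -> Ob') (homF : forall X Y, Hom X Y -> Hom' (obF X) (obF Y))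
    : Prop := IsFunctor {
  functor_dom : is_category idm comp ;
  functor_cod : is_category idm' comp' ;
  functor_id : forall X, homF _ _ (idm X) = idm' (obF X) ;
  functor_comp : forall X Y Z (f : Hom X Y) (g : Hom Y Z),
    homF _ _ (comp _ _ _ f g) = comp' _ _ _ (homF _ _ f) (homF _ _ g) }.

(* Main.v *)
From HB Require Import structures.
Require Import Defs.
From mathcomp Require Import all_boot all_order all_algebra.
From mathcomp Require Import all_classical all_reals all_analysis.
From mathcomp Require Import complex.
From mathcomp Require Import ring.
Set Implicit Arguments.
Unset Strict Implicit.
Unset Printing Implicit Defensive.
Import Order.TTheory GRing.Theory Num.Theory.
Import numFieldNormedType.Exports.
Local Open Scope classical_set_scope.
Local Open Scope complex_scope.
Local Open Scope ring_scope.

(* [Phi0_A f] is [L_A(f) 1], where [L_A(f)] is the left action of [f] and [1]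
   is the section equal to [1_y] at a unit [y] and to 0 elsewhere: [1] is a
   two-sided identity for convolution and agrees, at any given unit, with a
   compactly supported section, and [L_A(f)(v * u) = (L_A(f) v) * u].  Hence
   [L_BA(f) u = L_B(L_A(f) 1) u] gives [Phi0_BA = Phi0_B o Phi0_A], and the
   extensions agree because they are continuous and agree on a dense subspace.

   For the functor one also needs the maximal C*-seminorm to be finite.  By the
   C*-identity and compactness this reduces to self-adjoint sections [h] over
   the units with [|h| <= 1/2].  Solving [2 l = h^2 + l^2] fibrewise, so that
   [1 - l = sqrt (1 - h^2)], writes [h] as the average of the unitary fields
   [+-i (1 - l) + h]; every C*-seminorm is invariant under multiplication by
   these, hence is at most 1 at [h]. *)

(** * Groupoids and actors *)

(** All sums are finite pointwise, so the algebraic identities are proved for sections with finitely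
    many nonzero values per range. Continuity and compact support enter afterwards, to see that
    [actor_hom] preserves [in_Cc]. This is why [unit_section], which need not have compact support,
    can be an argument like any other. Two elements turn actions into left multiplications: the
    arrow [act a g (gr x)] and the vector [fam A xi 1]. With them the double sum for a composite
    collapses, since a nonzero value of the unit section pins down the summation index. [G] need not
    be Hausdorff: a generating section is continuous only on the bisection that carries it, and
    products of compact sets are compact because composability is a closed condition over the
    Hausdorff unit space. The algebra [in_Cc] need not be complete, so the square root is taken in
    the unit fibres, which are C*-algebras, and the fibrewise limits are glued by an error bound
    uniform in the fibre. The unitary fields contain 1 and need not lie in [in_Cc]; only their
    products with elements of [in_Cc] do. *)

Section GroupoidAlgebra.
Variable G : etaleGroupoid.
Implicit Types g h k x : G.
Let GP := egroupoidP G.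

Lemma gssE g : gs (gs g) = gs g. Proof. exact: gs_gs. Qed.

Lemma grsE g : gr (gs g) = gs g. Proof. exact: gr_gs. Qed.

Lemma gsrE g : gs (gr g) = gr g. Proof. exact: gs_gr. Qed.

Lemma grrE g : gr (gr g) = gr g. Proof. exact: gr_gr. Qed.

Lemma gsVE g : gs (ginv g) = gr g. Proof. exact: gs_inv. Qed.

Lemma grVE g : gr (ginv g) = gs g. Proof. exact: gr_inv. Qed.

Lemma gsME g h : gs g = gr h -> gs (gmul g h) = gs h.
Proof. exact: gs_mul. Qed.

Lemma grME g h : gs g = gr h -> gr (gmul g h) = gr g.
Proof. exact: gr_mul. Qed.

Lemma gmulAE g h k : gs g = gr h -> gs h = gr k ->
  gmul g (gmul h k) = gmul (gmul g h) k.
Proof. exact: gmulA. Qed.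

Lemma unit_gs g : units G (gs g). Proof. exact: gssE. Qed.

Lemma unit_gr g : units G (gr g). Proof. exact: gsrE. Qed.

Lemma gs_unit x : units G x -> gs x = x. Proof. by []. Qed.

Lemma gr_unit x : units G x -> gr x = x.
Proof. by move=> ux; rewrite -{1}(gs_unit ux) grsE. Qed.

Lemma gmul_unitl x g : units G x -> x = gr g -> gmul x g = g.
Proof. by move=> _ ->; exact: (gmul_gr GP). Qed.

Lemma gmul_unitr g x : units G x -> gs g = x -> gmul g x = g.
Proof. by move=> _ <-; exact: (gmul_gs GP). Qed.

Lemma gmulKg g h : gs g = gr h -> gmul (ginv g) (gmul g h) = h.
Proof.
move=> gh; rewrite gmulAE ?gsVE// (gmulVg GP) gmul_unitl//; exact: unit_gs.
Qed.

Lemma gmulgK g h : gs g = gr h -> gmul (gmul g h) (ginv h) = g.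
Proof.
move=> gh; rewrite -gmulAE ?grVE// (gmulgV GP) gmul_unitr//; exact: unit_gr.
Qed.

Lemma ginvK g : ginv (ginv g) = g.
Proof.
have := @gmulKg (ginv g) g; rewrite gsVE => /(_ erefl).
by rewrite (gmulVg GP) gmul_unitr// ?gsVE ?grVE //; exact: unit_gs.
Qed.

Lemma gmulgKV g h : gs g = gs h -> gmul (gmul g (ginv h)) h = g.
Proof. by move=> gh; rewrite -{2}[h]ginvK gmulgK// grVE. Qed.

Lemma gmulgI g h k : gs g = gr h -> gs g = gr k -> gmul g h = gmul g k -> h = k.
Proof. by move=> gh gk e; rewrite -(gmulKg gh) e gmulKg. Qed.

Lemma ginvM g h : gs g = gr h -> ginv (gmul g h) = gmul (ginv h) (ginv g).
Proof.
move=> gh; apply: (@gmulgI (gmul g h)).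
- by rewrite grVE.
- by rewrite gsME// grME ?grVE// gsVE gh.
rewrite (gmulgV GP) grME// gmulAE ?gsME ?grVE//; last by rewrite gsVE.
by rewrite gmulgK// (gmulgV GP).
Qed.

Lemma ginv_unit x : units G x -> ginv x = x.
Proof.
move=> ux; have := gmulVg GP x.
by rewrite (gs_unit ux) gmul_unitr// gsVE gr_unit.
Qed.

(** Collapses sums against [unit_section]: a nonzero unit value leaves one possible summation
    index. *)
Lemma gmul_inv_unit g h : gs g = gs h -> units G (gmul g (ginv h)) -> g = h.
Proof.
move=> gh u; rewrite -(gmulgKV gh) gmul_unitl//.
by rewrite -(gs_unit u) gsME ?grVE// gsVE.
Qed.

Lemma gmul_unit_inv g h : gs g = gr h -> units G (gmul g h) -> g = ginv h.
Proof. by move=> gh u; apply: gmul_inv_unit; rewrite ?gsVE ?ginvK. Qed.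

End GroupoidAlgebra.

Section ActorAlgebra.
Variables (G H : etaleGroupoid) (a : actor G H).
Implicit Types (g : G) (x y : H).

(** [rho_mul] for the factorisation of [x] as [gr x] times [x]: the anchor only sees the range. *)
Lemma rho_gr x : rho a (gr x) = rho a x.
Proof.
have := @rho_mul _ _ a (rho a (gr x)) (gr x) x.
rewrite /composable gsrE gmul_unitl//; last exact: unit_gr.
by rewrite (gs_unit (rho_units a _)) => ->.
Qed.

Lemma gs_rho x : gs (rho a x) = rho a x.
Proof. exact/gs_unit/rho_units. Qed.

(** Equivariance for the factorisation of [x] as [gr x] times [x]. The action of [g] is left
    multiplication by the arrow [act a g (gr x)], so questions about actors become questions inside
    [H]. *)
Lemma act_gr g x : gs g = rho a x -> act a g x = gmul (act a g (gr x)) x.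
Proof.
move=> gx; rewrite -act_mul ?rho_gr ?gmul_unitl//; last by rewrite /composable gsrE.
exact: unit_gr.
Qed.

Lemma gr_act g x : gs g = rho a x -> gr (act a g x) = gr (act a g (gr x)).
Proof. by move=> gx; rewrite act_gr// grME// gs_act ?rho_gr// gsrE. Qed.

Lemma actKg g x : gs g = rho a x -> act a (ginv g) (act a g x) = x.
Proof.
move=> gx; rewrite actA ?gsVE// /composable ?gsVE//.
by rewrite (gmulVg (egroupoidP G)) gx act_rho.
Qed.

(** By [act_gr] the left side is [w] times its inverse, [w = act a g (gr x)]. It evaluates the unit
    section at the one index that survives in [actor_conv_comp]. *)
Lemma act_inv g x : gs g = rho a x ->
  act a g (ginv (act a g (gr x))) = gr (act a g x).
Proof.
move=> gx; set w := act a g (gr x).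
have sw : gs w = gr x by rewrite gs_act ?rho_gr// gsrE.
have rw : rho a (ginv w) = rho a x by rewrite -rho_gr grVE sw rho_gr.
by rewrite act_gr ?rw// grVE sw -/w (gmulgV (egroupoidP H)) gr_act.
Qed.

Lemma rho_inv x : rho a (ginv x) = rho a (gs x).
Proof. by rewrite -rho_gr grVE. Qed.

End ActorAlgebra.

(** * Limits along filters and continuity within a domain *)

Lemma cvg_nbhsI (S : Type) (Y : topologicalType) (F : set_system S) (f : S -> Y) (y : Y) :
  (forall W, nbhs y W -> \forall t \near F, W (f t)) -> f @ F --> y.
Proof. exact. Qed.

Lemma cvg_nbhsE (S : Type) (Y : topologicalType) (F : set_system S) (f : S -> Y) (y : Y) W :
  f @ F --> y -> nbhs y W -> \forall t \near F, W (f t).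
Proof. by move=> /(_ W). Qed.

(** The partial operations are continuous only within their domain. An arbitrary filter is allowed
    because later limits run along neighbourhoods, their traces and their images; the arguments need
    only be composable eventually. *)
Lemma cvg_within_comp (X Y : topologicalType) (S : Type) (F : set_system S)
    (D : set X) (phi : X -> Y) (psi : S -> X) (q : X) : Filter F ->
  {within D, continuous phi} -> D q -> (\forall t \near F, D (psi t)) ->
  psi @ F --> q -> (phi \o psi) @ F --> phi q.
Proof.
move=> FF /subspace_continuousP cphi Dq FD psiq W /(cphi _ Dq) /psiq nF.
have {}nF : F (psi @^-1` [set x | D x -> W (phi x)]) by exact: nF.
by apply: filterS2 FD nF => t /= Dt; exact.
Qed.

Lemma continuous_within_at (X Y : topologicalType) (D : set X) (f : X -> Y) :
  (forall x, D x -> f @ x --> f x) -> {within D, continuous f}.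
Proof. by move=> cf; apply: continuous_in_subspaceT => x /set_mem; exact: cf. Qed.

Lemma open_within_cvg (X Y : topologicalType) (S : Type) (F : set_system S)
    (D : set X) (phi : X -> Y) (psi : S -> X) (q : X) : Filter F -> open D ->
  {within D, continuous phi} -> D q -> psi @ F --> q ->
  (phi \o psi) @ F --> phi q.
Proof.
move=> FF oD cphi Dq psiq; apply: (cvg_within_comp FF cphi Dq _ psiq).
by apply: psiq; exact: open_nbhs_nbhs.
Qed.

Lemma compact_image_filter (X Y : topologicalType) (K : set X) (f : X -> Y) :
  (forall x, K x -> f @ within K (nbhs x) --> f x) -> compact K ->
  compact (f @` K).
Proof. by move=> cf; apply: continuous_compact; apply/subspace_continuousP. Qed.

Lemma sub_set_inj (X Y : Type) (A B : set X) (f : X -> Y) :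
  A `<=` B -> set_inj B f -> set_inj A f.
Proof.
by move=> AB injB x y /set_mem Ax /set_mem Ay; apply: injB; apply/mem_set/AB.
Qed.

(** * Topology of étale groupoids *)

Section GroupoidTopology.
Variable G : etaleGroupoid.
Implicit Types (g h x : G) (U V W : set G).
Let GP := egroupoidP G.

Lemma gs_continuous : continuous (@gs G).
Proof. by case: (gs_etale GP). Qed.

Lemma gr_continuous : continuous (@gr G).
Proof. by case: (gr_etale GP). Qed.

(** On an open [U] where [gs] is injective, an arrow [g] with [g] and [gs g] both in [U] has the
    same source as [gs g], hence equals it. *)
Lemma open_units : open (units G).
Proof.
rewrite openE => x ux.
have [_ _ /(_ x)[U [oU Ux injU _]]] := gs_etale GP.
rewrite /interior nbhsE; exists (U `&` @gs G @^-1` U); first split.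
- by apply: openI => //; exact: (open_comp (in1W gs_continuous)).
- by split=> //=; rewrite gs_unit.
by move=> g [Ug /= Usg]; apply: injU; rewrite ?inE// gssE.
Qed.

Lemma nbhs_units x : units G x -> nbhs x (units G).
Proof. by move=> ux; apply: open_nbhs_nbhs; split=> //; exact: open_units. Qed.

Lemma bisection_ex x : exists2 U, open_bisection U & U x.
Proof.
have [_ _ /(_ x)[U [oU Ux injU _]]] := gs_etale GP.
have [_ _ /(_ x)[V [oV Vx injV _]]] := gr_etale GP.
exists (U `&` V) => //; split; first exact: openI.
- exact: sub_set_inj (@subIsetl _ _ _) injU.
- exact: sub_set_inj (@subIsetr _ _ _) injV.
Qed.

Lemma gs_open V : open V -> open (@gs G @` V).
Proof.
move=> oV; rewrite openE => _ [g Vg <-].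
have [_ _ /(_ g)[U [oU Ug injU imU]]] := gs_etale GP.
have [W oW WE] : exists2 W, open W & (@gs G @` (U `&` V)) = W `&` units G.
  by apply: imU; [exact: openI|exact: subIsetl].
have oI : open (@gs G @` (U `&` V)).
  by rewrite WE; apply: openI => //; exact: open_units.
rewrite /interior nbhsE; exists (@gs G @` (U `&` V)); first by split=> //; exists g.
by move=> _ [h [_ Vh] <-]; exists h.
Qed.

Lemma bisection_units : open_bisection (units G).
Proof.
split; first exact: open_units.
- by move=> x y /set_mem ux /set_mem uy; rewrite !gs_unit.
- by move=> x y /set_mem ux /set_mem uy; rewrite !gr_unit.
Qed.

Definition slift U (y : G) : G := xget y [set u | U u /\ gs u = y].

Lemma sliftP U y : (@gs G @` U) y -> U (slift U y) /\ gs (slift U y) = y.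
Proof.
by move=> [u Uu uy]; rewrite /slift; case: xgetP => [v _ []//|/(_ u)[]].
Qed.

Lemma sliftK U u : set_inj U (@gs G) -> U u -> slift U (gs u) = u.
Proof.
move=> injU Uu; have [|V E] := @sliftP U (gs u); first by exists u.
by apply: injU => //; exact: mem_set.
Qed.

(** Openness of [gs]: the part of [U] inside a given neighbourhood of [u] has an open image, and
    over that image the lift stays in the neighbourhood. *)
Lemma slift_cvg U u (S : Type) (F : set_system S) (phi : S -> G) : Filter F ->
  open U -> set_inj U (@gs G) -> U u -> phi @ F --> gs u ->
  (slift U \o phi) @ F --> u.
Proof.
move=> FF oU injU Uu phiu W nW /=.
have oI : open (U `&` W^°) by apply: openI => //; exact: open_interior.
have : nbhs (gs u) (@gs G @` (U `&` W^°)).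
  by apply: open_nbhs_nbhs; split; [exact: gs_open|exists u].
move=> /phiu nF.
have {}nF : F (phi @^-1` (@gs G @` (U `&` W^°))) by exact: nF.
apply: (@filterS _ F) nF => t /= [g [Ug /interior_subset Wg]] <-.
by rewrite sliftK.
Qed.

Lemma near_slift U u (S : Type) (F : set_system S) (phi : S -> G) : Filter F ->
  open U -> U u -> phi @ F --> gs u ->
  \forall t \near F, U (slift U (phi t)) /\ gs (slift U (phi t)) = phi t.
Proof.
move=> FF oU Uu phiu; have : nbhs (gs u) (@gs G @` U).
  by apply: open_nbhs_nbhs; split; [exact: gs_open|exists u].
by move=> /phiu; apply: (@filterS _ F) => t /= /sliftP.
Qed.

Lemma gmul_cvg (S : Type) (F : set_system S) (f k : S -> G) g h : Filter F ->
  gs g = gr h -> (\forall t \near F, gs (f t) = gr (k t)) ->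
  f @ F --> g -> k @ F --> h -> (fun t => gmul (f t) (k t)) @ F --> gmul g h.
Proof.
move=> FF gh fk fg kh.
have := @cvg_within_comp _ _ _ F _ _ (fun t => (f t, k t)) (g, h) FF
  (gmul_continuous GP) gh fk.
by apply; exact: cvg_pair.
Qed.

Lemma ginv_cvg (S : Type) (F : set_system S) (f : S -> G) g : Filter F ->
  f @ F --> g -> (fun t => ginv (f t)) @ F --> ginv g.
Proof. by move=> FF fg; apply: cvg_comp fg _; exact: (ginv_continuous GP). Qed.

Lemma gs_cvg (S : Type) (F : set_system S) (f : S -> G) g : Filter F ->
  f @ F --> g -> (fun t => gs (f t)) @ F --> gs g.
Proof. by move=> FF fg; apply: cvg_comp fg _; exact: gs_continuous. Qed.

(** The Hausdorff axiom concerns the subtype of units; here it is transported to open sets of [G],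
    which are disjoint only after intersecting with the units. *)
Lemma units_separate x y : units G x -> units G y -> x <> y ->
  exists U V, [/\ open U, open V, U x, V y & U `&` V `&` units G = set0].
Proof.
move=> ux uy xy.
pose x' : units G := exist _ x (mem_set ux).
pose y' : units G := exist _ y (mem_set uy).
have x'y' : x' != y' by apply/eqP => /(congr1 val).
have := units_hausdorff GP; rewrite open_hausdorff => /(_ x' y' x'y').
move=> [[A B]] /= [/set_mem Ax /set_mem By] [oA oB /eqP AB].
move: oA oB => [U oU UE] [V oV VE].
exists U, V; split => //.
- by move: Ax; rewrite -UE.
- by move: By; rewrite -VE.
rewrite -subset0 => z [[Uz Vz] uz].
pose z' : units G := exist _ z (mem_set uz).
have : (A `&` B) z' by rewrite -UE -VE.
by rewrite AB.
Qed.

(** The set is the preimage of the diagonal of the Hausdorff unit space. It makes the product of two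
    compact sets compact although [G] itself need not be Hausdorff. *)
Lemma closed_composable : closed [set q : G * G | gs q.1 = gr q.2].
Proof.
rewrite -openC openE => -[g h] /= gh.
have [U [V [oU oV Ux Vy UV]]] := units_separate (unit_gs g) (unit_gr h) gh.
exists (@gs G @^-1` U, @gr G @^-1` V).
  split; apply: open_nbhs_nbhs; split=> //.
    exact: (open_comp (in1W gs_continuous)).
  exact: (open_comp (in1W gr_continuous)).
move=> [g' h'] /= [Ug Vh] E.
have : (U `&` V `&` units G) (gs g') by split; [split=> //; rewrite E|exact: unit_gs].
by rewrite UV.
Qed.

Lemma compact_gmul (K L : set G) : compact K -> compact L ->
  compact [set gmul q.1 q.2 | q in (K `*` L) `&` [set q | gs q.1 = gr q.2]].
Proof.
move=> cK cL; apply: continuous_compact; last first.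
  by apply: compact_closedI; [exact: compact_setX|exact: closed_composable].
apply: continuous_subspaceW (gmul_continuous GP); exact: subIsetr.
Qed.

End GroupoidTopology.

(** * Banach bundles *)

Section BundleTopology.
Variables (R : realType) (X : topologicalType) (E : bundle R X).
Hypothesis UP : is_usc_banach_bundle E.
Local Notation C := R[i].

Lemma inc_inj x : injective (@inc R X E x).
Proof. exact: can_inj (@incK R X E x). Qed.

Lemma inc_fibcoord x (e : E) : bproj e = x -> inc (fibcoord x e) = e.
Proof. exact: coordK. Qed.

Lemma bnormE x (e : E) : bproj e = x -> bnorm e = `|fibcoord x e|.
Proof. by move=> <-. Qed.

Lemma bnorm_inc x (v : fib E x) : bnorm (inc v) = `|v|.
Proof. by rewrite (bnormE (bproj_inc v)) incK. Qed.

Lemma badd_inc x (v w : fib E x) : badd (inc v) (inc w) = inc (v + w).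
Proof.
have H (e e' : E) : bproj e = x -> badd e e' = inc (fibcoord x e + fibcoord x e').
  by move=> <-.
by rewrite (H _ _ (bproj_inc v)) !incK.
Qed.

Lemma bscale_inc z x (v : fib E x) : bscale z (inc v) = inc (z *: v).
Proof.
have H (e : E) : bproj e = x -> bscale z e = inc (z *: fibcoord x e) by move=> <-.
by rewrite (H _ (bproj_inc v)) incK.
Qed.

(** [zero_limit] is applied to the filter generated by the tubes themselves: along it the base point
    tends to [x] and the norm to 0, so each neighbourhood of the zero vector contains a tube. *)
Lemma zero_tube x (W : set E) : nbhs (inc (0 : fib E x)) W ->
  exists (eps : C) (O : set X), [/\ 0 < eps, nbhs x O &
    forall y (v : fib E y), O y -> `|v| < eps -> W (inc v)].
Proof.
move=> nW.
pose D := [set p : C * set X | 0 < p.1 /\ nbhs x p.2].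
pose B (p : C * set X) := [set e : E | p.2 (bproj e) /\ bnorm e < p.1].
have FF : ProperFilter (filter_from D B).
  apply: filter_from_proper; last first.
    move=> [eps O] [/= eps0 nO]; exists (inc (0 : fib E x)) => /=.
    rewrite /B/= bproj_inc bnorm_inc normr0; split=> //; exact: nbhs_singleton nO.
  apply: filter_from_filter; first by exists (1, setT); split=> //; exact: filterT.
  move=> [e1 O1] [e2 O2] [/= e10 nO1] [/= e20 nO2].
  (* The order of [C] is partial; the two radii are positive, hence real and comparable. *)
  have [|] := comparable_leP (real_comparable (gtr0_real e10) (gtr0_real e20)) => h12.
    exists (e1, O1 `&` O2); first by split=> //; exact: filterI.
    by move=> e [/= [? ?] ?]; split; split=> //=; exact: lt_le_trans h12.
  exists (e2, O1 `&` O2); first by split=> //; exact: filterI.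
  by move=> e [/= [? ?] ?]; split; split=> //=; exact: lt_trans h12.
suff [[eps N] [/= eps0 nN] BW] : filter_from D B W.
  exists eps, N; split=> // y v Ny vd; apply: BW.
  by split; rewrite /= ?bproj_inc ?bnorm_inc.
apply: (@zero_limit _ _ _ UP (filter_from D B) x FF _ _ W nW).
- move=> O nO; exists (1, O); first by split.
  by move=> e [].
- apply/cvgrPdist_lt => eps eps0; exists (eps, setT).
    by split=> //; exact: filterT.
  by move=> e [_ /=]; rewrite sub0r normrN ger0_norm// /bnorm.
Qed.

Lemma badd_nbhs x (v w : fib E x) (W : set E) : nbhs (inc (v + w)) W ->
  exists A B, [/\ nbhs (inc v) A, nbhs (inc w) B &
    forall y (v' w' : fib E y), A (inc v') -> B (inc w') -> W (inc (v' + w'))].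
Proof.
move=> nW; have /subspace_continuousP := badd_continuous UP.
have vw : bproj (inc v) = bproj (inc w) by rewrite !bproj_inc.
move=> /(_ (inc v, inc w) vw W); rewrite /from_subspace /= badd_inc => /(_ nW).
move=> [[A B]] /= [nA nB] AB; exists A, B; split=> // y v' w' Av' Bw'.
have := AB (inc v', inc w') (conj Av' Bw').
by rewrite /= !bproj_inc badd_inc => /(_ erefl).
Qed.

(** Relates the norm topology of a fibre to the topology of the total space: write [u] as
    [v + (u - v)] and put the small difference in a tube around zero. *)
Lemma inc_continuous x : continuous (@inc R X E x).
Proof.
move=> v; apply: cvg_nbhsI => W; rewrite -{1}[v]addr0 => /badd_nbhs[A [B [nA nB AB]]].
have [eps [N [eps0 nN H]]] := zero_tube nB.
apply/nbhs_ballP; exists eps => //= u; rewrite -ball_normE /= => uv.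
have := AB x v (u - v); rewrite subrKC; apply; first exact: nbhs_singleton.
by apply: H; [exact: nbhs_singleton|rewrite distrC].
Qed.

(** The usual criterion: [v t] is the convergent [w t] plus an error lying in a tube around zero. It
    serves for scalars that vary and for the fibrewise limits of the square root iteration. *)
Lemma bundle_cvg_approx (S : Type) (F : set_system S) (p : S -> X) (x : X)
    (v : forall t, fib E (p t)) (v0 : fib E x) : Filter F -> p @ F --> x ->
  (forall eps : C, 0 < eps -> exists (w : forall t, fib E (p t)) (w0 : fib E x),
     [/\ (fun t => inc (w t)) @ F --> inc w0,
         \forall t \near F, `|v t - w t| < eps & `|v0 - w0| < eps]) ->
  (fun t => inc (v t)) @ F --> inc v0.
Proof.
move=> FF px app; apply: cvg_nbhsI => W; rewrite -{1}[v0]addr0 => /badd_nbhs[A [B [nA nB AB]]].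
have [eps [N [eps0 nN H]]] := zero_tube nB.
have nA' : nbhs v0 (@inc R X E x @^-1` A^°).
  apply: inc_continuous; exact: nbhs_interior.
have /nbhs_ballP[eps' /= eps'0 bA] := nA'.
(* [eps] keeps the errors in the tube; [eps'] keeps the limit of the approximants within the
   neighbourhood [A] of [v0]. *)
pose d : C := Num.min eps eps'.
have rc : (eps >=< eps')%O by rewrite real_comparable// gtr0_real.
have d0 : 0 < d by rewrite comparable_lt_min// eps0.
have [w [w0 [wF vw vw0]]] := app d d0.
have nAw : nbhs (inc w0) A.
  apply: bA; rewrite -ball_normE /=; apply: lt_le_trans vw0 _.
  by rewrite comparable_ge_min// lexx orbT.
have F1 := cvg_nbhsE wF nAw; have F2 := cvg_nbhsE px nN.
apply: filterS3 F1 F2 vw => t /= At Ot vwt.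
have := AB (p t) (w t) (v t - w t); rewrite subrKC; apply=> //.
by apply: H => //; apply: lt_le_trans vwt _; rewrite comparable_ge_min// lexx.
Qed.

Lemma badd_cvg (S : Type) (F : set_system S) (p : S -> X) (x : X)
    (v w : forall t, fib E (p t)) (v0 w0 : fib E x) : Filter F ->
  (fun t => inc (v t)) @ F --> inc v0 -> (fun t => inc (w t)) @ F --> inc w0 ->
  (fun t => inc (v t + w t)) @ F --> inc (v0 + w0).
Proof.
move=> FF vF wF; apply: cvg_nbhsI => W /badd_nbhs[A [B [nA nB AB]]].
by apply: filterS2 (cvg_nbhsE vF nA) (cvg_nbhsE wF nB) => t /=; exact: AB.
Qed.

Lemma near_bnorm_lt (S : Type) (F : set_system S) (p : S -> X) (x : X)
    (v : forall t, fib E (p t)) (v0 : fib E x) (M : C) : Filter F ->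
  (fun t => inc (v t)) @ F --> inc v0 -> `|v0| < M ->
  \forall t \near F, `|v t| < M.
Proof.
move=> FF vF vM.
have nM : nbhs (inc v0) [set e : E | bnorm e < M].
  apply: open_nbhs_nbhs; split; first exact: bnorm_usc.
  by rewrite /= bnorm_inc.
by apply: filterS (cvg_nbhsE vF nM) => t /=; rewrite bnorm_inc.
Qed.

(** The bundle axiom gives continuity for one fixed scalar. The difference from [z0 *: v t] is
    [|z t - z0| * |v t|], and upper semicontinuity keeps [|v t|] below [|v0| + 1]. *)
Lemma bscale_cvg (S : Type) (F : set_system S) (p : S -> X) (x : X) (z : S -> C)
    (z0 : C) (v : forall t, fib E (p t)) (v0 : fib E x) : Filter F ->
  z @ F --> (z0 : C^o) -> (fun t => inc (v t)) @ F --> inc v0 ->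
  (fun t => inc (z t *: v t)) @ F --> inc (z0 *: v0).
Proof.
move=> FF zF vF.
have pF : p @ F --> x.
  have := cvg_comp _ _ vF (@bproj_continuous _ _ _ UP (inc v0)).
  rewrite bproj_inc; apply: cvg_trans; apply: near_eq_cvg; apply: nearW => t /=.
  by rewrite bproj_inc.
apply: (bundle_cvg_approx FF pF) => eps eps0.
exists (fun t => z0 *: v t), (z0 *: v0); split; last by rewrite subrr normr0.
  have := cvg_comp _ _ vF (@bscale_continuous _ _ _ UP z0 (inc v0)).
  rewrite bscale_inc; apply: cvg_trans; apply: near_eq_cvg; apply: nearW => t /=.
  by rewrite bscale_inc.
have M0 : 0 < `|v0| + 1 by rewrite ltr_wpDl.
have vM := near_bnorm_lt FF vF (ltr_pwDr ltr01 (lexx `|v0|)).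
have [zd _] := @cvgrPdist_lt _ C^o _ F FF z z0.
have {}zd := zd zF _ (divr_gt0 eps0 M0).
apply: filterS2 vM zd => t /= vt zt.
rewrite -scalerBl normrZ distrC.
have [->|vt0] := eqVneq `|v t| 0; first by rewrite mulr0.
apply: (@lt_trans _ _ (eps / (`|v0| + 1) * `|v t|)).
  by rewrite ltr_pM2r// lt_def vt0 normr_ge0.
by rewrite -[ltRHS](divfK (lt0r_neq0 M0)) ltr_pM2l// divr_gt0.
Qed.

Lemma ge0_Re (z : C) : 0 <= z -> z = (complex.Re z)%:C.
Proof. by case: z => a b; rewrite lecE /= => /andP[/eqP -> _]. Qed.

(** Upper semicontinuity bounds the norm near each point. The near-covering form of compactness,
    with a parameter tending to infinity, turns these into one bound without choosing a finite
    subcover. *)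
Lemma bundle_bounded (K : set X) (f : forall x, fib E x) : compact K ->
  (forall x, K x -> (fun y => inc (f y)) @ x --> inc (f x)) ->
  exists M : R, forall x, K x -> `|f x| <= M%:C.
Proof.
move=> /compact_near_coveringP cK cf.
have := cK R (pinfty_nbhs R) (fun r x => `|f x| < r%:C) _.
case=> [x Kx|M [Mr H]].
  pose r := complex.Re `|f x| + 1.
  have fr : `|f x| < r%:C.
    by rewrite (ge0_Re (normr_ge0 _)) ltcR /r ltrDl.
  have := near_bnorm_lt _ (cf _ Kx) fr.
  move=> n1; exists ([set y | `|f y| < r%:C], [set s | r < s]).
    split; first exact: n1.
    by apply: nbhs_pinfty_gt; exact: num_real.
  by move=> [y s] [/= ys rs]; apply: lt_trans ys _; rewrite ltcR.
exists (M + 1) => x Kx; apply/ltW/(H (M + 1)) => //.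
by rewrite ltrDl.
Qed.

End BundleTopology.

(** * Finitely supported sums and linear maps *)

Lemma fsum_additive (U V : zmodType) (I : choiceType) (L : U -> V) (A : set I)
    (v : I -> U) : (forall a b, L (a + b) = L a + L b) ->
  finite_set (A `&` [set i | v i <> 0]) ->
  L (\sum_(i \in A) v i) = \sum_(i \in A) L (v i).
Proof.
move=> LD fA; have L0 : L 0 = 0.
  by apply: (@addrI _ (L 0)); rewrite -LD !addr0.
set B := A `&` _ in fA.
have -> : \sum_(i \in A) v i = \sum_(i \in B) v i.
  apply/esym/fsbig_widen; first exact: subIsetl.
  by move=> i [Ai /not_andP[]//= /contrapT].
have -> : \sum_(i \in A) L (v i) = \sum_(i \in B) L (v i).
  apply/esym/fsbig_widen; first exact: subIsetl.
  by move=> i [Ai /not_andP[]//= /contrapT ->].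
by rewrite !fsbig_finite//; exact: (big_morph L LD L0).
Qed.

(** Both index sets are first cut down to finite ones outside of which [F] vanishes; only there may
    the order be changed, as a sum with infinite support has the value 0 by convention. *)
Lemma fsum_exchange (V : zmodType) (I J : choiceType) (P A : set I) (Q : set J)
    (F : I -> J -> V) : finite_set A ->
  (forall i, P i -> A i -> finite_set (Q `&` [set j | F i j <> 0])) ->
  (forall i j, P i -> Q j -> F i j <> 0 -> A i) ->
  \sum_(i \in P) \sum_(j \in Q) F i j = \sum_(j \in Q) \sum_(i \in P) F i j.
Proof.
move=> fA fB FA.
pose P' := P `&` A.
pose B := \bigcup_(i in P') (Q `&` [set j | F i j <> 0]).
have fP : finite_set P' by exact: finite_setIr.
have fBB : finite_set B by apply: bigcup_finite => // i [Pi Ai]; exact: fB.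
have BQ : B `<=` Q by move=> j [i _ []].
have F0 i j : P i -> Q j -> ~ (A i /\ B j) -> F i j = 0.
  move=> Pi Qj nAB; apply: contrapT => Fij; apply: nAB.
  by have Ai := FA _ _ Pi Qj Fij; split=> //; exists i.
have -> : \sum_(i \in P) \sum_(j \in Q) F i j =
    \sum_(i \in P') \sum_(j \in B) F i j.
  transitivity (\sum_(i \in P') \sum_(j \in Q) F i j).
    apply/esym/fsbig_widen; first exact: subIsetl.
    move=> i [Pi /not_andP[]//= nAi]; apply: fsbig1 => j Qj.
    by apply: F0 => // -[].
  apply: eq_fsbigr => i /set_mem[Pi _]; apply/esym/fsbig_widen => //.
  by move=> j [Qj nB]; apply: F0 => // -[].
rewrite exchange_fsbig//.
transitivity (\sum_(j \in B) \sum_(i \in P) F i j).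
  apply: eq_fsbigr => j /set_mem Bj; apply: fsbig_widen; first exact: subIsetl.
  by move=> i [Pi /not_andP[]// nAi]; apply: F0 => //; [exact: BQ|case].
apply: fsbig_widen => // j [Qj nB]; apply: fsbig1 => i Pi.
by apply: F0 => // -[].
Qed.

Lemma fsum_single (V : zmodType) (I : choiceType) (A : set I) (v : I -> V) i :
  A i -> (forall j, A j -> j <> i -> v j = 0) -> \sum_(j \in A) v j = v i.
Proof.
move=> Ai v0; transitivity (\sum_(j \in [set i]) v j); last by rewrite fsbig_set1.
apply/esym/fsbig_widen; first by move=> _ ->.
by move=> j [Aj ji]; exact: v0.
Qed.

Section LinearMaps.
Variables (K : pzRingType) (U V : lmodType K) (L : U -> V).
Hypothesis Llin : linear L.

Lemma lin_add u v : L (u + v) = L u + L v.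
Proof. by have := Llin 1 u v; rewrite !scale1r. Qed.

Lemma lin_0 : L 0 = 0.
Proof. by apply: (@addrI _ (L 0)); rewrite -lin_add !addr0. Qed.

Lemma lin_scale z u : L (z *: u) = z *: L u.
Proof. by have := Llin z u 0; rewrite lin_0 !addr0. Qed.

Lemma lin_sub u v : L (u - v) = L u - L v.
Proof. by rewrite -scaleN1r lin_add lin_scale scaleN1r. Qed.

End LinearMaps.

(** * Fell bundles and Fell actors *)

Section FellAlgebra.
Variables (R : realType) (G : etaleGroupoid) (E : fellData R G).
Hypothesis EP : is_fell_bundle E.
Implicit Types (g h k : G) (e : E).

Lemma bproj_fmul (e1 e2 : E) g : gs (bproj e1) = gr (bproj e2) ->
  gmul (bproj e1) (bproj e2) = g -> bproj (fmul e1 e2) = g.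
Proof. by move=> c <-; exact: bproj_mul. Qed.

(** The target fibre is a variable [k] with an equation: fibres over provably equal arrows are
    different types, and reading the product through [fibcoord k] avoids transports. *)
Lemma fmul_linl g k e : gs g = gr (bproj e) -> gmul g (bproj e) = k ->
  linear (fun v : fib E g => fibcoord k (fmul (inc v) e)).
Proof.
move=> c <- z u v; have [lin _] := fibmul_bilinear EP c.
have := lin (fibcoord (bproj e) e) z u v.
by rewrite /fibmul inc_fibcoord.
Qed.

Lemma fmul_linr h k e : gs (bproj e) = gr h -> gmul (bproj e) h = k ->
  linear (fun v : fib E h => fibcoord k (fmul e (inc v))).
Proof.
move=> c <- z u v; have [_ lin] := fibmul_bilinear EP c.
have := lin (fibcoord (bproj e) e) z u v.
by rewrite /fibmul inc_fibcoord.
Qed.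

Lemma fstar_conjlin g k : ginv g = k ->
  is_conj_linear (fun v : fib E g => fibcoord k (fstar (inc v))).
Proof. by move=> <- z u v; exact: (fibstar_conj_linear EP). Qed.

End FellAlgebra.

Section FellActorAlgebra.
Variables (R : realType) (G H : etaleGroupoid) (E : fellData R G) (F : fellData R H).
Variable A : fellActorData E F.
Hypothesis AP : is_fell_actor A.
Implicit Types (e : E) (f : F).

Lemma bproj_famE e f x : gs (bproj e) = rho A (bproj f) ->
  act A (bproj e) (bproj f) = x -> bproj (fam A e f) = x.
Proof. by move=> c <-; exact: bproj_fam. Qed.

Lemma fam_linl g x f : gs g = rho A (bproj f) -> act A g (bproj f) = x ->
  linear (fun v : fib E g => fibcoord x (fam A (inc v) f)).
Proof.
move=> c <- z u v; have [lin _] := nabla_bilinear AP c.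
have := lin (fibcoord (bproj f) f) z u v.
by rewrite /nabla inc_fibcoord.
Qed.

Lemma fam_linr y x e : gs (bproj e) = rho A y -> act A (bproj e) y = x ->
  linear (fun v : fib F y => fibcoord x (fam A e (inc v))).
Proof.
move=> c <- z u v; have [_ lin] := nabla_bilinear AP c.
have := lin (fibcoord (bproj e) e) z u v.
by rewrite /nabla inc_fibcoord.
Qed.

End FellActorAlgebra.

(* Summability condition under which the finitely supported sums below, which
   are 0 on infinite supports, behave as sums. *)
Definition rfin (R : realType) (G : etaleGroupoid) (E : fellData R G)
    (f : sections E) : Prop :=
  forall y, finite_set [set g | gr g = y /\ f g <> 0].

Lemma rfin_inv (R : realType) (G : etaleGroupoid) (E : fellData R G)
    (f : sections E) y : rfin f ->
  finite_set [set g | gs g = y /\ f (ginv g) <> 0].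
Proof.
move=> /(_ y) ff; apply: sub_finite_set (finite_image (@ginv G) ff) => g [gy fg].
by exists (ginv g); rewrite /= ?ginvK// grVE.
Qed.

(** The operator [L_A(f)] of the overview, defined for arbitrary sections so that it can be applied
    to [unit_section]. *)
Definition actor_conv (R : realType) (G H : etaleGroupoid) (E : fellData R G)
    (F : fellData R H) (A : fellActorData E F) (f : sections E) (u : sections F)
    : sections F := fun x =>
  \sum_(g \in [set g : G | gs g = rho A x])
    fibcoord x (fam A (inc (f (ginv g))) (inc (u (act A g x)))).

(** The substitution [d = k w^-1] makes the index set at [w x] the one at [x], hence independent of
    [w]; this is what permits the exchange of sums in [actor_conv_convr]. *)
Lemma convolution_shift (R : realType) (G : etaleGroupoid) (E : fellData R G)
    (v u : sections E) (w x : G) : gs w = gr x ->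
  convolution v u (gmul w x) = \sum_(k \in [set k : G | gs k = gr x])
    fibcoord (gmul w x) (fmul (inc (v (gmul w (ginv k)))) (inc (u (gmul k x)))).
Proof.
move=> wx; rewrite /convolution.
rewrite (reindex_fsbig (fun k => gmul k (ginv w)) [set k : G | gs k = gr x]).
  apply: eq_fsbigr => k /set_mem /= kx.
  rewrite ginvM ?grVE ?ginvK ?wx// gmulAE ?gmulgKV ?wx//.
  by rewrite gsME ?gsVE// grVE wx.
split.
- by move=> d dx; rewrite /= grME// gsME ?gsVE// grVE wx.
- move=> d d' /set_mem /= dx /set_mem /= d'x e.
  by rewrite -(@gmulgKV _ d w) ?dx// e gmulgKV// d'x.
- move=> k /= kz; rewrite grME// in kz.
  by exists (gmul k w); [rewrite /= gsME|rewrite gmulgK].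
Qed.

Section ActorConvolution.
Variables (R : realType) (G H : etaleGroupoid) (E : fellData R G) (F : fellData R H).
Variable A : fellActorData E F.
Hypotheses (EP : is_fell_bundle E) (FP : is_fell_bundle F) (AP : is_fell_actor A).

(** [L_A] is multiplicative. Both sides are the double sum of [T d h], joined by the associativity
    axiom [famM]; for the identity actor this is associativity of convolution. *)
Lemma actor_conv_convl (f g : sections E) (u : sections F) : rfin f -> rfin g ->
  actor_conv A (convolution f g) u = actor_conv A f (actor_conv A g u).
Proof.
move=> ff fg; apply: functional_extensionality_dep => x.
pose D := [set d : G | gs d = rho A x].
pose S d h := fibcoord (act A h x)
  (fam A (inc (g (gmul h (ginv d)))) (inc (u (act A d x)))).
pose T d h := fibcoord x (fam A (inc (f (ginv h))) (inc (S d h))).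
have hdE h d : D h -> D d -> gs h = gr (ginv d) by rewrite grVE => -> ->.
have act_hd h d : D h -> D d ->
    act A (gmul h (ginv d)) (act A d x) = act A h x.
  move=> hx dx; rewrite actA; first by rewrite gmulgKV// dx.
    by rewrite /composable gsME ?gsVE//; exact: hdE.
  by [].
have shd h d : D h -> D d -> gs (gmul h (ginv d)) = rho A (act A d x).
  by move=> hx dx; rewrite gsME ?rho_act ?gsVE//; exact: hdE.
(* For fixed [h] the arrow [h d^-1] has range [gr h], over which [g] has finitely many nonzero
   values, and [d] is recovered from it. *)
have fS h : D h -> finite_set (D `&` [set d | S d h <> 0]).
  move=> hx; apply: sub_finite_set
    (finite_image (fun k => gmul (ginv k) h) (fg (gr h))) => d [dx nz].
  exists (gmul h (ginv d)).
    split; first by rewrite grME//; exact: hdE.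
    move=> g0; apply: nz; rewrite /S g0 (lin_0 (fam_linl AP _ _)) ?bproj_inc//.
      exact: shd.
    exact: act_hd.
  by rewrite ginvM ?ginvK ?gmulgKV ?dx//; exact: hdE.
have Llin h : D h -> linear (fun v : fib F (act A h x) =>
    fibcoord x (fam A (inc (f (ginv h))) (inc v))).
  by move=> hx; apply: (fam_linr AP); rewrite ?bproj_inc ?gsVE ?rho_act ?actKg.
have fT d h : D h -> T d h <> 0 -> f (ginv h) <> 0.
  move=> hx nz f0; apply: nz; rewrite /T f0 (lin_0 (fam_linl AP _ _)) ?bproj_inc//.
    by rewrite gsVE rho_act.
  by rewrite actKg.
transitivity (\sum_(d \in D) \sum_(h \in D) T d h).
  apply: eq_fsbigr => d /set_mem dx.
  have -> : convolution f g (ginv d) = \sum_(h \in D) fibcoord (ginv d)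
      (fmul (inc (f (ginv h))) (inc (g (gmul h (ginv d))))).
    by apply: eq_fsbigl; apply/seteqP; split=> h /=; rewrite grVE dx.
  have Ml : linear (fun v : fib E (ginv d) =>
      fibcoord x (fam A (inc v) (inc (u (act A d x))))).
    by apply: fam_linl; rewrite ?bproj_inc ?gsVE ?rho_act ?actKg.
  have c1 h : D h -> gs (ginv h) = gr (gmul h (ginv d)).
    by move=> hx; rewrite gsVE grME//; exact: hdE.
  rewrite (fsum_additive (lin_add Ml)); last first.
    apply: sub_finite_set (rfin_inv (rho A x) ff) => h [hx nz]; split=> // f0.
    apply: nz; rewrite f0 (lin_0 (fmul_linl EP _ _)) ?bproj_inc//; first exact: c1.
    by rewrite gmulKg//; exact: hdE.
  apply: eq_fsbigr => h /set_mem hx; rewrite /T /S.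
  rewrite !inc_fibcoord.
  - rewrite (famM AP)// /bcomposable /composable /fa_dom ?bproj_inc; first exact: c1.
    exact: shd.
  - by apply: (bproj_famE AP); rewrite !bproj_inc; [exact: shd|exact: act_hd].
  - apply: (bproj_fmul EP); rewrite ?bproj_inc; first exact: c1.
    by rewrite gmulKg//; exact: hdE.
transitivity (\sum_(h \in D) \sum_(d \in D) T d h).
  apply/esym/(fsum_exchange (A := [set h | gs h = rho A x /\ f (ginv h) <> 0])).
  - exact: rfin_inv.
  - move=> h hx _; apply: sub_finite_set (fS h hx) => d [dx nz]; split=> // S0.
    by apply: nz; rewrite /T S0 (lin_0 (Llin _ _)).
  - by move=> h d hx dx nz; split=> //; exact: fT nz.
apply: eq_fsbigr => h /set_mem hx.
pose z := act A h x.
have -> : actor_conv A g u z = \sum_(d \in D) S d h.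
  rewrite /actor_conv (reindex_fsbig (fun d => gmul d (ginv h)) D).
    apply: eq_fsbigr => d /set_mem dx.
    rewrite ginvM ?grVE ?ginvK ?dx//.
    by rewrite /z actA ?gmulgKV ?dx// /composable gsME ?gsVE// grVE dx.
  split.
  - by move=> d dx; rewrite /= /z rho_act// gsME ?gsVE// grVE dx.
  - move=> d d' /set_mem dx /set_mem d'x e.
    by rewrite -(@gmulgKV _ d h) ?dx// e gmulgKV// d'x.
  - move=> k /= kz; rewrite /z rho_act// in kz.
    by exists (gmul k h); [rewrite /D /= gsME|rewrite gmulgK].
by rewrite (fsum_additive (lin_add (Llin _ hx)))//; exact: fS.
Qed.

(** [L_A(f)] commutes with right convolution. Since [g] acts as left multiplication by [w g],
    [convolution_shift] makes the inner index set [Q] the same for all [g]; the terms then agree by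
    [fam_mul]. *)
Lemma actor_conv_convr (f : sections E) (v u : sections F) : rfin f -> rfin v ->
  actor_conv A f (convolution v u) = convolution (actor_conv A f v) u.
Proof.
move=> ff fv; apply: functional_extensionality_dep => x.
pose D := [set g : G | gs g = rho A x].
pose Q := [set k : H | gs k = gr x].
pose w g := act A g (gr x).
have sw g : D g -> gs (w g) = gr x by move=> gx; rewrite gs_act ?rho_gr// gsrE.
have aE g : D g -> act A g x = gmul (w g) x by exact: act_gr.
have rk k : Q k -> rho A (ginv k) = rho A x by move=> kx; rewrite rho_inv kx rho_gr.
have aE' g k : D g -> Q k -> act A g (ginv k) = gmul (w g) (ginv k).
  by move=> gx kx; rewrite act_gr ?rk// grVE kx.
have wk g k : D g -> Q k -> gs (w g) = gr (ginv k).
  by move=> gx kx; rewrite sw// grVE kx.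
pose S g k := fibcoord (act A g x)
  (fmul (inc (v (gmul (w g) (ginv k)))) (inc (u (gmul k x)))).
pose T g k := fibcoord x (fam A (inc (f (ginv g))) (inc (S g k))).
have wkx g k : D g -> Q k -> gmul (gmul (w g) (ginv k)) (gmul k x) = act A g x.
  move=> gx kx; rewrite gmulAE//; last by rewrite gsME ?gsVE//; exact: wk.
  by rewrite gmulgKV ?aE// sw// kx.
have Slin g k : D g -> Q k -> linear (fun a : fib F (gmul (w g) (ginv k)) =>
    fibcoord (act A g x) (fmul (inc a) (inc (u (gmul k x))))).
  move=> gx kx; apply: fmul_linl; rewrite ?bproj_inc//.
    by rewrite gsME ?gsVE ?grME//; exact: wk.
  exact: wkx.
have fS g : D g -> finite_set (Q `&` [set k | S g k <> 0]).
  move=> gx; apply: sub_finite_set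
    (finite_image (fun k => gmul (ginv k) (w g)) (fv (gr (w g)))) => k [kx nz].
  exists (gmul (w g) (ginv k)).
    split; first by rewrite grME//; exact: wk.
    by move=> v0; apply: nz; rewrite /S v0 (lin_0 (Slin _ _ gx kx)).
  rewrite ginvM; last exact: wk.
  by rewrite ginvK gmulgKV// kx sw.
have Llin g : D g -> linear (fun a : fib F (act A g x) =>
    fibcoord x (fam A (inc (f (ginv g))) (inc a))).
  by move=> hx; apply: (fam_linr AP); rewrite ?bproj_inc ?gsVE ?rho_act ?actKg.
have fT g k : D g -> T g k <> 0 -> f (ginv g) <> 0.
  move=> gx nz f0; apply: nz; rewrite /T f0 (lin_0 (fam_linl AP _ _)) ?bproj_inc//.
    by rewrite gsVE rho_act.
  by rewrite actKg.
transitivity (\sum_(g \in D) \sum_(k \in Q) T g k).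
  apply: eq_fsbigr => g /set_mem gx.
  have -> : convolution v u (act A g x) = \sum_(k \in Q) S g k.
    by rewrite /S aE// convolution_shift// sw.
  by rewrite (fsum_additive (lin_add (Llin _ gx)))//; exact: fS.
transitivity (\sum_(k \in Q) \sum_(g \in D) T g k).
  apply: (fsum_exchange (A := [set h | gs h = rho A x /\ f (ginv h) <> 0])).
  - exact: rfin_inv.
  - move=> g gx _; apply: sub_finite_set (fS g gx) => k [kx nz]; split=> // S0.
    by apply: nz; rewrite /T S0 (lin_0 (Llin _ _)).
  - by move=> g k gx kx nz; split=> //; exact: fT nz.
apply: eq_fsbigr => k /set_mem kx; rewrite /actor_conv.
have -> : [set g : G | gs g = rho A (ginv k)] = D.
  by apply/seteqP; split=> g; rewrite /D /= rk.
have act1 g : D g -> act A (ginv g) (gmul (w g) (ginv k)) = ginv k.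
  by move=> gx; rewrite -aE'// actKg// rk.
have sg g : D g -> gs (ginv g) = rho A (gmul (w g) (ginv k)).
  by move=> gx; rewrite -aE'// gsVE rho_act// rk.
have kkx : gmul (ginv k) (gmul k x) = x by rewrite gmulKg.
have Ml : linear (fun a : fib F (ginv k) =>
    fibcoord x (fmul (inc a) (inc (u (gmul k x))))).
  by apply: fmul_linl; rewrite ?bproj_inc// gsVE grME.
rewrite (fsum_additive (lin_add Ml)); last first.
  apply: sub_finite_set (rfin_inv (rho A x) ff) => g [gx nz]; split=> // f0.
  apply: nz; rewrite f0 (lin_0 (fam_linl AP _ _)) ?bproj_inc ?aE'//; first exact: sg.
  exact: act1.
apply: eq_fsbigr => g /set_mem gx; rewrite /T /S !inc_fibcoord.
- rewrite (fam_mul AP) ?aE'//.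
    by rewrite /fa_dom !bproj_inc; exact: sg.
  rewrite /bcomposable /composable !bproj_inc gsME ?gsVE ?grME//; exact: wk.
- apply: (bproj_famE AP); rewrite !bproj_inc ?aE'//; [exact: sg|exact: act1].
- apply: (bproj_fmul FP); rewrite !bproj_inc; last exact: wkx.
  by rewrite gsME ?gsVE ?grME//; exact: wk.
Qed.

End ActorConvolution.

Lemma conj_lin_add (K : numClosedFieldType) (U V : lmodType K) (L : U -> V) :
  is_conj_linear L -> forall u v, L (u + v) = L u + L v.
Proof. by move=> Llin u v; have := Llin 1 u v; rewrite conjC1 !scale1r. Qed.

Lemma conj_lin_0 (K : numClosedFieldType) (U V : lmodType K) (L : U -> V) :
  is_conj_linear L -> L 0 = 0.
Proof.
by move=> Llin; apply: (@addrI _ (L 0)); rewrite -(conj_lin_add Llin) !addr0.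
Qed.

Section StarSections.
Variables (R : realType) (G : etaleGroupoid) (E : fellData R G).
Hypothesis EP : is_fell_bundle E.

Lemma inc_sec_star (f : sections E) x :
  inc (sec_star f x) = fstar (inc (f (ginv x))).
Proof.
by rewrite /sec_star inc_fibcoord// (bproj_star EP) bproj_inc ginvK.
Qed.

Lemma sec_starK (f : sections E) : sec_star (sec_star f) = f.
Proof.
apply: functional_extensionality_dep => x; apply: inc_inj.
by rewrite !inc_sec_star (fstarK EP) ginvK.
Qed.

Lemma sec_star_conv (f g : sections E) : rfin f ->
  sec_star (convolution f g) = convolution (sec_star g) (sec_star f).
Proof.
move=> ff; apply: functional_extensionality_dep => x.
have Ml := @fstar_conjlin _ _ _ EP _ _ (ginvK x).
rewrite {1}/sec_star /convolution (fsum_additive (conj_lin_add Ml)); last first.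
  apply: sub_finite_set (rfin_inv (gr (ginv x)) ff) => h [hx nz]; split=> // f0.
  apply: nz; rewrite /= in hx.
  rewrite f0 (lin_0 (fmul_linl EP _ _)) ?bproj_inc//; first by rewrite gsVE grME.
  by rewrite gmulKg.
rewrite [RHS](reindex_fsbig (fun h => gmul h (ginv x)) [set h | gs h = gr (ginv x)]).
  apply: eq_fsbigr => h /set_mem /= hx.
  rewrite !inc_sec_star inc_fibcoord; last first.
    by apply: (bproj_fmul EP); rewrite !bproj_inc ?gmulKg// gsVE grME.
  rewrite (fstarM EP); last by rewrite /bcomposable /composable !bproj_inc gsVE grME.
  by rewrite ginvK gmulgKV// hx grVE.
split.
- by move=> h /= hx; rewrite gsME// gsVE.
- move=> h h' /set_mem /= hx /set_mem /= h'x e.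
  rewrite grVE in hx h'x.
  by rewrite -(@gmulgKV _ h x) ?hx// e gmulgKV// h'x.
- move=> k /= kx; exists (gmul k x); last by rewrite gmulgK.
  by rewrite /= gsME// grVE.
Qed.

End StarSections.

Section UnitSection.
Variables (R : realType) (G : etaleGroupoid) (E : fellData R G) (one : G -> E).
Hypotheses (EP : is_fell_bundle E) (CP : is_categorical one).

Definition unit_section : sections E := fun x =>
  if `[< units G x >] then fibcoord x (one x) else 0.

Lemma inc_unit_section x : units G x -> inc (unit_section x) = one x.
Proof.
move=> ux; rewrite /unit_section asboolT// inc_fibcoord//.
exact: (bproj_one CP).
Qed.

Lemma unit_section_out x : ~ units G x -> unit_section x = 0.
Proof. by move=> ux; rewrite /unit_section asboolF. Qed.

Lemma unit_section_neq0 x : unit_section x <> 0 -> units G x.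
Proof. by move=> nz; apply: contrapT => /unit_section_out. Qed.

Lemma rfin_unit_section : rfin unit_section.
Proof.
move=> y; apply: (@sub_finite_set _ _ [set y]); last exact: finite_set1.
by move=> g /= [gy /unit_section_neq0 ug]; rewrite -gy gr_unit.
Qed.

Lemma fmul_onel x (v : fib E x) y : y = gr x -> fmul (one y) (inc v) = inc v.
Proof. by move=> ->; have := mul1 CP (inc v); rewrite bproj_inc. Qed.

Lemma fmul_oner x (v : fib E x) y : y = gs x -> fmul (inc v) (one y) = inc v.
Proof. by move=> ->; have := mul_1 CP (inc v); rewrite bproj_inc. Qed.

Lemma conv_unitl (u : sections E) : convolution unit_section u = u.
Proof.
apply: functional_extensionality_dep => x; rewrite /convolution.
have ur := unit_gr x.
rewrite (fsum_single (i := gr x)) /=; last 2 first.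
- exact: gsrE.
- move=> h hx hn; rewrite unit_section_out; last first.
    by move=> u1; apply: hn; rewrite -hx -[h]ginvK (ginv_unit u1) (gs_unit u1).
  by rewrite (lin_0 (fmul_linl EP _ _)) ?bproj_inc ?gmulKg// gsVE grME.
by rewrite ginv_unit// gmul_unitl// inc_unit_section// fmul_onel// incK.
Qed.

Lemma conv_unitr (f : sections E) : convolution f unit_section = f.
Proof.
apply: functional_extensionality_dep => x; rewrite /convolution.
rewrite (fsum_single (i := ginv x)) /=; last 2 first.
- exact: gsVE.
- move=> h hx hn; rewrite [unit_section _]unit_section_out; last first.
    move=> u1; apply: hn; apply: gmul_inv_unit; first by rewrite gsVE.
    by rewrite ginvK.
  by rewrite (lin_0 (fmul_linr EP _ _)) ?bproj_inc ?gmulKg// gsVE grME.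
rewrite ginvK (gmulVg (egroupoidP G)) inc_unit_section; last exact: unit_gs.
by rewrite fmul_oner// incK.
Qed.

(** Apply the involution to [1 1^* = 1^*]. *)
Lemma fstar_one y : units G y -> fstar (one y) = one y.
Proof.
move=> uy; have py := bproj_one CP uy.
have ps : bproj (fstar (one y)) = y by rewrite (bproj_star EP) py ginv_unit.
have H : fmul (one y) (fstar (one y)) = fstar (one y).
  by have := mul1 CP (fstar (one y)); rewrite ps gr_unit.
rewrite -[RHS](fstarK EP) -{2}H (fstarM EP) ?(fstarK EP) ?H//.
by rewrite /bcomposable /composable ps py gs_unit// gr_unit.
Qed.

End UnitSection.

Section ActorUnit.
Variables (R : realType) (G H : etaleGroupoid) (E : fellData R G) (F : fellData R H).
Variables (A : fellActorData E F) (one : H -> F).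
Hypotheses (EP : is_fell_bundle E) (FP : is_fell_bundle F) (AP : is_fell_actor A).
Hypothesis CP : is_categorical one.

(** [fam_mul] for [1 f]. The bundle counterpart of [act_gr]: acting by [xi] is left multiplication
    by the vector obtained from the unit of the fibre over [gr (bproj f)]. *)
Lemma fam_one (xi : E) (f : F) : fa_dom A xi f ->
  fmul (fam A xi (one (gr (bproj f)))) f = fam A xi f.
Proof.
move=> d; rewrite -(fam_mul AP) ?(mul1 CP)//.
  by rewrite /fa_dom (bproj_one CP) ?rho_gr//; exact: unit_gr.
by rewrite /bcomposable /composable (bproj_one CP) ?gsrE//; exact: unit_gr.
Qed.

(** [fam_adjoint] tested on the units at both ends, where all multiplications by units cancel. *)
Lemma fam_star_one (xi : E) y : units H y -> gs (bproj xi) = rho A y ->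
  fstar (fam A xi (one y)) =
  fam A (fstar xi) (one (gr (act A (bproj xi) y))).
Proof.
move=> uy xy; have py := bproj_one CP uy.
set z := act A (bproj xi) y.
have sz : gs z = y by rewrite /z gs_act// gs_unit.
have rz : rho A z = gr (bproj xi) by rewrite /z rho_act.
have uz := unit_gr z; have pz := bproj_one CP uz.
have sV : gs (ginv (bproj xi)) = rho A (gr z) by rewrite gsVE rho_gr.
have wE : act A (ginv (bproj xi)) (gr z) = ginv z.
  apply: gmul_unit_inv; first by rewrite gs_act// gsrE.
  by rewrite -act_gr ?gsVE// /z actKg.
have p1 : bproj (fstar (fam A xi (one y))) = ginv z.
  by rewrite (bproj_star FP) (bproj_famE AP (x := z))// py.
have p2 : bproj (fam A (fstar xi) (one (gr z))) = ginv z.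
  by apply: (bproj_famE AP); rewrite pz (bproj_star EP).
have := fam_adjoint AP (xi := xi) (f := one y) (g := one (gr z)).
rewrite /fa_dom py pz -/z grrE => /(_ xy erefl).
have -> : fmul (fstar (fam A xi (one y))) (one (gr z)) = fstar (fam A xi (one y)).
  by have := mul_1 CP (fstar (fam A xi (one y))); rewrite p1 gsVE.
rewrite (fstar_one FP CP uy) => ->.
by have := mul1 CP (fam A (fstar xi) (one (gr z))); rewrite p2 grVE sz.
Qed.

(** Inversion matches the contributing terms of the two sums, and [fam_star_one] compares them one
    by one. *)
Lemma actor_conv_star (f : sections E) : rfin f ->
  actor_conv A (sec_star f) (unit_section one) =
  sec_star (actor_conv A f (unit_section one)).
Proof.
move=> ff; apply: functional_extensionality_dep => x.
have Ml := @fstar_conjlin _ _ _ FP _ _ (ginvK x).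
have su := unit_gs x; have ru := unit_gr x.
rewrite {2}/sec_star /actor_conv (fsum_additive (conj_lin_add Ml)); last first.
  apply: sub_finite_set (rfin_inv (rho A (ginv x)) ff) => g [gx nz]; split=> // f0.
  apply: nz; rewrite f0 (lin_0 (fam_linl AP _ _)) ?bproj_inc//.
    by rewrite gsVE rho_act.
  by rewrite actKg.
have unitE g y : gs g = rho A y -> units H (act A g y) -> act A g y = gs y.
  by move=> gy u; rewrite -(gs_unit u) gs_act.
(* Both sums are first restricted to the indices where the unit section is evaluated at a unit:
   inversion need not map the full index sets to each other, but it does map these. *)
rewrite -(@fsbig_widen _ _ _ _ [set g | gs g = rho A x /\ act A g x = gs x]);
    last 2 first.
- by move=> g [].
- move=> g [/= gx /not_andP[//|gn]].
  rewrite [unit_section _ _]unit_section_out; last by move/(unitE _ _ gx).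
  by rewrite (lin_0 (fam_linr AP _ _)) ?bproj_inc ?gsVE ?rho_act ?actKg.
rewrite -[RHS](@fsbig_widen _ _ _ _
    [set g | gs g = rho A (ginv x) /\ act A g (ginv x) = gr x]); last 2 first.
- by move=> g [].
- move=> g [/= gx /not_andP[//|gn]].
  rewrite [unit_section _ _]unit_section_out; last first.
    by move/(unitE _ _ gx); rewrite gsVE.
  rewrite (lin_0 (fam_linr AP _ _)) ?bproj_inc ?gsVE ?rho_act ?actKg//.
  exact: conj_lin_0 Ml.
rewrite [RHS](reindex_fsbig (@ginv G) [set g | gs g = rho A x /\ act A g x = gs x]).
  apply: eq_fsbigr => g /set_mem[gx gE].
  have wE : act A g (gr x) = ginv x.
    apply: gmul_unit_inv; first by rewrite gs_act ?rho_gr ?gsrE.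
    by rewrite -act_gr// gE.
  have gE' : act A (ginv g) (ginv x) = gr x by rewrite -wE actKg// rho_gr.
  rewrite gE inc_unit_section// inc_sec_star// gE' inc_unit_section//.
  rewrite inc_fibcoord; last first.
    apply: (bproj_famE AP); rewrite (bproj_one CP)// bproj_inc ginvK ?rho_gr//.
  rewrite fam_star_one ?bproj_inc ?ginvK ?rho_gr//.
  by rewrite wE grVE.
split.
- move=> g [gx gE] /=; split.
    by rewrite gsVE rho_inv -gE rho_act.
  have wE : act A g (gr x) = ginv x.
    apply: gmul_unit_inv; first by rewrite gs_act ?rho_gr ?gsrE.
    by rewrite -act_gr// gE.
  by rewrite -wE actKg// rho_gr.
- by move=> g g' _ _ /(congr1 (@ginv G)); rewrite !ginvK.
- move=> g [gx gE]; exists (ginv g); last by rewrite ginvK.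
  have rg : gr g = rho A x by rewrite -(rho_gr A x) -gE rho_act.
  have wE : act A g (gs x) = x.
    rewrite -[RHS]ginvK; apply: gmul_unit_inv.
      by rewrite gs_act -?rho_inv// gssE grVE.
    by rewrite -grVE -act_gr// gE.
  by split; rewrite ?gsVE// -{1}wE actKg// -rho_inv.
Qed.

End ActorUnit.

(** * Continuity of the partial operations along filters *)

Lemma fst_cvg (X Y : topologicalType) (F : set_system (X * Y)) (q : X * Y) : Filter F ->
  F --> q -> (fun t => t.1) @ F --> q.1.
Proof. by move=> FF Fq; apply: cvg_comp Fq _; exact: cvg_fst. Qed.

Lemma snd_cvg (X Y : topologicalType) (F : set_system (X * Y)) (q : X * Y) : Filter F ->
  F --> q -> (fun t => t.2) @ F --> q.2.
Proof. by move=> FF Fq; apply: cvg_comp Fq _; exact: cvg_snd. Qed.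

(** On the domain [f] is replaced by its meaningful formula [f']; the cut-off operations below are
    shown to be continuous in this way. *)
Lemma continuous_withinI (X Y : topologicalType) (D : set X) (f f' : X -> Y) :
  (forall q, D q -> f q = f' q) ->
  (forall q (F : set_system X), Filter F -> D q -> F --> q ->
     (\forall t \near F, D t) -> f' @ F --> f' q) ->
  {within D, continuous f}.
Proof.
move=> ff' cf; apply/subspace_continuousP => q Dq; rewrite /from_subspace ff'//.
have FF : Filter (within D (nbhs q)) by exact: within_filter.
have nD : within D (nbhs q) D by exact: withinT.
apply: cvg_trans (cf q _ FF Dq (cvg_within _) nD).
by apply: near_eq_cvg; apply: filterS nD => t /= Dt; rewrite ff'.
Qed.

Section ActorCvg.
Variables (G H : etaleGroupoid) (A : actor G H).

Lemma rho_cvg (S : Type) (F : set_system S) (f : S -> H) x : Filter F ->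
  f @ F --> x -> (fun t => rho A (f t)) @ F --> rho A x.
Proof. by move=> FF fg; apply: cvg_comp fg _; exact: rho_continuous. Qed.

Lemma act_cvg (S : Type) (F : set_system S) (f : S -> G) (k : S -> H) g x :
  Filter F -> gs g = rho A x -> (\forall t \near F, gs (f t) = rho A (k t)) ->
  f @ F --> g -> k @ F --> x -> (fun t => act A (f t) (k t)) @ F --> act A g x.
Proof.
move=> FF gh fk fg kh.
have := @cvg_within_comp _ _ _ F _ _ (fun t => (f t, k t)) (g, x) FF
  (@act_continuous _ _ A) gh fk.
by apply; exact: cvg_pair.
Qed.

End ActorCvg.

Section BundleCvg.
Variables (R : realType) (G : etaleGroupoid) (E : fellData R G).
Hypothesis EP : is_fell_bundle E.
Let UP := fell_usc EP.

Lemma bproj_cvg (S : Type) (F : set_system S) (f : S -> E) e : Filter F ->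
  f @ F --> e -> (fun t => bproj (f t)) @ F --> bproj e.
Proof. by move=> FF fe; apply: cvg_comp fe _; exact: bproj_continuous. Qed.

Lemma fmul_cvg (S : Type) (F : set_system S) (f k : S -> E) a b :
  Filter F -> bcomposable a b -> (\forall t \near F, bcomposable (f t) (k t)) ->
  f @ F --> a -> k @ F --> b -> (fun t => fmul (f t) (k t)) @ F --> fmul a b.
Proof.
move=> FF gh fk fg kh.
have := @cvg_within_comp _ _ _ F _ _ (fun t => (f t, k t)) (a, b) FF
  (fmul_continuous EP) gh fk.
by apply; exact: cvg_pair.
Qed.

Lemma fstar_cvg (S : Type) (F : set_system S) (f : S -> E) e : Filter F ->
  f @ F --> e -> (fun t => fstar (f t)) @ F --> fstar e.
Proof. by move=> FF fe; apply: cvg_comp fe _; exact: fstar_continuous. Qed.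

(** The axiom gives continuity on the total space only. As [bproj] is open, a neighbourhood of the
    zero vector over [y] projects onto a neighbourhood of [y], and continuity descends. *)
Lemma one_continuous (one : G -> E) : is_categorical one ->
  continuous (fun y : G => one (gs y)).
Proof.
move=> CP y W nW.
have cW : nbhs (inc (0 : fib E y)) ((fun e : E => one (gs (bproj e))) @^-1` W).
  by apply: (one_gs_continuous CP); rewrite bproj_inc.
move: cW; rewrite nbhsE => -[N [oN N0] NW].
apply: (@filterS _ _ _ (@bproj _ _ E @` N)).
  by move=> _ [e Ne <-]; exact: NW.
apply: open_nbhs_nbhs; split; first exact: (bproj_open UP).
by exists (inc (0 : fib E y)); rewrite ?bproj_inc.
Qed.

Lemma one_cvg (one : G -> E) (S : Type) (F : set_system S) (f : S -> G) y :
  is_categorical one -> Filter F -> units G y ->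
  (\forall t \near F, units G (f t)) -> f @ F --> y ->
  (fun t => one (f t)) @ F --> one y.
Proof.
move=> CP FF uy uf fy.
have := cvg_comp _ _ fy (@one_continuous _ CP y); rewrite (gs_unit uy).
apply: cvg_trans; apply: near_eq_cvg; apply: filterS uf => t /= ut.
by rewrite (gs_unit ut).
Qed.

End BundleCvg.

Lemma fam_cvg (R : realType) (G H : etaleGroupoid) (E : fellData R G)
    (F : fellData R H) (A : fellActorData E F) (S : Type) (Z : set_system S)
    (f : S -> E) (k : S -> F) a b :
  is_fell_actor A -> Filter Z -> fa_dom A a b ->
  (\forall t \near Z, fa_dom A (f t) (k t)) ->
  f @ Z --> a -> k @ Z --> b -> (fun t => fam A (f t) (k t)) @ Z --> fam A a b.
Proof.
move=> AP FF gh fk fg kh.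
have := @cvg_within_comp _ _ _ Z _ _ (fun t => (f t, k t)) (a, b) FF
  (fam_continuous AP) gh fk.
by apply; exact: cvg_pair.
Qed.

(** * Norm closures of linear spans *)

Section Span.
Variables (R : realType) (V : normedModType R[i]).
Implicit Types (S T : set V) (v w : V).

Definition approx S : set V :=
  [set v | forall eps : R[i], 0 < eps -> exists2 w, S w & `|v - w| < eps].

Lemma dense_approx S : dense S <-> forall v, approx S v.
Proof.
split=> [dS v eps eps0|aS O [v Ov] oO].
  have [|w []] := dS (ball v eps)^° _ (open_interior _).
    by exists v; apply: nbhsx_ballx.
  by move=> /interior_subset; rewrite -ball_normE /= => vw Sw; exists w.
have : nbhs v O by exact: open_nbhs_nbhs.
move=> /nbhs_ballP[eps /= eps0 bO]; have [w Sw vw] := aS v eps eps0.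
by exists w; split=> //; apply: bO; rewrite -ball_normE.
Qed.

Lemma approx_sub S : S `<=` approx S.
Proof. by move=> v Sv eps eps0; exists v; rewrite // subrr normr0. Qed.

Lemma lspan0 S : lspan S 0.
Proof.
exists 0%N, (fun=> 0), (fun=> 0); split; last by rewrite big_ord0.
by case.
Qed.

Lemma lspan_sub S : S `<=` lspan S.
Proof.
move=> v Sv; exists 1%N, (fun=> 1), (fun=> v).
by split=> //; rewrite big_ord1 scale1r.
Qed.

Lemma lspan_lin S z v w : lspan S v -> lspan S w -> lspan S (z *: v + w).
Proof.
move=> [n [c [a [Sa ->]]]] [m [d [b [Sb ->]]]].
exists (n + m)%N,
  (fun i : 'I_(n + m) => match fintype.split i with inl j => z * c j | inr j => d j end),
  (fun i : 'I_(n + m) => match fintype.split i with inl j => a j | inr j => b j end).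
split; first by move=> i; case: (fintype.split i).
rewrite big_split_ord /= scaler_sumr; congr (_ + _); apply: eq_bigr => i _.
  by case: splitP => j /= ij; [have -> : i = j by exact: val_inj|
    have := ltn_ord i; rewrite ij ltnNge leq_addr]; rewrite scalerA.
case: splitP => j /= ij; first by have := ltn_ord j; rewrite -ij ltnNge leq_addr.
by have -> : i = j by apply: val_inj; apply/eqP; rewrite -(eqn_add2l n) ij.
Qed.

Lemma approx_lin S z v w : (forall v w, S v -> S w -> S (z *: v + w)) ->
  approx S v -> approx S w -> approx S (z *: v + w).
Proof.
move=> Slin Sv Sw eps eps0.
have z1 : 0 < `|z| + 1 by rewrite ltr_wpDl.
have e2 : 0 < eps / 2 by rewrite divr_gt0// ltr0Sn.
have [v' Sv' vv'] := Sv (eps / 2 / (`|z| + 1)) (divr_gt0 e2 z1).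
have [w' Sw' ww'] := Sw (eps / 2) e2.
exists (z *: v' + w'); first exact: Slin.
have -> : z *: v + w - (z *: v' + w') = z *: (v - v') + (w - w').
  by rewrite scalerBr opprD addrACA.
apply: le_lt_trans (ler_normD _ _) _; rewrite [ltRHS](splitr eps).
apply: ler_ltD => //; rewrite normrZ.
apply: (@le_trans _ _ (`|z| * (eps / 2 / (`|z| + 1)))).
  by apply: ler_wpM2l => //; exact: ltW.
by rewrite mulrA ler_pdivrMr// [leLHS]mulrC ler_pM2l// lerDl.
Qed.

Lemma approx_lspan S T : S `<=` approx (lspan T) -> lspan S `<=` approx (lspan T).
Proof.
move=> ST _ [n [c [a [Sa ->]]]].
apply: (big_ind (approx (lspan T))).
- exact/approx_sub/lspan0.
- move=> v w Tv Tw; rewrite -[v]scale1r; apply: approx_lin => // ? ? ? ?.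
  exact: lspan_lin.
- move=> i _; rewrite -[_ *: _]addr0; apply: approx_lin.
  + by move=> ? ? ? ?; exact: lspan_lin.
  + exact: ST.
  + exact/approx_sub/lspan0.
Qed.

Lemma approx_lspan_mono S T : S `<=` T -> approx (lspan S) `<=` approx (lspan T).
Proof.
move=> ST v Sv eps /Sv[w [n [c [a [Sa ->]]]] vw].
by exists (\sum_(i < n) c i *: a i) => //; exists n, c, a; split=> // i; exact/ST.
Qed.

Lemma approx_idem S : approx (approx S) `<=` approx S.
Proof.
move=> v Sv eps eps0.
have e2 : 0 < eps / 2 by rewrite divr_gt0// ltr0Sn.
have [w Sw vw] := Sv _ e2; have [u Su wu] := Sw _ e2.
exists u => //; rewrite -(subrK w v) -addrA (splitr eps).
by apply: le_lt_trans (ler_normD _ _) _; rewrite ltrD.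
Qed.

End Span.

Lemma approx_image (R : realType) (U V : normedModType R[i]) (L : U -> V)
    (S : set U) (T : set V) : linear L ->
  (forall eps : R[i], 0 < eps -> exists2 d : R[i], 0 < d &
     forall u, `|u| < d -> `|L u| < eps) ->
  (forall u, S u -> approx T (L u)) -> forall u, approx S u -> approx T (L u).
Proof.
move=> Llin Lc ST u Su; apply: approx_idem => eps /Lc[d d0 Ld].
have [w Sw uw] := Su d d0; exists (L w); first exact: ST.
rewrite -(lin_sub Llin).
exact: Ld.
Qed.

(** Convergence in the bundle topology at 0 becomes an estimate in norms, because the set of vectors
    of norm less than [eps] is open. *)
Lemma fib_near0 (R : realType) (X Y : topologicalType) (E : bundle R X)
    (F : bundle R Y) x y (L : fib E x -> fib F y) :
  is_usc_banach_bundle E -> is_usc_banach_bundle F -> linear L ->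
  (forall Z : set_system (fib E x), Filter Z -> Z --> (0 : fib E x) ->
     (fun v => inc (L v)) @ Z --> inc (L 0)) ->
  forall eps : R[i], 0 < eps -> exists2 d : R[i], 0 < d &
     forall u, `|u| < d -> `|L u| < eps.
Proof.
move=> EU FU Llin Lc eps eps0.
have Lc0 := Lc (nbhs (0 : fib E x)) (nbhs_filter _) (fun _ => id).
have := near_bnorm_lt FU (p := fun=> y) (nbhs_filter _) Lc0.
move=> /(_ eps); rewrite (lin_0 Llin) normr0 => /(_ eps0) /nbhs_ballP[d /= d0 dL].
by exists d => // u ud; apply: dL; rewrite -ball_normE /= sub0r normrN.
Qed.

Section FamContinuity.
Variables (R : realType) (G H : etaleGroupoid) (E : fellData R G) (F : fellData R H).
Variable A : fellActorData E F.
Hypotheses (EP : is_fell_bundle E) (FP : is_fell_bundle F) (AP : is_fell_actor A).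

Lemma fam_linl_near0 g x (f : F) : gs g = rho A (bproj f) ->
  act A g (bproj f) = x -> forall eps : R[i], 0 < eps -> exists2 d : R[i], 0 < d &
     forall u : fib E g, `|u| < d -> `|fibcoord x (fam A (inc u) f)| < eps.
Proof.
move=> c e; apply: (fib_near0 (fell_usc EP) (fell_usc FP) (fam_linl AP c e)).
move=> Z FZ Z0; have pE (u : fib E g) : bproj (fam A (inc u) f) = x.
  by apply: (bproj_famE AP); rewrite bproj_inc.
have -> : (fun v : fib E g => inc (fibcoord x (fam A (inc v) f))) =
    (fun v : fib E g => fam A (inc v) f).
  by apply/funext => v; rewrite inc_fibcoord.
rewrite inc_fibcoord//; apply: (fam_cvg AP); rewrite /fa_dom ?bproj_inc//.
- by apply: filterE => v; rewrite bproj_inc.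
- by apply: cvg_comp Z0 _; exact: (inc_continuous (fell_usc EP)).
- exact: cvg_cst.
Qed.

End FamContinuity.

(** * The category of Fell actors *)

Section IdentityActor.
Variable G : etaleGroupoid.

Definition id_act (g x : G) : G := if `[< gs g = gr x >] then gmul g x else x.

Lemma id_actE g x : gs g = gr x -> id_act g x = gmul g x.
Proof. by move=> c; rewrite /id_act asboolT. Qed.

Lemma id_act_continuous :
  {within [set q : G * G | gs q.1 = gr q.2],
    continuous (fun q : G * G => id_act q.1 q.2)}.
Proof.
apply: continuous_withinI => [q|q F FF Dq Fq nD]; first exact: id_actE.
by apply: gmul_cvg => //; [exact: fst_cvg|exact: snd_cvg].
Qed.

Definition id_actor : actor G G.
Proof.
refine (@Actor G G (@gr G) id_act (@unit_gr G) (@gr_continuous G)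
  id_act_continuous _ _ _ _ _ _ _).
- by move=> g x c; rewrite id_actE// grME.
- move=> g1 g2 x c1 c2; rewrite /composable in c1.
  rewrite (id_actE c2) !id_actE ?gsME// ?grME// gmulAE//.
- by move=> x; rewrite id_actE ?gsrE// gmul_unitl//; exact: unit_gr.
- by move=> g x y c1 c2; rewrite grME.
- by move=> g x c; rewrite id_actE// gsME.
- by move=> g x y c1 c2; rewrite !id_actE ?gmulAE// grME.
- by move=> g x c; rewrite /id_act asboolF.
Defined.

End IdentityActor.

Section IdentityFellActor.
Variables (R : realType) (E : scFellBundle R).
Let G := sc_base E.
Let EP := sc_fell E.

Definition id_fam (a b : E) : E :=
  if `[< gs (bproj a) = gr (bproj b) >] then fmul a b else b.

Definition id_fell_data : fellActorData E E := FellActorData (id_actor G) id_fam.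

Lemma id_famE a b : gs (bproj a) = gr (bproj b) -> id_fam a b = fmul a b.
Proof. by move=> c; rewrite /id_fam asboolT. Qed.

Lemma id_nablaE g x k (v : fib E g) (w : fib E x) : gs g = gr x -> id_act g x = k ->
  fibcoord k (id_fam (inc v) (inc w)) = fibcoord k (fmul (inc v) (inc w)).
Proof. by move=> c <-; rewrite id_famE// !bproj_inc. Qed.

Lemma id_fell_actor : is_fell_actor id_fell_data.
Proof.
split=> /=.
- apply: continuous_withinI => [q|q F FF Dq Fq nD]; first exact: id_famE.
  by apply: (fmul_cvg EP) => //; [exact: fst_cvg|exact: snd_cvg].
- move=> a b d; rewrite id_famE// id_actE//; exact: (bproj_mul EP).
- move=> g x c; split=> w.
    move=> z u v; rewrite /nabla /= !id_nablaE// !(id_actE c).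
    by apply: (fmul_linl EP); rewrite ?bproj_inc.
  move=> z u v; rewrite /nabla /= !id_nablaE// !(id_actE c).
  by apply: (fmul_linr EP); rewrite ?bproj_inc.
- move=> a b c ab bc; rewrite /bcomposable /composable /fa_dom /= in ab bc.
  rewrite (id_famE bc) id_famE ?(bproj_mul EP)// ?gsME// id_famE.
    by rewrite (fmulA EP).
  by rewrite (bproj_mul EP)// grME.
- move=> a b c ab bc; rewrite /bcomposable /composable /fa_dom /= in ab bc.
  rewrite (id_famE ab) id_famE; last by rewrite (bproj_mul EP)// grME.
  exact: (fmulA EP).
- move=> a b c ab; rewrite /fa_dom /= in ab; rewrite id_actE// grME// => rc.
  rewrite (id_famE ab) id_famE; last by rewrite (bproj_star EP) gsVE.
  have sb : bcomposable (fstar b) (fstar a).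
    by rewrite /bcomposable /composable !(bproj_star EP) gsVE grVE.
  have sa : bcomposable (fstar a) c.
    by rewrite /bcomposable /composable (bproj_star EP) gsVE.
  by rewrite (fstarM EP)// (fmulA EP).
- by move=> a b d; rewrite /id_fam asboolF.
Qed.

Lemma sat_approx g h k : gs g = gr h -> gmul g h = k -> forall u : fib E k,
  approx (lspan [set u | exists v w, u =
    fibcoord k (fmul (inc (v : fib E g)) (inc (w : fib E h)))]) u.
Proof. by move=> c <-; apply/dense_approx; exact: (sc_saturated c). Qed.

Lemma id_saturated : saturated_fell_actor id_fell_data.
Proof.
move=> g x c; apply/dense_approx => u.
have := sat_approx c (esym (id_actE c)) u.
apply: approx_lspan_mono => _ [v [w ->]]; exists v, w.
by rewrite /nabla /= id_nablaE.
Qed.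

Lemma id_proper_actor : proper_actor (id_actor G).
Proof.
move=> K cK KU; rewrite (_ : units G `&` _ = K)//.
apply/seteqP; split=> x /=; first by move=> [ux]; rewrite gr_unit.
by move=> Kx; have ux := KU _ Kx; rewrite gr_unit.
Qed.

(** Saturation makes the identity proper. With [k = g x] one has [g = k x^-1], so [xi] is
    approximated by sums of products [a b] over [k] and [x^-1], and left multiplication by [a b] is
    the rank-one operator given by [a] and [b^*]. *)
Lemma id_compact g x (xi : fib E g) : gs g = rho id_fell_data x ->
  compact_operator (@nabla _ _ _ _ _ id_fell_data g x xi).
Proof.
move=> c eps eps0; rewrite /= in c.
set k := act id_fell_data g x; have kE : gmul g x = k by rewrite /k /= id_actE.
have kx : gs k = gr (ginv x) by rewrite -kE gsME// grVE.
have kg : gmul k (ginv x) = g by rewrite -kE gmulgK.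
have [_ [n [z [v [Sv ->]]]] xiv] := sat_approx kx kg xi eps0.
have {Sv} Sv i : exists w : fib E k * fib E (ginv x), v i =
    fibcoord g (fmul (inc w.1) (inc w.2)).
  by have [a [b ->]] := Sv i; exists (a, b).
(* The coefficients go into [a]; [b] is the adjoint of the second factor, so that the star in the
   rank-one operator gives that factor back. *)
pose a i := z i *: (projT1 (cid (Sv i))).1.
pose b i := fibcoord x (fstar (inc (projT1 (cid (Sv i))).2)).
exists n, a, b => w.
have bE i : fstar (inc (b i)) = inc (projT1 (cid (Sv i))).2.
  by rewrite /b inc_fibcoord ?(fstarK EP)// (bproj_star EP) bproj_inc ginvK.
have cw : gmul (ginv x) x = gs x by exact: (gmulVg (egroupoidP G)).
have Ml : linear (fun u : fib E g => fibcoord k (fmul (inc u) (inc w))).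
  by apply: (fmul_linl EP); rewrite ?bproj_inc.
have Ml' i : linear (fun u : fib E k => fibcoord g
    (fmul (inc u) (inc (projT1 (cid (Sv i))).2))).
  by apply: (fmul_linl EP); rewrite ?bproj_inc.
have vE i : z i *: v i = fibcoord g (fmul (inc (a i)) (fstar (inc (b i)))).
  rewrite bE {1}(projT2 (cid (Sv i))) /a.
  by rewrite -(lin_scale (Ml' i)).
have -> : \sum_(i < n) fibcoord k
    (fmul (inc (a i)) (fmul (fstar (inc (b i))) (inc w))) =
    fibcoord k (fmul (inc (\sum_(i < n) z i *: v i)) (inc w)).
  rewrite (big_morph _ (lin_add Ml) (lin_0 Ml)); apply: eq_bigr => i _.
  rewrite vE inc_fibcoord ?(fmulA EP)//.
  - by rewrite /bcomposable /composable bE !bproj_inc.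
  - by rewrite /bcomposable /composable bE !bproj_inc gsVE.
  - by apply: (bproj_fmul EP); rewrite bE !bproj_inc.
rewrite /nabla /= id_nablaE//.
rewrite (_ : _ - _ = fibcoord k (fmul (inc (xi - \sum_(i < n) z i *: v i)) (inc w)));
  last by rewrite (lin_sub Ml).
have pk : bproj (fmul (inc (xi - \sum_(i < n) z i *: v i)) (inc w)) = k.
  by apply: (bproj_fmul EP); rewrite ?bproj_inc.
rewrite -(bnormE pk); apply: le_trans (fmul_norm EP _) _.
  by rewrite /bcomposable /composable !bproj_inc.
by rewrite !bnorm_inc; apply: ler_wpM2r => //; exact: ltW.
Qed.

Definition id_psFellActor : psFellActor E E :=
  @PsFellActor R E E id_fell_data id_fell_actor id_saturated
    (conj id_proper_actor id_compact).

End IdentityFellActor.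

Section CompositeActor.
Variables (G H K : etaleGroupoid) (a : actor G H) (b : actor H K).

Definition comp_act (g : G) (t : K) : K :=
  if `[< gs g = rho a (rho b t) >] then act b (act a g (rho b t)) t else t.

Lemma comp_actE g t : gs g = rho a (rho b t) ->
  comp_act g t = act b (act a g (rho b t)) t.
Proof. by move=> c; rewrite /comp_act asboolT. Qed.

Lemma gs_act_rho g t : gs g = rho a (rho b t) ->
  gs (act a g (rho b t)) = rho b t.
Proof. by move=> c; rewrite gs_act// gs_rho. Qed.

Lemma comp_rho_continuous : continuous (fun t => rho a (rho b t)).
Proof. by move=> t; apply: rho_cvg; exact: rho_continuous. Qed.

Lemma comp_act_continuous :
  {within [set q : G * K | gs q.1 = rho a (rho b q.2)],
    continuous (fun q : G * K => comp_act q.1 q.2)}.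
Proof.
apply: continuous_withinI => [q|q F FF Dq Fq nD]; first exact: comp_actE.
have F1 := fst_cvg FF Fq; have F2 := snd_cvg FF Fq.
apply: act_cvg => //; first exact: gs_act_rho.
  by apply: filterS nD => t /=; exact: gs_act_rho.
by apply: act_cvg => //; exact: rho_cvg.
Qed.

Definition comp_actor : actor G K.
Proof.
refine (@Actor G K (fun t => rho a (rho b t)) comp_act (fun t => rho_units a _)
  comp_rho_continuous comp_act_continuous _ _ _ _ _ _ _).
- by move=> g t c; rewrite comp_actE// rho_act ?gs_act_rho// -(rho_act c) rho_gr.
- move=> g1 g2 t c1 c2; rewrite /composable in c1.
  have rt : rho b (act b (act a g2 (rho b t)) t) = gr (act a g2 (rho b t)).
    by rewrite rho_act// gs_act_rho.
  have c3 : gs g1 = rho a (gr (act a g2 (rho b t))) by rewrite rho_gr rho_act.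
  rewrite (comp_actE c2) !comp_actE ?rt ?gsME// actA ?gs_act// ?gs_act_rho//.
  + by rewrite -act_gr ?rho_act// actA.
  + by rewrite /composable gs_act// gsrE.
  + exact: gs_rho.
- move=> t; rewrite comp_actE ?gs_rho//.
  by rewrite !act_rho.
- move=> g t u c1 c2; rewrite /composable in c2.
  have <- := rho_mul (a := b) (gs_rho b t) c2.
  by [].
- by move=> g t c; rewrite comp_actE// gs_act// gs_act_rho.
- move=> g t u c1 c2; have E := rho_mul (a := b) (gs_rho b t) c2.
  by rewrite !comp_actE ?E// act_mul// gs_act_rho.
- by move=> g t c; rewrite /comp_act asboolF.
Defined.

Lemma comp_proper_actor : proper_actor a -> proper_actor b -> proper_actor comp_actor.
Proof.
move=> pa pb C cC CU.
have := pb _ (pa C cC CU) (@subIsetl _ _ _).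
rewrite (_ : _ `&` _ = units K `&` rho comp_actor @^-1` C)//.
apply/seteqP; split=> t /=; first by move=> [ut [_ Ct]].
by move=> [ut Ct]; split=> //; split=> //; exact: rho_units.
Qed.

End CompositeActor.

Section CompositeFellActor.
Variables (R : realType) (E F D : scFellBundle R).
Variables (A : psFellActor E F) (B : psFellActor F D).
Let EP := sc_fell E. Let FP := sc_fell F. Let DP := sc_fell D.
Let AP := ps_fell_actor A. Let BP := ps_fell_actor B.
Let CP := sc_categorical F.
Let one := @sc_one R F.

Definition comp_fam (xi : E) (zeta : D) : D :=
  if `[< gs (bproj xi) = rho A (rho B (bproj zeta)) >]
  then fam B (fam A xi (one (rho B (bproj zeta)))) zeta else zeta.

Definition comp_data : fellActorData E D := FellActorData (comp_actor A B) comp_fam.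

Lemma comp_famE xi zeta : gs (bproj xi) = rho A (rho B (bproj zeta)) ->
  comp_fam xi zeta = fam B (fam A xi (one (rho B (bproj zeta)))) zeta.
Proof. by move=> c; rewrite /comp_fam asboolT. Qed.

Let oneP t : bproj (one (rho B t)) = rho B t.
Proof. exact/(bproj_one CP)/rho_units. Qed.

Lemma bproj_fam_one xi t : gs (bproj xi) = rho A (rho B t) ->
  bproj (fam A xi (one (rho B t))) = act A (bproj xi) (rho B t).
Proof. by move=> c; apply: (bproj_famE AP); rewrite oneP. Qed.

Lemma fa_dom_fam_one xi zeta : gs (bproj xi) = rho A (rho B (bproj zeta)) ->
  fa_dom B (fam A xi (one (rho B (bproj zeta)))) zeta.
Proof. by move=> c; rewrite /fa_dom bproj_fam_one// gs_act_rho. Qed.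

Lemma comp_nablaE g t k (v : fib E g) (w : fib D t) : gs g = rho A (rho B t) ->
  fibcoord k (comp_fam (inc v) (inc w)) = fibcoord k (fam B
    (inc (fibcoord (act A g (rho B t)) (fam A (inc v) (one (rho B t))))) (inc w)).
Proof.
move=> c; rewrite comp_famE !bproj_inc// inc_fibcoord//.
by rewrite bproj_fam_one bproj_inc.
Qed.

(** The anchor of [fam B f zeta] is the range of [f], so the composite uses the unit there, and
    [fam_one] for [A] absorbs it into [f]. Associativity and saturation of the composite rest on
    this. *)
Lemma fam_comp_mul xi f zeta : gs (bproj xi) = rho A (bproj f) ->
  gs (bproj f) = rho B (bproj zeta) ->
  comp_fam xi (fam B f zeta) = fam B (fam A xi f) zeta.
Proof.
move=> c d.
have pz : bproj (fam B f zeta) = act B (bproj f) (bproj zeta) by exact: (bproj_fam BP).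
have rz : rho B (bproj (fam B f zeta)) = gr (bproj f) by rewrite pz rho_act.
have ur := unit_gr (bproj f).
rewrite comp_famE ?rz ?rho_gr// -(famM BP)//.
- by rewrite (fam_one AP CP).
- rewrite /bcomposable /composable (bproj_famE AP (x := act A (bproj xi) (gr (bproj f))));
    rewrite ?(bproj_one CP)// ?rho_gr//.
  by rewrite gs_act ?rho_gr// gsrE.
Qed.

(** The composite is [B] acting by [fam A xi 1], so the axioms come from those of [B]; associativity
    also needs [fam_comp_mul], and the adjoint relation [fam_star_one]. *)
Lemma comp_fell_actor : is_fell_actor comp_data.
Proof.
split=> /=.
- apply: continuous_withinI => [q|q Z ZF Dq Fq nD]; first exact: comp_famE.
  have F1 := fst_cvg ZF Fq; have F2 := snd_cvg ZF Fq.
  apply: (fam_cvg BP) => //; first exact: fa_dom_fam_one.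
    by apply: filterS nD => t /=; exact: fa_dom_fam_one.
  apply: (fam_cvg AP) => //.
  + by rewrite /fa_dom oneP.
  + by apply: filterS nD => t /=; rewrite /fa_dom oneP.
  + apply: (one_cvg FP CP); first exact: rho_units.
      by apply: filterE => t; exact: rho_units.
    by apply: rho_cvg; exact: (bproj_cvg DP ZF F2).
- move=> xi zeta c; rewrite comp_famE// comp_actE//.
  by apply: (bproj_famE BP); [exact: fa_dom_fam_one|rewrite bproj_fam_one].
- move=> g t c.
  have L1 : linear (fun v : fib E g => fibcoord (act A g (rho B t))
      (fam A (inc v) (one (rho B t)))).
    by apply: (fam_linl AP); rewrite oneP.
  split=> w z u v; rewrite /nabla /= !comp_nablaE// ?L1 comp_actE//.
    by apply: (fam_linl BP); rewrite ?bproj_inc// gs_act_rho.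
  by apply: (fam_linr BP); rewrite ?bproj_inc// gs_act_rho.
- move=> xi xi' zeta c c'; rewrite /bcomposable /composable /fa_dom /= in c c'.
  rewrite (comp_famE c') fam_comp_mul.
  + rewrite comp_famE ?(bproj_mul EP)// ?gsME// (famM AP)//.
    by rewrite /fa_dom oneP.
  + by rewrite bproj_fam_one// rho_act.
  + exact: fa_dom_fam_one.
- move=> xi f g c d; rewrite /fa_dom /= in c; rewrite /bcomposable /composable in d.
  have rE : rho B (bproj (fmul f g)) = rho B (bproj f).
    by rewrite (bproj_mul DP)// (rho_mul (gs_rho B _)).
  rewrite !comp_famE ?rE// (fam_mul BP)//; exact: fa_dom_fam_one.
- move=> xi f g c; rewrite /fa_dom /= in c; rewrite comp_actE// => rg.
  set z := rho B (bproj f) in c rg *.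
  set w := act A (bproj xi) z in rg *.
  have sw : gs w = z by rewrite /w gs_act_rho.
  have rgE : rho B (bproj g) = gr w by rewrite -rho_gr rg rho_gr rho_act.
  rewrite !comp_famE//; last first.
    by rewrite (bproj_star EP) gsVE rgE rho_gr /w rho_act.
  have d : fa_dom B (fam A xi (one z)) f by exact: fa_dom_fam_one.
  rewrite (fam_adjoint BP)//; last by rewrite bproj_fam_one.
  by rewrite (fam_star_one EP FP AP CP)// -/w ?rgE//; exact: rho_units.
- by move=> xi f d; rewrite /comp_fam asboolF.
Qed.

(** Products [fam B v w] have dense span, and [v] is approximated by sums of [fam A xi f]. By
    [fam_comp_mul] the resulting vectors are composite actions of [xi] on [fam B f w]; continuity in
    [v] carries the approximation over. *)
Lemma comp_saturated : saturated_fell_actor comp_data.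
Proof.
move=> g t /= c; apply/dense_approx => u.
set k := comp_act A B g t in u *.
set z := rho B t in c *; set y := act A g z.
have kE : act B y t = k by rewrite /k comp_actE.
have sy : gs y = rho B t by exact: gs_act_rho.
pose S := [set u : fib D k | exists v w,
  u = fibcoord k (comp_fam (inc (v : fib E g)) (inc (w : fib D t)))].
have SB : forall u : fib D k, approx (lspan [set u | exists v w, u =
    fibcoord k (fam B (inc (v : fib F y)) (inc (w : fib D t)))]) u.
  have sB : forall v : fib D (act B y t), approx (lspan [set u | exists eta w,
       u = @nabla _ _ _ _ _ B y t eta w]) v.
    by apply/dense_approx; exact: ps_saturated.
  by rewrite -kE.
apply: (approx_idem (S := lspan S)) => eps eps0.
have [v Sv uv] := SB u eps eps0; exists v => //; move: v Sv {uv}.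
apply: approx_lspan => _ [v [w ->]].
have sA : forall v : fib F y, approx (lspan [set u | exists xi f,
     u = @nabla _ _ _ _ _ A g z xi f]) v.
  by apply/dense_approx; exact: ps_saturated.
have Ml : linear (fun v : fib F y => fibcoord k (fam B (inc v) (inc w))).
  by apply: (fam_linl BP); rewrite ?bproj_inc.
apply: (approx_image Ml) (sA v).
  by apply: (fam_linl_near0 FP DP BP); rewrite ?bproj_inc.
move=> {}v [n [d [a [Sa ->]]]].
rewrite (big_morph _ (lin_add Ml) (lin_0 Ml)).
apply/approx_sub; apply: (big_ind (lspan S)).
- exact: lspan0.
- by move=> v1 v2 S1 S2; rewrite -[v1]scale1r; exact: lspan_lin.
- move=> i _; rewrite (lin_scale Ml) -[_ *: _]addr0.
  apply: lspan_lin; last exact: lspan0.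
  apply: lspan_sub; have [xi [f ->]] := Sa i.
  have pf : bproj (fam B (inc f) (inc w)) = t.
    by apply: (bproj_famE BP); rewrite !bproj_inc ?gs_rho ?act_rho.
  exists xi, (fibcoord t (fam B (inc f) (inc w))).
  rewrite [in RHS]inc_fibcoord// fam_comp_mul ?bproj_inc ?gs_rho//.
  rewrite /nabla inc_fibcoord//.
  by apply: (bproj_famE AP); rewrite !bproj_inc.
Qed.

(** The operator is that of [B] for the vector [fam A xi 1], and operators of [B] are compact. *)
Lemma comp_compact g t (xi : fib E g) : gs g = rho comp_data t ->
  compact_operator (@nabla _ _ _ _ _ comp_data g t xi).
Proof.
rewrite /= => c; pose y := act A g (rho B t).
have sy : gs y = rho B t by exact: gs_act_rho.
have [_ /(_ y t (fibcoord y (fam A (inc xi) (one (rho B t)))) sy)] := ps_proper B.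
(* [comp_act g t] and [act B y t] are equal only by a proof, so the target is generalised to a
   variable [k] and the equation eliminated. *)
suff cpt k (e : act B y t = k) (T : fib D t -> fib D k) :
    (forall w, T w = fibcoord k (comp_fam (inc xi) (inc w))) ->
    compact_operator (@nabla _ _ _ _ _ B y t
      (fibcoord y (fam A (inc xi) (one (rho B t))))) -> compact_operator T.
  by apply: cpt => //; rewrite -comp_actE.
case: k / e T => T TE cT eps eps0; have [n [a [b ab]]] := cT eps eps0.
exists n, a, b => w; apply: le_trans (ab w).
by rewrite TE comp_nablaE.
Qed.

Definition comp_psFellActor : psFellActor E D :=
  @PsFellActor R E D comp_data comp_fell_actor comp_saturated
    (conj (comp_proper_actor (ps_proper A).1 (ps_proper B).1) comp_compact).

Lemma comp_psFellActorP : is_composite A B comp_psFellActor.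
Proof.
split=> //; first by move=> g t c; exact: comp_actE.
by move=> xi zeta c; exact: comp_famE.
Qed.

End CompositeFellActor.

Lemma actor_eq (G H : etaleGroupoid) (a b : actor G H) :
  (forall x, rho a x = rho b x) -> (forall g x, act a g x = act b g x) -> a = b.
Proof.
case: a => r m p1 p2 p3 p4 p5 p6 p7 p8 p9 p10.
case: b => r' m' q1 q2 q3 q4 q5 q6 q7 q8 q9 q10 /= rr mm.
have E1 : r = r' by apply: funext.
have E2 : m = m' by apply/funext => g; apply: funext.
move: p1 p2 p3 p4 p5 p6 p7 p8 p9 p10 {rr mm}; rewrite {}E1 {}E2 => *.
by f_equal; exact: Prop_irrelevance.
Qed.

Lemma psFellActor_eq (R : realType) (E F : scFellBundle R) (A B : psFellActor E F) :
  (forall x, rho A x = rho B x) -> (forall g x, act A g x = act B g x) ->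
  (forall xi f, fam A xi f = fam B xi f) -> A = B.
Proof.
case: A => [[a f] p1 p2 p3]; case: B => [[b f'] q1 q2 q3] /= rr mm ff.
have E1 : a = b by exact: actor_eq.
have E2 : f = f' by apply/funext => g; apply: funext.
move: p1 p2 p3 {rr mm ff}; rewrite E1 E2 => *.
by f_equal; exact: Prop_irrelevance.
Qed.

(** [is_composite] speaks of composable arguments; the remaining values are fixed by [act_out] and
    [fam_out]. *)
Lemma is_composite_uniq (R : realType) (E F D : scFellBundle R)
    (A : psFellActor E F) (B : psFellActor F D) (C C' : psFellActor E D) :
  is_composite A B C -> is_composite A B C' -> C = C'.
Proof.
move=> [r a f] [r' a' f']; apply: psFellActor_eq.
- by move=> t; rewrite r r'.
- move=> g t; have [c|c] := pselect (gs g = rho A (rho B t)).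
    by rewrite a// a'.
  by rewrite !act_out// ?r ?r'.
- move=> xi zeta; have [c|c] := pselect (gs (bproj xi) = rho A (rho B (bproj zeta))).
    by rewrite f// f'.
  by rewrite (fam_out (ps_fell_actor C)) ?(fam_out (ps_fell_actor C'))// /fa_dom ?r ?r'.
Qed.

(** Each law is proved by checking that the other side is also a composite of the same two actors.
    The laws for the identity use the units of the fibres. *)
Lemma fell_category (R : realType) :
  is_category (@id_psFellActor R) (@comp_psFellActor R).
Proof.
split.
- move=> E F A; have AP := ps_fell_actor A.
  apply: (is_composite_uniq (comp_psFellActorP _ _)); split.
  + by move=> t; rewrite /= gr_unit//; exact: rho_units.
  + move=> g t /= c; rewrite id_actE// gmul_unitr//; first exact: rho_units.
    by rewrite c gr_unit//; exact: rho_units.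
  + move=> xi z /= c.
    have c' : gs (bproj xi) = rho A (bproj z).
      by rewrite c gr_unit//; exact: rho_units.
    rewrite id_famE; last by rewrite (bproj_one (sc_categorical E))//; exact: rho_units.
    by rewrite -c' (mul_1 (sc_categorical E)).
- move=> E F A; have AP := ps_fell_actor A.
  apply: (is_composite_uniq (comp_psFellActorP _ _)); split.
  + by move=> t; rewrite /= rho_gr.
  + move=> g t /=; rewrite rho_gr => c.
    by rewrite id_actE ?gs_act ?rho_gr ?gsrE// -act_gr.
  + move=> xi z /=; rewrite rho_gr => c.
    have p : gs (bproj (fam A xi (sc_one (gr (bproj z))))) = gr (bproj z).
      rewrite (bproj_famE AP (x := act A (bproj xi) (gr (bproj z))));
        rewrite ?(bproj_one (sc_categorical F)) ?rho_gr//; try exact: unit_gr.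
      by rewrite gs_act ?rho_gr// gsrE.
    by rewrite id_famE// (fam_one AP (sc_categorical F)).
- move=> E1 E2 E3 E4 A B C; have CP := ps_fell_actor C; have BP := ps_fell_actor B.
  apply: (is_composite_uniq (comp_psFellActorP _ _)); split=> //.
  + move=> g t /= c; rewrite !comp_actE//= ?comp_actE//.
    by rewrite gs_act_rho.
  + move=> xi z /= c.
    have c1 : gs (bproj xi) = rho A (rho B (bproj (sc_one (rho C (bproj z))))).
      by rewrite (bproj_one (sc_categorical E3))//; exact: rho_units.
    rewrite !comp_famE//= ?comp_famE//.
      by rewrite (bproj_one (sc_categorical E3))//; exact: rho_units.
    by rewrite bproj_fam_one// gs_act_rho.
Qed.

Lemma fsum_lin (K : pzRingType) (V : lmodType K) (I : choiceType) (A : set I)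
    (z : K) (a b : I -> V) :
  finite_set (A `&` [set i | a i <> 0]) -> finite_set (A `&` [set i | b i <> 0]) ->
  \sum_(i \in A) (z *: a i + b i) = z *: \sum_(i \in A) a i + \sum_(i \in A) b i.
Proof.
move=> fa fb; set S := (A `&` [set i | a i <> 0]) `|` (A `&` [set i | b i <> 0]).
have fS : finite_set S by rewrite finite_setU.
have SA : S `<=` A by move=> i [[]|[]].
have W (v : I -> V) : (forall i, A i -> a i = 0 -> b i = 0 -> v i = 0) ->
    \sum_(i \in A) v i = \sum_(i \in S) v i.
  move=> v0; apply/esym/fsbig_widen => // i [Ai nS]; apply: v0 => //.
    by apply: contrapT => ai; apply: nS; left.
  by apply: contrapT => bi; apply: nS; right.
rewrite (W a)// (W b)// (W (fun i => _ *: _ + _)); last first.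
  by move=> i _ -> ->; rewrite scaler0 addr0.
by rewrite !fsbig_finite//= scaler_sumr -big_split.
Qed.

(** * The convolution algebra and the induced homomorphism *)

Section ActorConvLinear.
Variables (R : realType) (G H : etaleGroupoid) (E : fellData R G) (F : fellData R H).
Variable A : fellActorData E F.
Hypothesis AP : is_fell_actor A.

Lemma actor_conv_supp (f : sections E) (u : sections F) x : rfin f ->
  finite_set ([set g : G | gs g = rho A x] `&` [set g | fibcoord x
    (fam A (inc (f (ginv g))) (inc (u (act A g x)))) <> 0]).
Proof.
move=> ff; apply: sub_finite_set (rfin_inv (rho A x) ff) => g [/= gx nz].
split=> // f0; apply: nz; rewrite f0 (lin_0 (fam_linl AP _ _)) ?bproj_inc//.
  by rewrite gsVE rho_act.
by rewrite actKg.
Qed.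

Lemma actor_conv_linl z (f g : sections E) (u : sections F) : rfin f -> rfin g ->
  actor_conv A (sec_lin z f g) u = sec_lin z (actor_conv A f u) (actor_conv A g u).
Proof.
move=> ff fg; apply: functional_extensionality_dep => x.
rewrite /sec_lin /actor_conv -fsum_lin; [|exact: actor_conv_supp..].
apply: eq_fsbigr => h /set_mem /= hx.
by apply: (fam_linl AP); rewrite ?bproj_inc ?gsVE ?rho_act// actKg.
Qed.

Lemma actor_conv_linr z (f : sections E) (u v : sections F) : rfin f ->
  actor_conv A f (sec_lin z u v) = sec_lin z (actor_conv A f u) (actor_conv A f v).
Proof.
move=> ff; apply: functional_extensionality_dep => x.
rewrite /sec_lin /actor_conv -fsum_lin; [|exact: actor_conv_supp..].
apply: eq_fsbigr => h /set_mem /= hx.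
by apply: (fam_linr AP); rewrite ?bproj_inc ?gsVE ?rho_act// actKg.
Qed.

Lemma actor_conv0l (u : sections F) : actor_conv A (fun=> 0) u = fun=> 0.
Proof.
apply: functional_extensionality_dep => x; apply: fsbig1 => g gx.
rewrite (lin_0 (fam_linl AP _ _)) ?bproj_inc//; first by rewrite gsVE rho_act.
by rewrite actKg.
Qed.

Lemma actor_conv0r (f : sections E) : actor_conv A f (fun=> 0) = fun=> 0.
Proof.
apply: functional_extensionality_dep => x; apply: fsbig1 => g gx.
rewrite (lin_0 (fam_linr AP _ _)) ?bproj_inc//; first by rewrite gsVE rho_act.
by rewrite actKg.
Qed.

End ActorConvLinear.

Section ConvolutionAlgebra.
Variables (R : realType) (E : scFellBundle R).
Let EP := sc_fell E.

(** Makes associativity and linearity of convolution instances of the facts on [actor_conv]. *)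
Lemma conv_actor_id (f u : sections E) :
  convolution f u = actor_conv (id_fell_data E) f u.
Proof.
apply: functional_extensionality_dep => x; apply: eq_fsbigr => h /set_mem /= hx.
rewrite !id_actE// id_famE// !bproj_inc gsVE.
by rewrite grME.
Qed.

Lemma convA (f g u : sections E) : rfin f -> rfin g ->
  convolution (convolution f g) u = convolution f (convolution g u).
Proof.
move=> ff fg; rewrite !(conv_actor_id _ u) (conv_actor_id f (actor_conv _ _ _)).
exact: (actor_conv_convl EP (id_fell_actor E)).
Qed.

Lemma conv_linl z (f g u : sections E) : rfin f -> rfin g ->
  convolution (sec_lin z f g) u = sec_lin z (convolution f u) (convolution g u).
Proof.
by move=> ff fg; rewrite !conv_actor_id; exact: (actor_conv_linl (id_fell_actor E)).
Qed.

Lemma conv_linr z (f u v : sections E) : rfin f ->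
  convolution f (sec_lin z u v) = sec_lin z (convolution f u) (convolution f v).
Proof.
by move=> ff; rewrite !conv_actor_id; exact: (actor_conv_linr (id_fell_actor E)).
Qed.

Lemma conv0l (u : sections E) : convolution (fun=> 0) u = fun=> 0.
Proof. by rewrite conv_actor_id; exact: (actor_conv0l (id_fell_actor E)). Qed.

Lemma conv0r (f : sections E) : convolution f (fun=> 0) = fun=> 0.
Proof. by rewrite conv_actor_id; exact: (actor_conv0r (id_fell_actor E)). Qed.

Lemma sec_star_lin z (f g : sections E) :
  sec_star (sec_lin z f g) = sec_lin z^* (sec_star f) (sec_star g).
Proof.
apply: functional_extensionality_dep => x.
exact: (fstar_conjlin EP (ginvK x)).
Qed.

End ConvolutionAlgebra.

(** Expanding the right side gives a double sum over [g] and [h] in which, for each [g], only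
    [h = act A g z] survives. That term contains [fam A (f (g^-1)) 1], the vector by which the
    composite acts. *)
Lemma actor_conv_comp (R : realType) (E F D : scFellBundle R)
    (A : psFellActor E F) (B : psFellActor F D) (BA : psFellActor E D)
    (f : sections E) (u : sections D) : is_composite A B BA -> rfin f ->
  actor_conv BA f u =
  actor_conv B (actor_conv A f (unit_section (@sc_one R F))) u.
Proof.
move=> [rBA aBA fBA] ff; apply: functional_extensionality_dep => t.
have [AP BP] := (ps_fell_actor A, ps_fell_actor B).
have CP := sc_categorical F.
pose y := rho A (rho B t); pose z := rho B t.
pose P := [set g : sc_base E | gs g = y].
pose Q := [set h : sc_base F | gs h = z].
have rQ h : Q h -> rho A (ginv h) = y by move=> hz; rewrite rho_inv hz.
pose S h g := fibcoord (ginv h) (fam A (inc (f (ginv g)))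
  (inc (unit_section (@sc_one R F) (act A g (ginv h))))).
pose T h g := fibcoord t (fam B (inc (S h g)) (inc (u (act B h t)))).
have Ml h : Q h -> linear (fun v : fib F (ginv h) =>
    fibcoord t (fam B (inc v) (inc (u (act B h t))))).
  by move=> hz; apply: (fam_linl BP); rewrite ?bproj_inc ?gsVE ?rho_act ?actKg.
(* The arrow [act A g (h^-1)] is [w h^-1] with [w = act A g z]; it is a unit only if [h = w]. *)
have S0 h g : Q h -> P g -> S h g <> 0 -> h = act A g z.
  move=> hz gy nz; have c : gs g = rho A (ginv h) by rewrite rQ.
  have U : units _ (act A g (ginv h)).
    apply: contrapT => nU; apply: nz; rewrite /S unit_section_out//.
    by rewrite (lin_0 (fam_linr AP _ _)) ?bproj_inc ?gsVE ?rho_act ?actKg.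
  move: U; rewrite act_gr// grVE hz => /gmul_unit_inv; rewrite ginvK => -> //.
  by rewrite gs_act_rho// grVE.
have T0 h g : Q h -> P g -> T h g <> 0 -> h = act A g z.
  move=> hz gy nz; apply: S0 => // S0; apply: nz.
  by rewrite /T S0 (lin_0 (Ml _ hz)).
have fT h g : Q h -> P g -> S h g <> 0 -> f (ginv g) <> 0.
  move=> hz gy nz f0; apply: nz; rewrite /S f0.
  by rewrite (lin_0 (fam_linl AP _ _)) ?bproj_inc ?gsVE ?rho_act ?rQ// actKg ?rQ.
transitivity (\sum_(g \in P) \sum_(h \in Q) T h g); last first.
  rewrite (fsum_exchange (A := [set g | gs g = y /\ f (ginv g) <> 0])).
  - apply: eq_fsbigr => h /set_mem hz.
    rewrite /actor_conv (_ : [set g | gs g = rho A (ginv h)] = P); last first.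
      by apply/seteqP; split=> g; rewrite /P /= rQ.
    rewrite (fsum_additive (lin_add (Ml _ hz)))//.
    apply: sub_finite_set (rfin_inv y ff) => g [gy nz]; split=> //.
    exact: fT nz.
  - exact: rfin_inv.
  - move=> g gy _; apply: (@sub_finite_set _ _ [set act A g z]) => //.
    by move=> h [hz nz]; exact: T0.
  - move=> g h gy hz nz; split=> //; apply: (fT h) => // S0'; apply: nz.
    by rewrite /T S0' (lin_0 (Ml _ hz)).
rewrite /actor_conv rBA; apply: eq_fsbigr => g /set_mem gy.
have hz : Q (act A g z) by exact: gs_act_rho.
have rz : gr z = z by apply: gr_unit; exact: rho_units.
have E1 : act A g (ginv (act A g z)) = gr (act A g z).
  by rewrite -{1}rz act_inv.
have ug := unit_gr (act A g z).
rewrite (fsum_single (i := act A g z))//; last first.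
  by move=> h hQ hn; apply: contrapT => nz; apply: hn; exact: T0.
rewrite /T /S E1 inc_unit_section// aBA//.
have c1 : gs (ginv g) = rho A (gr (act A g z)) by rewrite rho_gr gsVE rho_act.
rewrite inc_fibcoord; last first.
  by apply: (bproj_famE AP); rewrite (bproj_one CP) ?bproj_inc// -E1 actKg// rQ.
rewrite fBA; last by rewrite !bproj_inc c1 rho_act// rho_gr.
by rewrite bproj_inc rho_act.
Qed.

(** * Compactly supported sections *)

Section CompactSupport.
Variables (R : realType) (G : etaleGroupoid) (E : fellData R G).
Implicit Types (f u : sections E) (U V : set G).

Lemma Cc0 : in_Cc (fun=> 0 : fib E _).
Proof.
exists 0%N, (fun=> set0), (fun=> 0), (fun=> fun=> 0).
by split=> [[]//|g]; rewrite big_ord0.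
Qed.

Lemma CcU_Cc U f : open_bisection U -> in_CcU U f -> in_Cc f.
Proof.
move=> bU fU; exists 1%N, (fun=> U), (fun=> 1), (fun=> f).
by split=> // g; rewrite big_ord1 scale1r.
Qed.

Lemma Cc_lin z f u : in_Cc f -> in_Cc u -> in_Cc (sec_lin z f u).
Proof.
move=> [n [U [c [a [Ua fE]]]]] [m [V [d [b [Vb uE]]]]].
exists (n + m)%N,
  (fun i : 'I_(n + m) => match fintype.split i with inl j => U j | inr j => V j end),
  (fun i : 'I_(n + m) => match fintype.split i with inl j => z * c j | inr j => d j end),
  (fun i : 'I_(n + m) => match fintype.split i with inl j => a j | inr j => b j end).
split; first by move=> i; case: (fintype.split i).
move=> g; rewrite /sec_lin fE uE big_split_ord /= scaler_sumr.
congr (_ + _); apply: eq_bigr => i _.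
  case: splitP => j /= ij; last by have := ltn_ord i; rewrite ij ltnNge leq_addr.
  by have -> : i = j; [exact: val_inj|rewrite scalerA].
case: splitP => j /= ij; first by have := ltn_ord j; rewrite -ij ltnNge leq_addr.
by have -> : i = j by apply: val_inj; apply/eqP; rewrite -(eqn_add2l n) ij.
Qed.

Lemma Cc_scale z f : in_Cc f -> in_Cc (fun x => z *: f x).
Proof.
move=> Cf; rewrite (_ : (fun x => _) = sec_lin z f (fun=> 0)).
  by apply: Cc_lin => //; exact: Cc0.
by apply: functional_extensionality_dep => x; rewrite /sec_lin addr0.
Qed.

(** Statements on the span are reduced to adding one section carried by a single bisection at a
    time. *)
Lemma Cc_ind (P : sections E -> Prop) : P (fun=> 0) ->
  (forall z U u f, open_bisection U -> in_CcU U u -> in_Cc f -> P f ->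
     P (sec_lin z u f)) ->
  forall f, in_Cc f -> P f.
Proof.
move=> P0 PS f [n [U [c [a [Ua fE]]]]].
have -> : f = fun g => \sum_(i < n) c i *: a i g.
  by apply: functional_extensionality_dep => g; rewrite fE.
elim: n U c a Ua {f fE} => [|n IH] U c a Ua.
  by rewrite (_ : (fun g => _) = fun=> 0)//; apply: functional_extensionality_dep => g;
    rewrite big_ord0.
rewrite (_ : (fun g => _) = sec_lin (c ord0) (a ord0)
   (fun g => \sum_(i < n) c (lift ord0 i) *: a (lift ord0 i) g)); last first.
  by apply: functional_extensionality_dep => g; rewrite big_ord_recl.
have [bU aU] := Ua ord0; apply: (PS _ (U ord0)) => //.
- by exists n, (fun i => U (lift ord0 i)), (fun i => c (lift ord0 i)),
    (fun i => a (lift ord0 i)); split.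
- exact: (IH (fun i => U (lift ord0 i)) (fun i => c (lift ord0 i))
    (fun i => a (lift ord0 i))).
Qed.

Lemma CcU_cvg U f (S : Type) (F : set_system S) (phi : S -> G) x : Filter F ->
  open U -> in_CcU U f -> U x -> phi @ F --> x ->
  (fun t => inc (f (phi t))) @ F --> inc (f x).
Proof. by move=> FF oU [cf _] Ux; exact: (open_within_cvg FF oU cf Ux). Qed.

Lemma CcU_out U f g : in_CcU U f -> f g <> 0 -> U g.
Proof. by move=> [_ [K [_ KU f0]]] fg; apply: KU; apply: contrapT => /f0. Qed.

Lemma CcU_rfin U f : open_bisection U -> in_CcU U f -> rfin f.
Proof.
move=> [_ _ injr] fU y.
have [[g0 [g0y fg0]]|N] := pselect (exists g, gr g = y /\ f g <> 0).
  apply: (@sub_finite_set _ _ [set g0]); last exact: finite_set1.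
  move=> g /= [gy fg]; apply: injr; [| |by rewrite gy]; apply/mem_set.
    exact: CcU_out fU fg.
  exact: CcU_out fU fg0.
apply: (@sub_finite_set _ _ set0) => // g gP.
by apply: N; exists g.
Qed.

Lemma rfin_lin z f u : rfin f -> rfin u -> rfin (sec_lin z f u).
Proof.
move=> ff fu y; apply: (@sub_finite_set _ _ _ _ (_ : finite_set (_ `|` _))).
  2: by rewrite finite_setU; split; [exact: ff y|exact: fu y].
move=> g /= [gy nz]; have [f0|] := pselect (f g = 0); last by left.
right; split=> // u0; apply: nz.
by rewrite /sec_lin f0 u0 scaler0 addr0.
Qed.

Lemma Cc_rfin f : in_Cc f -> rfin f.
Proof.
apply: Cc_ind => [y|z U u {}f bU uU _ ff].
  by apply: (@sub_finite_set _ _ set0) => // g [].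
by apply: rfin_lin => //; exact: CcU_rfin uU.
Qed.

End CompactSupport.

Section StarCompactSupport.
Variables (R : realType) (G : etaleGroupoid) (E : fellData R G).
Hypothesis EP : is_fell_bundle E.
Implicit Types (f u : sections E) (U V : set G).

Lemma bisection_inv U : open_bisection U -> open_bisection (@ginv G @^-1` U).
Proof.
move=> [oU injs injr]; split.
- exact: (open_comp (in1W (ginv_continuous (egroupoidP G)))).
- move=> x y /set_mem /= Ux /set_mem /= Uy xy; rewrite -[x]ginvK -[y]ginvK.
  by congr ginv; apply: injr; rewrite ?inE// !grVE.
- move=> x y /set_mem /= Ux /set_mem /= Uy xy; rewrite -[x]ginvK -[y]ginvK.
  by congr ginv; apply: injs; rewrite ?inE// !gsVE.
Qed.

Lemma CcU_star U f : open U -> in_CcU U f ->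
  in_CcU (@ginv G @^-1` U) (sec_star f).
Proof.
move=> oU fU; split.
  apply: (continuous_withinI (f' := fun x => fstar (inc (f (ginv x))))).
    by move=> x _; exact: inc_sec_star.
  move=> x F FF Ux Fx _; apply: (fstar_cvg EP FF).
  by apply: (CcU_cvg FF oU fU Ux); exact: ginv_cvg.
have [_ [K [cK KU f0]]] := fU.
exists (@ginv G @` K); split.
- apply: continuous_compact => //; apply: continuous_subspaceT.
  exact: (ginv_continuous (egroupoidP G)).
- by move=> _ [x Kx <-]; rewrite /= ginvK; exact: KU.
- move=> g nK; rewrite /sec_star f0; last first.
    by move=> Kg; apply: nK; exists (ginv g); rewrite ?ginvK.
  exact: (conj_lin_0 (fstar_conjlin EP (ginvK g))).
Qed.

(** On the product bisection each arrow factors uniquely, so the sum has one term and is continuous.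
    The last clause is used to see that a product of the form [u^* u] is carried by units. *)
Lemma CcU_conv U V f u : open_bisection U -> open_bisection V ->
  in_CcU U f -> in_CcU V u ->
  exists W, [/\ open_bisection W, in_CcU W (convolution f u) &
    forall x, W x -> exists a v, [/\ U a, V v, gs a = gr v & x = gmul a v]].
Proof.
move=> [oU sU rU] [oV sV rV] fU uV.
pose v x := slift V (gs x); pose a x := gmul x (ginv (v x)).
(* [W] is the set of products of [U] and [V], written with the only possible factors: [v x] is the
   arrow of [V] with the source of [x], and [a x] is what remains on the left. *)
pose W := [set x | (@gs G @` V) (gs x) /\ U (a x)].
have vP x : W x -> V (v x) /\ gs (v x) = gs x by move=> [Vx _]; exact: sliftP.
have aP x : W x -> gs (a x) = gr (v x) /\ gr (a x) = gr x.
  move=> Wx; have [Vv sv] := vP x Wx.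
  by rewrite /a gsME ?grME ?gsVE ?grVE.
have avE x : W x -> gmul (a x) (v x) = x.
  by move=> Wx; have [Vv sv] := vP x Wx; rewrite /a gmulgKV.
have Wh x h : gs h = gr x -> U (ginv h) -> V (gmul h x) ->
    [/\ W x, v x = gmul h x & a x = ginv h].
  move=> hx Uh Vhx.
  have vE : v x = gmul h x by rewrite /v -(gsME hx) sliftK.
  have aE : a x = ginv h.
    rewrite /a vE ginvM// gmulAE ?grVE ?gsVE//.
    by rewrite (gmulgV (egroupoidP G)) gmul_unitl ?grVE//; exact: unit_gr.
  split=> //; split; last by rewrite aE.
  by exists (gmul h x); rewrite ?gsME.
have termN0 x h : gs h = gr x ->
    fibcoord x (fmul (inc (f (ginv h))) (inc (u (gmul h x)))) <> 0 ->
    f (ginv h) <> 0 /\ u (gmul h x) <> 0.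
  move=> hx nz; split=> z0; apply: nz; rewrite z0.
    rewrite (lin_0 (fmul_linl EP _ _)) ?bproj_inc//; first by rewrite gsVE grME.
    by rewrite gmulKg.
  rewrite (lin_0 (fmul_linr EP _ _)) ?bproj_inc//; first by rewrite gsVE grME.
  by rewrite gmulKg.
have convE x : W x -> inc (convolution f u x) = fmul (inc (f (a x))) (inc (u (v x))).
  move=> Wx; have [Vv sv] := vP x Wx; have [sa ra] := aP x Wx.
  have hE : gmul (ginv (a x)) x = v x by rewrite -{2}(avE x Wx) gmulKg.
  rewrite /convolution (fsum_single (i := ginv (a x))) /=; last 2 first.
  - by rewrite gsVE ra.
  - move=> h hx hn; apply: contrapT => /(termN0 _ _ hx)[fh uh]; apply: hn.
    have [_ _ ->] := Wh x h hx (CcU_out fU fh) (CcU_out uV uh).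
    by rewrite ginvK.
  rewrite ginvK hE inc_fibcoord//.
  by apply: (bproj_fmul EP); rewrite !bproj_inc// avE.
have vcvg x (F : set_system G) : Filter F -> W x -> F --> x -> v @ F --> v x.
  move=> FF Wx Fx; have [Vv sv] := vP x Wx.
  by apply: (slift_cvg FF oV sV Vv); rewrite sv; exact: gs_cvg.
have nv x (F : set_system G) : Filter F -> W x -> F --> x ->
    \forall t \near F, V (v t) /\ gs (v t) = gs t.
  move=> FF Wx Fx; have [Vv sv] := vP x Wx.
  by apply: (near_slift FF oV Vv); rewrite sv; exact: gs_cvg.
have acvg x (F : set_system G) : Filter F -> W x -> F --> x -> a @ F --> a x.
  move=> FF Wx Fx; have [Vv sv] := vP x Wx; apply: gmul_cvg => //.
  - by rewrite grVE.
  - by apply: filterS (nv x F FF Wx Fx) => t [_ tE]; rewrite grVE tE.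
  - by apply: ginv_cvg; exact: vcvg.
have Wprod x : W x -> exists a v, [/\ U a, V v, gs a = gr v & x = gmul a v].
  move=> Wx; exists (a x), (v x); rewrite avE//; split=> //; first by case: Wx.
    by case: (vP x Wx).
  by case: (aP x Wx).
exists W; split=> //; first split.
- rewrite openE => x Wx; have [Vv sv] := vP x Wx.
  have nU : nbhs (a x) U by apply: open_nbhs_nbhs; split=> //; case: Wx.
  have FF := nbhs_filter x.
  have := cvg_nbhsE (acvg x _ FF Wx (fun _ => id)) nU.
  apply: filterS2 (nv x _ FF Wx (fun _ => id)) => t [Vt st] Ut.
  by split=> //; exists (v t).
- move=> x y /set_mem Wx /set_mem Wy xy.
  have vxy : v x = v y by rewrite /v xy.
  rewrite -(avE x Wx) -(avE y Wy) vxy; congr gmul.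
  have [[_ Ux] [_ Uy]] := (Wx, Wy); apply: sU; rewrite ?inE//.
  by rewrite (aP x Wx).1 (aP y Wy).1 vxy.
- move=> x y /set_mem Wx /set_mem Wy xy.
  have axy : a x = a y.
    have [[_ Ux] [_ Uy]] := (Wx, Wy); apply: rU; rewrite ?inE//.
    by rewrite (aP x Wx).2 (aP y Wy).2.
  rewrite -(avE x Wx) -(avE y Wy) axy; congr gmul.
  have [[Vx _] [Vy _]] := (vP x Wx, vP y Wy); apply: rV; rewrite ?inE//.
  by rewrite -(aP x Wx).1 -(aP y Wy).1 axy.
split.
  apply: (continuous_withinI (f' := fun x => fmul (inc (f (a x))) (inc (u (v x))))) => //.
  move=> x F FF Wx Fx nW; apply: (fmul_cvg EP) => //.
  - by rewrite /bcomposable /composable !bproj_inc (aP x Wx).1.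
  - by apply: filterS nW => t Wt; rewrite /bcomposable /composable !bproj_inc (aP t Wt).1.
  - by apply: (CcU_cvg FF oU fU); [case: Wx|exact: acvg].
  - by apply: (CcU_cvg FF oV uV); [case: (vP x Wx)|exact: vcvg].
have [_ [K [cK KU f0]]] := fU; have [_ [L [cL LV u0]]] := uV.
exists [set gmul q.1 q.2 | q in (K `*` L) `&` [set q | gs q.1 = gr q.2]]; split.
- exact: compact_gmul.
- move=> _ [[g h] /= [[Kg Lh] gh] <-].
  have [] := Wh (gmul g h) (ginv g) => //; rewrite ?gsVE ?grME ?ginvK//.
    exact: KU.
  by rewrite gmulKg//; exact: LV.
- move=> x nx; apply: fsbig1 => h /= hx.
  apply: contrapT => /(termN0 _ _ hx)[fh uh]; apply: nx.
  exists (ginv h, gmul h x) => /=; last by rewrite gmulKg.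
  split; last by rewrite gsVE grME.
  by split; apply: contrapT => n; [apply: fh; exact: f0|apply: uh; exact: u0].
Qed.

End StarCompactSupport.

Section CcAlgebra.
Variables (R : realType) (E : scFellBundle R).
Let EP := sc_fell E.
Implicit Types f u : sections E.

Lemma Cc_star f : in_Cc f -> in_Cc (sec_star f).
Proof.
move: f; apply: Cc_ind => [|z U u f bU uU _ Cf].
  rewrite (_ : sec_star _ = fun=> 0); first exact: Cc0.
  apply: functional_extensionality_dep => x.
  exact: (conj_lin_0 (fstar_conjlin EP (ginvK x))).
rewrite sec_star_lin; apply: Cc_lin => //.
apply: CcU_Cc (bisection_inv bU) _; apply: CcU_star => //.
by case: bU.
Qed.

Lemma Cc_conv f u : in_Cc f -> in_Cc u -> in_Cc (convolution f u).
Proof.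
move=> Cf Cu; move: f Cf; apply: Cc_ind => [|z U f f' bU fU Cf' IH].
  by rewrite conv0l; exact: Cc0.
rewrite conv_linl; [|exact: CcU_rfin fU|exact: Cc_rfin].
apply: Cc_lin => //; move: u Cu {IH}; apply: Cc_ind => [|d V u u' bV uV _ IH].
  by rewrite conv0r; exact: Cc0.
rewrite conv_linr; last exact: CcU_rfin fU.
apply: Cc_lin => //; have [W [bW fW _]] := CcU_conv EP bU bV fU uV.
exact: CcU_Cc fW.
Qed.

End CcAlgebra.

(** * The induced homomorphism on compactly supported sections *)

Section ActorImage.
Variables (R : realType) (E F : scFellBundle R) (A : psFellActor E F).
Let G := sc_base E. Let H := sc_base F.
Let EP := sc_fell E. Let FP := sc_fell F. Let AP := ps_fell_actor A.
Let CP := sc_categorical F.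
Let one := @sc_one R F.
Implicit Types (U : set G) (f : sections E).

Definition actor_hom f : sections F := actor_conv A f (unit_section one).

(** The source determines the arrow [g y] of [U] that acts at the unit [y], so the image is carried
    by the range of the partial section [sg] of the source map, and the sum has one term. *)
Lemma CcU_actor_hom U f : open_bisection U -> in_CcU U f ->
  exists2 V, open_bisection V & in_CcU V (actor_hom f).
Proof.
move=> [oU sU rU] fU.
pose g y := slift U (rho A y).
pose sg y := act A (g y) y.
pose V := [set x : H | (@gs G @` U) (rho A (gs x)) /\ sg (gs x) = x].
have gP y : (@gs G @` U) (rho A y) -> U (g y) /\ gs (g y) = rho A y by exact: sliftP.
have gcvg y (Z : set_system H) : Filter Z -> (@gs G @` U) (rho A y) -> Z --> y ->
    g @ Z --> g y.
  move=> ZF Uy Zy; have [Ug sgE] := gP y Uy.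
  by apply: (slift_cvg ZF oU sU Ug); rewrite sgE; exact: rho_cvg.
have ng y (Z : set_system H) : Filter Z -> (@gs G @` U) (rho A y) -> Z --> y ->
    \forall t \near Z, U (g t) /\ gs (g t) = rho A t.
  move=> ZF Uy Zy; have [Ug sgE] := gP y Uy.
  by apply: (near_slift ZF oU Ug); rewrite sgE; exact: rho_cvg.
have sgcvg y (Z : set_system H) : Filter Z -> (@gs G @` U) (rho A y) -> Z --> y ->
    sg @ Z --> sg y.
  move=> ZF Uy Zy; apply: act_cvg => //.
  - by case: (gP y Uy).
  - by apply: filterS (ng y Z ZF Uy Zy) => t [].
  - exact: gcvg.
have VP x : V x -> [/\ U (g (gs x)), gs (g (gs x)) = rho A (gs x),
    sg (gs x) = x & gr (g (gs x)) = rho A x].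
  move=> [Ux xE]; have [Ug sgE] := gP _ Ux; split=> //.
  by rewrite -{2}xE rho_act.
have Vh x h : gs h = rho A x -> units H (act A h x) -> U (ginv h) ->
    [/\ V x, g (gs x) = ginv h & act A h x = gs x].
  move=> hx uh Uh.
  have hE : act A h x = gs x by rewrite -(gs_unit uh) gs_act.
  have sE : gs (ginv h) = rho A (gs x) by rewrite gsVE -hE rho_act.
  have gE : g (gs x) = ginv h by rewrite /g -sE sliftK.
  split=> //; split; first by exists (ginv h).
  by rewrite /sg gE -hE actKg.
have termN0 x h : gs h = rho A x ->
    fibcoord x (fam A (inc (f (ginv h))) (inc (unit_section one (act A h x)))) <> 0 ->
    f (ginv h) <> 0 /\ units H (act A h x).
  move=> hx nz; split=> [z0|]; first apply: nz; last first.
    apply: contrapT => nu; apply: nz; rewrite unit_section_out//.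
    by rewrite (lin_0 (fam_linr AP _ _)) ?bproj_inc ?gsVE ?rho_act ?actKg.
  rewrite z0 (lin_0 (fam_linl AP _ _)) ?bproj_inc//; first by rewrite gsVE rho_act.
  by rewrite actKg.
have homE x : V x -> inc (actor_hom f x) = fam A (inc (f (g (gs x)))) (one (gs x)).
  move=> Vx; have [Ug sE xE rE] := VP x Vx.
  have aE : act A (ginv (g (gs x))) x = gs x by rewrite -{2}xE actKg.
  have us := unit_gs x.
  rewrite /actor_hom /actor_conv (fsum_single (i := ginv (g (gs x)))) /=; last 2 first.
  - by rewrite gsVE rE.
  - move=> h hx hn; apply: contrapT => /(termN0 _ _ hx)[fh uh]; apply: hn.
    have [_ -> _] := Vh x h hx uh (CcU_out fU fh).
    by rewrite ginvK.
  rewrite ginvK aE inc_unit_section// inc_fibcoord//.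
  by apply: (bproj_famE AP); rewrite (bproj_one CP)// bproj_inc.
exists V; first split.
- rewrite openE => x Vx; have [Ug sE xE rE] := VP x Vx.
  (* For [t] near [x], both [t] and [sg (gs t)] lie in the bisection [W] around [x] and have the
     same source, hence coincide; this makes [V] open. *)
  have [W [oW sW _] Wx] := bisection_ex x.
  have FF := nbhs_filter x.
  have gsx : (@gs H) @ x --> gs x by exact: gs_continuous.
  have Ux : (@gs G @` U) (rho A (gs x)) by case: Vx.
  have nW : nbhs x W by exact: open_nbhs_nbhs.
  have F2 : Filter (@gs H @ x) by exact: fmap_filter.
  have sgW := cvg_nbhsE (sgcvg _ _ F2 Ux gsx).
  rewrite xE in sgW; have {}sgW := sgW _ nW.
  have ngx := ng _ _ F2 Ux gsx.
  have H1 : nbhs x [set t | W (sg (gs t))] by exact: sgW.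
  have H2 : nbhs x [set t | U (g (gs t)) /\ gs (g (gs t)) = rho A (gs t)] by exact: ngx.
  apply: filterS3 nW H1 H2 => t Wt Wst [Ut st].
  split; first by exists (g (gs t)).
  by apply: sW; rewrite ?inE// /sg gs_act// gssE.
- move=> x y /set_mem Vx /set_mem Vy xy.
  by have [_ _ <- _] := VP x Vx; have [_ _ <- _] := VP y Vy; rewrite xy.
- move=> x y /set_mem Vx /set_mem Vy xy.
  have [Ux sx xE rx] := VP x Vx; have [Uy sy yE ry] := VP y Vy.
  (* The range of [g (gs x)] is [rho A x], which depends on [gr x] only. So equal ranges force equal
     lifts, and [key] recovers the arrow from its lift and its range. *)
  have gE : g (gs x) = g (gs y).
    by apply: rU; rewrite ?inE// rx ry -(rho_gr A x) xy rho_gr.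
  have key z : V z -> act A (ginv (g (gs z))) (gr z) = ginv z.
    move=> Vz; have [Uz sz zE rz] := VP z Vz.
    have c : gs (ginv (g (gs z))) = rho A z by rewrite gsVE.
    apply: gmul_unit_inv; first by rewrite gs_act ?rho_gr// gsrE.
    by rewrite -act_gr// -{2}zE actKg//; exact: unit_gs.
  by rewrite -[x]ginvK -[y]ginvK -(key x Vx) -(key y Vy) gE xy.
split.
  apply: (continuous_withinI
    (f' := fun x => fam A (inc (f (g (gs x)))) (one (gs x)))) => //.
  move=> x Z ZF Vx Zx nV; have [Ug sE xE rE] := VP x Vx.
  have Ux : (@gs G @` U) (rho A (gs x)) by case: Vx.
  have gsx : (@gs H) @ Z --> gs x by exact: gs_cvg.
  apply: (fam_cvg AP) => //.
  - by rewrite /fa_dom bproj_inc (bproj_one CP)//; exact: unit_gs.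
  - apply: filterS nV => t Vt; have [_ st _ _] := VP t Vt.
    by rewrite /fa_dom bproj_inc (bproj_one CP)//; exact: unit_gs.
  - apply: (CcU_cvg ZF oU fU Ug).
    have F2 : Filter (@gs H @ Z) by exact: fmap_filter.
    by have := gcvg (gs x) _ F2 Ux gsx.
  - apply: (one_cvg FP CP) => //; first exact: unit_gs.
    by apply: filterE => t; exact: unit_gs.
have [_ [K [cK KU f0]]] := fU.
(* Properness of the underlying actor makes [L] compact; its image under [sg] contains the
   support. *)
pose L := units H `&` rho A @^-1` (@gs G @` K).
have cL : compact L.
  apply: (ps_proper A).1.
    by apply: continuous_compact => //; apply: continuous_subspaceT; exact: gs_continuous.
  by move=> _ [k _ <-]; exact: unit_gs.
have LU y : L y -> (@gs G @` U) (rho A y).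
  by move=> [_ [k Kk <-]]; exists k => //; exact: KU.
exists (sg @` L); split.
- apply: compact_image_filter => // y Ly.
  by apply: sgcvg; [exact: LU|exact: cvg_within].
- move=> _ [y Ly <-]; have [Ug sE] := gP y (LU y Ly).
  have yE : gs (sg y) = y by rewrite /sg gs_act//; case: Ly.
  by split; rewrite yE//; exact: LU.
- move=> x nx; apply: fsbig1 => h /= hx.
  apply: contrapT => /(termN0 _ _ hx)[fh uh]; apply: nx.
  have [Vx gE aE] := Vh x h hx uh (CcU_out fU fh).
  exists (gs x); last by case: Vx.
  split; first exact: unit_gs.
  exists (ginv h); last by rewrite gsVE -aE rho_act.
  by apply: contrapT => n; apply: fh; exact: f0.
Qed.

Lemma Cc_actor_hom f : in_Cc f -> in_Cc (actor_hom f).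
Proof.
move: f; apply: Cc_ind => [|z U f f' bU fU Cf' IH].
  by rewrite /actor_hom actor_conv0l//; exact: Cc0.
rewrite /actor_hom actor_conv_linl//; [|exact: CcU_rfin fU|exact: Cc_rfin].
apply: Cc_lin => //; have [V bV fV] := CcU_actor_hom bU fU.
exact: CcU_Cc fV.
Qed.

Lemma actor_hom_conv f (u : sections F) : in_Cc f ->
  convolution (actor_hom f) u = actor_conv A f u.
Proof.
move=> Cf; rewrite /actor_hom -(actor_conv_convr FP AP); last 2 first.
- exact: Cc_rfin.
- exact: rfin_unit_section.
by rewrite (conv_unitl FP CP).
Qed.

Lemma actor_hom_Phi0 : is_Phi0 A actor_hom.
Proof.
split; last by move=> f u Cf Cu x; rewrite actor_hom_conv.
split.
- exact: Cc_actor_hom.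
- move=> z f u Cf Cu; rewrite /actor_hom actor_conv_linl//; exact: Cc_rfin.
- move=> f u Cf Cu; rewrite actor_hom_conv// /actor_hom.
  by rewrite (actor_conv_convl EP AP)//; exact: Cc_rfin.
- move=> f Cf; rewrite /actor_hom (actor_conv_star EP FP AP CP)//.
  exact: Cc_rfin.
Qed.

End ActorImage.

Lemma normcR (R : realType) (x : R) : `|x%:C| = `|x|%:C :> R[i].
Proof.
have [x0|x0] := leP 0 x; first by rewrite !ger0_norm// lecR.
by rewrite !ltr0_norm// ?ltcR// -rmorphN.
Qed.

Lemma real_complex_cvg (R : realType) (S : Type) (F : set_system S) (f : S -> R) (x : R) :
  Filter F -> f @ F --> x -> (fun t => (f t)%:C) @ F --> (x%:C : R[i]^o).
Proof.
move=> FF fx; have [_ H] := @cvgrPdist_lt _ R[i]^o _ F FF (fun t => (f t)%:C) x%:C.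
apply: H => eps eps0.
have E := ge0_Re (ltW eps0); move: eps0; rewrite E ltcR => eps0.
have [/(_ fx _ eps0) H _] := @cvgrPdist_lt _ R^o _ F FF f x.
by apply: filterS H => t /=; rewrite -rmorphB normcR ltcR.
Qed.

(** * Compactly supported local units and uniqueness *)

Section Bump.
Variables (R : realType) (E : scFellBundle R).
Let G := sc_base E.
Let GP := egroupoidP G.
Let EP := sc_fell E.
Let CP := sc_categorical E.
Let one := @sc_one R E.

(** The unit section is multiplied by a function with compact support on the unit space that is 1 at
    [y]. *)
Lemma bump_ex y : units G y -> exists2 u : sections E, in_CcU (units G) u &
  inc (u y) = one y.
Proof.
move=> uy; pose y' : units G := exist _ y (mem_set uy).
have [K' nK [cK clK]] : exists2 K' : set (units G), nbhs y' K' & compact K' /\ closed K'.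
  have [K' nK cK] := units_locally_compact GP (x := y') I.
  have {}nK : nbhs y' [set t | [set: units G] t -> K' t] by exact: nK.
  by exists K' => //; apply: filterS nK => t /(_ I).
(* The closed set to separate from [y] is the complement of the interior of [K']: [f] is 0 at [y]
   and 1 there, so [1 - f] is 1 at [y] and vanishes outside [K']. *)
have H := @locally_compact_completely_regular _ R
  (units_locally_compact GP) (units_hausdorff GP) y' (~` K'^°).
have /(_ _ _)/(@uniform_separatorP _ R)[] := H.
- by apply: open_closedC; exact: open_interior.
- by apply.
move=> f [cf _ f0 f1].
pose phi := valL_ 0 (fun t : units G => 1 - f t).
have cphi : {within units G, continuous phi}.
  apply/subspace_valL_continuousP' => t.
  by apply: (@cvgB _ R^o _ (nbhs t) _ (fun=> 1) f); [exact: cvg_cst|exact: cf].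
have phiE (t : units G) : phi (val t) = 1 - f t.
  have := congr1 (fun g => g t) (@valLK _ _ 0 (units G) (fun t => 1 - f t)).
  by [].
pose u : sections E := fun x => (phi x)%:C *: unit_section one x.
exists u; last first.
  rewrite /u (phiE y') (_ : f y' = 0) ?subr0 ?scale1r ?inc_unit_section//.
  by apply: f0; exists y'.
split.
  apply: continuous_within_at => x ux.
  apply: (bscale_cvg (p := id) (fell_usc EP)).
    apply: real_complex_cvg.
    exact: (open_within_cvg _ (@open_units G) cphi ux (fun _ => id)).
  have := @one_cvg _ _ _ EP one _ (nbhs x) id x CP (nbhs_filter x) ux
    (nbhs_units ux) (fun _ => id).
  rewrite inc_unit_section//; apply: cvg_trans; apply: near_eq_cvg.
  by apply: filterS (nbhs_units ux) => t ut; rewrite inc_unit_section.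
exists (val @` K'); split.
- apply: continuous_compact => //; apply: continuous_subspaceT.
  exact: initial_continuous.
- by move=> _ [t _ <-]; apply: set_mem; exact: valP.
- move=> x nx; rewrite /u; have [ux|nu] := pselect (units G x); last first.
    by rewrite unit_section_out// scaler0.
  pose x' : units G := exist _ x (mem_set ux).
  rewrite (phiE x') (f1 (f x')) ?subrr ?scale0r//.
  exists x' => // /interior_subset Kx; apply: nx; by exists x'.
Qed.

End Bump.

Lemma dense_eq (X Y : topologicalType) (S : set X) (f g : X -> Y) :
  hausdorff_space Y -> dense S -> continuous f -> continuous g ->
  (forall x, S x -> f x = g x) -> forall x, f x = g x.
Proof.
move=> hY dS cf cg fg x; apply/eqP/negPn/negP => fgx.
move: (hY); rewrite open_hausdorff => /(_ _ _ fgx)[[P Q]] /= [/set_mem Px /set_mem Qx].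
move=> [oP oQ /eqP PQ].
have [||y [[Py Qy] Sy]] := dS (f @^-1` P `&` g @^-1` Q).
- by exists x.
- by apply: openI; [exact: (open_comp (in1W cf))|exact: (open_comp (in1W cg))].
have : (P `&` Q) (f y) by split=> //; rewrite fg.
by rewrite PQ.
Qed.

Section PhiUnique.
Variables (R : realType) (E F : scFellBundle R) (A : psFellActor E F).
Let FP := sc_fell F.
Let CP := sc_categorical F.

(** At [x] both sums only see units of the form [act A g x], and each of these equals [gs x];
    agreement with the unit section at that one point suffices. *)
Lemma actor_conv_bump (f : sections E) (u : sections F) x :
  in_CcU (units (sc_base F)) u -> inc (u (gs x)) = sc_one (gs x) ->
  actor_conv A f u x = actor_hom A f x.
Proof.
move=> uU ux; apply: eq_fsbigr => g /set_mem /= gx.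
have [U|nU] := pselect (units _ (act A g x)); last first.
  rewrite [in RHS]unit_section_out//; suff -> : u (act A g x) = 0 by [].
  by apply: contrapT => /(CcU_out uU).
have -> : act A g x = gs x by rewrite -(gs_unit U) gs_act.
by rewrite ux inc_unit_section//; exact: unit_gs.
Qed.

(** The defining formula only tests compactly supported [u]. For each [x] a bump at [gs x] stands in
    for the unit section, on both sides of the formula. *)
Lemma Phi0_uniq (Phi0 : sections E -> sections F) (f : sections E) :
  is_Phi0 A Phi0 -> in_Cc f -> Phi0 f = actor_hom A f.
Proof.
move=> [_ H] Cf; apply: functional_extensionality_dep => x.
have [u uU ux] := bump_ex (unit_gs x).
have Cu : in_Cc u by apply: CcU_Cc uU; exact: bisection_units.
rewrite -(actor_conv_bump _ uU ux) -[RHS]H//.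
have -> : convolution (Phi0 f) u x = convolution (Phi0 f) (unit_section (@sc_one R F)) x.
  apply: eq_fsbigr => h /set_mem /= hx.
  have [U|nU] := pselect (units _ (gmul h x)); last first.
    rewrite [in RHS]unit_section_out//; suff -> : u (gmul h x) = 0 by [].
    by apply: contrapT => /(CcU_out uU).
  have -> : gmul h x = gs x by rewrite -(gs_unit U) gsME.
  by rewrite ux inc_unit_section//; exact: unit_gs.
by rewrite (conv_unitr FP CP).
Qed.

End PhiUnique.

Lemma actor_hom_id (R : realType) (E : scFellBundle R) (f : sections E) :
  actor_hom (id_psFellActor E) f = f.
Proof.
by rewrite /actor_hom -(conv_actor_id f) (conv_unitr (sc_fell E) (sc_categorical E)).
Qed.

Lemma actor_hom_comp (R : realType) (E F D : scFellBundle R)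
    (A : psFellActor E F) (B : psFellActor F D) (BA : psFellActor E D)
    (f : sections E) : is_composite A B BA -> in_Cc f ->
  actor_hom BA f = actor_hom B (actor_hom A f).
Proof. by move=> cBA Cf; rewrite /actor_hom (actor_conv_comp _ cBA)//; exact: Cc_rfin. Qed.

Lemma extension_uniq (R : realType) (E : scFellBundle R) (CE CD : cstarAlgebra R)
    (iE : sections E -> CE) (P Q : starHom CE CD) : is_full_cstar iE ->
  continuous P -> continuous Q ->
  (forall f, in_Cc f -> P (iE f) = Q (iE f)) -> forall a, P a = Q a.
Proof.
move=> iEP cP cQ PQ; apply: (dense_eq _ (iota_dense iEP) cP cQ).
  exact: norm_hausdorff.
by move=> _ [f Cf <-]; exact: PQ.
Qed.

Lemma starHom_eq (R : realType) (A B : cstarAlgebra R) (P Q : starHom A B) :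
  (forall a, P a = Q a) -> P = Q.
Proof.
case: P => p p1 p2 p3; case: Q => q q1 q2 q3 /= pq.
have E : p = q by apply: funext.
by move: p1 p2 p3 {pq}; rewrite E => *; f_equal; exact: Prop_irrelevance.
Qed.

Lemma starHom_category (R : realType) :
  is_category (@starHom_id R) (@starHom_comp R).
Proof. by split=> *; exact: starHom_eq. Qed.

(** * Finiteness of the maximal seminorm *)

Section CstarNorm.
Variables (R : realType) (D : cstarAlgebra R).
Implicit Types a b h : D.
Local Notation C := R[i].

Lemma cmul_linl b : linear (fun a => cmul a b).
Proof. by case: (@cmul_bilinear _ D) => H _; exact: H. Qed.

Lemma cmul_linr a : linear (cmul a).
Proof. by case: (@cmul_bilinear _ D) => _ H; exact: H. Qed.

Lemma cstar_conjlin : is_conj_linear (@cstar _ D).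
Proof. exact: cstar_conj_linear. Qed.

Lemma cstarZ (z : C) a : cstar (z *: a) = z^* *: cstar a.
Proof.
by have := cstar_conjlin z a 0; rewrite (conj_lin_0 cstar_conjlin) !addr0.
Qed.

Lemma cstarB a b : cstar (a - b) = cstar a - cstar b.
Proof.
rewrite (conj_lin_add cstar_conjlin) -scaleN1r cstarZ rmorphN rmorph1.
by rewrite scaleN1r.
Qed.

Lemma cstar_norm_le a : `|a| <= `|cstar a|.
Proof.
have [->|a0] := eqVneq a 0; first by rewrite normr0.
have na : 0 < `|a| by rewrite normr_gt0.
by rewrite -(ler_pM2r na) -expr2 -cstar_identity; exact: cmul_norm.
Qed.

Lemma cstar_norm a : `|cstar a| = `|a|.
Proof.
by apply/eqP; rewrite eq_le cstar_norm_le andbT -{2}[a]cstarK cstar_norm_le.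
Qed.

End CstarNorm.

Lemma exp_half_small (R : realType) (eps : R[i]) : 0 < eps ->
  exists n, (2^-1 : R[i]) ^+ n < eps.
Proof.
move=> eps0; have E := ge0_Re (ltW eps0); move: eps0; rewrite E ltcR => e0.
have c0 : (fun n => (2^-1 : R) ^+ n) @ \oo --> (0 : R^o).
  by apply: cvg_expr; rewrite ger0_norm ?invr_ge0// invf_lt1 ?ltr1n.
have [H' _] := @cvgrPdist_lt _ R^o _ _ eventually_filter (fun n => (2^-1 : R) ^+ n) 0.
have [n _ Hn] := H' c0 _ e0; exists n; have := Hn n (leqnn n).
rewrite /= sub0r normrN ger0_norm ?exprn_ge0 ?invr_ge0// -ltcR.
by rewrite rmorphXn /= fmorphV rmorph_nat.
Qed.

(** Identities for the limit are proved through this: the defect is bounded by a constant times the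
    error of the iteration. *)
Lemma small_eq0 (R : realType) (V : normedModType R[i]) (v : V) (K : R[i]) :
  (forall n, `|v| <= K * 2^-1 ^+ n) -> v = 0.
Proof.
move=> H; apply/eqP/negPn/negP => v0.
have nv : 0 < `|v| by rewrite normr_gt0.
have K0 : 0 < K by have := lt_le_trans nv (H 0%N); rewrite expr0 mulr1.
have [n Hn] := exp_half_small (divr_gt0 nv K0).
have := le_lt_trans (H n) (_ : K * 2^-1 ^+ n < `|v|).
by rewrite mulrC -ltr_pdivlMr// ltxx => /(_ Hn).
Qed.

Lemma cauchy_seq_cvg (R : realType) (V : completeNormedModType R[i]) (c : nat -> V) :
  (forall eps : R[i], 0 < eps -> exists n0, forall n, (n0 <= n)%N ->
     `|c n0 - c n| < eps) ->
  exists l, forall eps : R[i], 0 < eps -> \forall n \near \oo, `|l - c n| < eps.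
Proof.
move=> Hc; have /cauchy_cvg : cauchy (c @ \oo).
  apply: cauchy_exP => eps eps0; have [n0 Hn] := Hc eps eps0.
  by exists (c n0); exists n0 => // n /= /Hn; rewrite -ball_normE.
move=> /cvg_ex[l cl]; exists l => eps eps0.
by have /cvgrPdist_lt/(_ eps eps0) := cl.
Qed.

Lemma geometric_limit (R : realType) (V : completeNormedModType R[i])
    (c : nat -> V) : (forall n, `|c n.+1 - c n| <= 2^-1 ^+ n) ->
  exists l, forall n, `|l - c n| <= 2 * 2^-1 ^+ n.
Proof.
move=> Hc; set q : R[i] := 2^-1.
have q0 : 0 < q by rewrite invr_gt0 ltr0n.
have qS n : 2 * q ^+ n.+1 = q ^+ n by rewrite exprS mulrA divff ?mul1r// pnatr_eq0.
(* The right side is the exact sum of the geometric bounds from [n] to [n + k - 1], which lets the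
   induction close. *)
have tail n k : `|c (n + k)%N - c n| <= 2 * q ^+ n - 2 * q ^+ (n + k).
  elim: k => [|k IH]; first by rewrite addn0 !subrr normr0.
  rewrite addnS -[c _.+1](subrK (c (n + k)%N)) -addrA.
  apply: le_trans (ler_normD _ _) _; apply: le_trans (lerD (Hc _) IH) _.
  by rewrite qS -/q [leLHS](_ : _ = 2 * q ^+ n - q ^+ (n + k))//; ring.
have {}tail n m : (n <= m)%N -> `|c m - c n| <= 2 * q ^+ n.
  move=> nm; rewrite -(subnKC nm); apply: le_trans (tail _ _) _.
  by rewrite gerBl mulr_ge0// exprn_ge0// ltW.
have [eps eps0|l Hl] := @cauchy_seq_cvg _ _ c.
  have e2 : 0 < eps / 2 by rewrite divr_gt0.
  have [n0 Hn] := exp_half_small e2; exists n0 => n n0n.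
  rewrite distrC; apply: le_lt_trans (tail _ _ n0n) _.
  by rewrite mulrC -ltr_pdivlMr.
exists l => n; apply/ler_addgt0Pr => eps eps0.
have [m _ Hm] := Hl eps eps0.
rewrite -(subrK (c (maxn m n)) l) -addrA addrC.
apply: le_trans (ler_normD _ _) _; apply: lerD; last first.
  by apply/ltW/Hm => /=; exact: leq_maxl.
by apply: tail; exact: leq_maxr.
Qed.

(** * Square roots by iteration in a C*-algebra *)

Section SquareRoot.
Variables (R : realType) (D : cstarAlgebra R) (h : D).
Hypotheses (hsa : cstar h = h) (hle : `|h| <= 2^-1).
Local Notation q := (2^-1 : R[i]).

(* Iterates of [l |-> (h^2 + l^2) / 2]. *)
Fixpoint sqrt_seq n : D :=
  if n is m.+1 then q *: (cmul h h + cmul (sqrt_seq m) (sqrt_seq m)) else 0.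

Let q0 : 0 < q. Proof. by rewrite invr_gt0 ltr0n. Qed.
Let qq : q + q = 1. Proof. by rewrite -[q]mul1r -splitr. Qed.
Let q1 : q <= 1. Proof. by rewrite invf_le1 ?ltr0n// ler1n. Qed.

Let mul_half (a b : D) : `|a| <= q -> `|b| <= q -> `|cmul a b| <= q * q :> R[i].
Proof.
by move=> aq bq; apply: le_trans (cmul_norm a b) _; apply: ler_pM.
Qed.

(** This is where the bound 1/2 on [h] comes from: the iteration maps the ball of radius 1/2 to
    itself, and on that ball it contracts with ratio 1/2. *)
Lemma sqrt_seq_le n : `|sqrt_seq n| <= q.
Proof.
elim: n => [|n IH] /=; first by rewrite normr0 ltW.
rewrite normrZ ger0_norm ?(ltW q0)//; apply: ler_piMr; first exact: ltW.
apply: le_trans (ler_normD _ _) _; apply: le_trans (lerD (mul_half hle hle) (mul_half IH IH)) _.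
by rewrite -mulrDl qq mul1r.
Qed.

Lemma sqrt_seq_sa n : cstar (sqrt_seq n) = sqrt_seq n.
Proof.
elim: n => [|n IH] /=; first exact: (conj_lin_0 (@cstar_conjlin _ D)).
rewrite cstarZ (conj_lin_add (@cstar_conjlin _ D)) !cstarM hsa IH.
by congr (_ *: _); rewrite fmorphV rmorph_nat.
Qed.

Lemma sqrt_seq_comm n : cmul h (sqrt_seq n) = cmul (sqrt_seq n) h.
Proof.
elim: n => [|n IH] /=.
  by rewrite (lin_0 (cmul_linr _)) (lin_0 (cmul_linl _)).
rewrite (lin_scale (cmul_linr _)) (lin_scale (cmul_linl _)); congr (_ *: _).
rewrite (lin_add (cmul_linr _)) (lin_add (cmul_linl _)) !cmulA; congr (_ + _).
by rewrite IH -cmulA IH cmulA.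
Qed.

Let sq_diff (a b : D) : `|a| <= q -> `|b| <= q ->
  `|cmul a a - cmul b b| <= `|a - b| :> R[i].
Proof.
move=> aq bq.
have -> : cmul a a - cmul b b = cmul a (a - b) + cmul (a - b) b.
  by rewrite (lin_sub (cmul_linr _)) (lin_sub (cmul_linl _)) addrA subrK.
apply: le_trans (ler_normD _ _) _; rewrite -[leRHS]mul1r -qq mulrDl.
apply: lerD; apply: le_trans (cmul_norm _ _) _; last rewrite mulrC; exact: ler_wpM2r.
Qed.

Lemma sqrt_seq_step n : `|sqrt_seq n.+1 - sqrt_seq n| <= q ^+ n.
Proof.
elim: n => [|n IH].
  rewrite subr0 expr0; apply: le_trans (sqrt_seq_le _) _.
  exact: q1.
have -> : sqrt_seq n.+2 - sqrt_seq n.+1 = q *: (cmul (sqrt_seq n.+1)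
    (sqrt_seq n.+1) - cmul (sqrt_seq n) (sqrt_seq n)).
  by rewrite -scalerBr opprD addrACA subrr add0r.
rewrite normrZ ger0_norm ?(ltW q0)// exprS ler_pM2l//.
apply: le_trans IH; apply: sq_diff; exact: sqrt_seq_le.
Qed.

(** The iterates are self-adjoint and commute with [h]; each property passes to the limit with an
    explicit error. The bound by [2 * q ^+ n] does not depend on the algebra, which matters when the
    fibre varies. *)
Lemma sqrt_limit : exists l : D, [/\ cstar l = l, cmul h l = cmul l h,
  l + l = cmul h h + cmul l l &
  forall n, `|l - sqrt_seq n| <= 2 * q ^+ n].
Proof.
have [l Hl] := geometric_limit sqrt_seq_step; exists l.
have lq : `|l| <= 2.
  by have := Hl 0%N; rewrite subr0 expr0 mulr1.
split=> //.
- apply/eqP; rewrite -subr_eq0; apply/eqP.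
  apply: (@small_eq0 _ _ _ (2 + 2)) => n.
  rewrite -(subrK (sqrt_seq n) (cstar l)) -addrA -{1}sqrt_seq_sa -cstarB.
  apply: le_trans (ler_normD _ _) _; rewrite cstar_norm mulrDl lerD//.
  by rewrite distrC.
- apply/eqP; rewrite -subr_eq0; apply/eqP.
  apply: (@small_eq0 _ _ _ (2 + 2)) => n.
  have -> : cmul h l - cmul l h = cmul h (l - sqrt_seq n) - cmul (l - sqrt_seq n) h.
    rewrite (lin_sub (cmul_linr _)) (lin_sub (cmul_linl _)) sqrt_seq_comm.
    by rewrite opprB addrA subrK.
  have h1 : `|h| <= 1 by exact: le_trans hle q1.
  apply: le_trans (ler_normB _ _) _; rewrite mulrDl lerD//.
    by apply: le_trans (cmul_norm _ _) _; apply: le_trans (Hl n); rewrite ler_piMl.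
  by apply: le_trans (cmul_norm _ _) _; apply: le_trans (Hl n); rewrite ler_piMr.
- apply/eqP; rewrite -subr_eq0; apply/eqP.
  (* The first 2 comes from twice the error at [n + 1]. The factor [2 + 1] bounds [|l|] plus
     [|sqrt_seq n|], and the last 2 is the constant in the error at [n]. *)
  apply: (@small_eq0 _ _ _ (2 + (2 + 1) * 2)) => n.
  have -> : l + l - (cmul h h + cmul l l) = (l - sqrt_seq n.+1) *+ 2
      - (cmul l (l - sqrt_seq n) + cmul (l - sqrt_seq n) (sqrt_seq n)).
    rewrite (lin_sub (cmul_linr _)) (lin_sub (cmul_linl _)) addrA subrK.
    have E : sqrt_seq n.+1 *+ 2 = cmul h h + cmul (sqrt_seq n) (sqrt_seq n).
      by rewrite [LHS]/= -scaler_nat scalerA divff ?scale1r ?pnatr_eq0.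
    by rewrite mulrnBl E mulr2n opprB !opprD !addrA subrK.
  apply: le_trans (ler_normB _ _) _; rewrite mulrDl lerD//.
    have := Hl n.+1; rewrite exprS mulrA divff ?pnatr_eq0// mul1r => Hn.
    rewrite mulr2n mulr_natl mulr2n; apply: le_trans (ler_normD _ _) _.
    exact: lerD.
  apply: le_trans (ler_normD _ _) _; rewrite -mulrA mulrDl mul1r lerD//.
    by apply: le_trans (cmul_norm _ _) _; apply: ler_pM.
  apply: le_trans (cmul_norm _ _) _; apply: le_trans (Hl n); rewrite ler_piMr//.
  exact: le_trans (sqrt_seq_le n) q1.
Qed.

End SquareRoot.

(** * Unit fibres and their unitaries *)

Section UnitFiber.
Variables (R : realType) (E : scFellBundle R).
Let G := sc_base E.
Let EP := sc_fell E.
Let CP := sc_categorical E.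
Let one := @sc_one R E.
Variables (y : G) (uy : units G y).

Let sy : gs y = y. Proof. exact: uy. Qed.
Let ry : gr y = y. Proof. exact: gr_unit. Qed.
Let yy : gmul y y = y. Proof. exact: gmul_unitr. Qed.
Let iy : ginv y = y. Proof. exact: ginv_unit. Qed.

Definition ufib_mul (v w : fib E y) : fib E y := fibcoord y (fmul (inc v) (inc w)).
Definition ufib_star (v : fib E y) : fib E y := fibcoord y (fstar (inc v)).

Lemma inc_ufib_mul v w : inc (ufib_mul v w) = fmul (inc v) (inc w).
Proof. by rewrite inc_fibcoord// (bproj_fmul EP (g := y))// !bproj_inc// sy. Qed.

Lemma inc_ufib_star v : inc (ufib_star v) = fstar (inc v).
Proof. by rewrite inc_fibcoord// (bproj_star EP) bproj_inc. Qed.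

Let comp_yy (v w : fib E y) : bcomposable (inc v) (inc w).
Proof. by rewrite /bcomposable /composable !bproj_inc sy. Qed.

Lemma ufib_mul_bilinear : is_bilinear ufib_mul.
Proof.
split=> v; [apply: (fmul_linl EP)|apply: (fmul_linr EP)]; by rewrite ?bproj_inc ?sy.
Qed.

Lemma ufib_mulA : associative ufib_mul.
Proof. by move=> a b c; apply: inc_inj; rewrite !inc_ufib_mul (fmulA EP). Qed.

Lemma ufib_mul_norm a b : `|ufib_mul a b| <= `|a| * `|b|.
Proof. by rewrite -!bnorm_inc inc_ufib_mul; exact: (fmul_norm EP). Qed.

Lemma ufib_star_conj_linear : is_conj_linear ufib_star.
Proof. exact: (fstar_conjlin EP). Qed.

Lemma ufib_starK : involutive ufib_star.
Proof. by move=> a; apply: inc_inj; rewrite !inc_ufib_star (fstarK EP). Qed.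

Lemma ufib_starM a b : ufib_star (ufib_mul a b) = ufib_mul (ufib_star b) (ufib_star a).
Proof.
by apply: inc_inj; rewrite !(inc_ufib_star, inc_ufib_mul) (fstarM EP).
Qed.

Lemma ufib_identity a : `|ufib_mul (ufib_star a) a| = `|a| ^+ 2.
Proof.
by rewrite -!bnorm_inc inc_ufib_mul inc_ufib_star; exact: (fell_identity EP).
Qed.

Definition ufib : cstarAlgebra R :=
  CstarAlgebra ufib_mul_bilinear ufib_mulA ufib_mul_norm ufib_star_conj_linear
    ufib_starK ufib_starM ufib_identity.

Definition ufib1 : ufib := unit_section one y.

Lemma inc_ufib1 : inc (ufib1 : fib E y) = one y.
Proof. exact: inc_unit_section. Qed.

Lemma ufib_mul1 (a : ufib) : cmul ufib1 a = a.
Proof. by apply: inc_inj; rewrite inc_ufib_mul inc_ufib1 (fmul_onel CP). Qed.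

Lemma ufib_mulr1 (a : ufib) : cmul a ufib1 = a.
Proof. by apply: inc_inj; rewrite inc_ufib_mul inc_ufib1 (fmul_oner CP). Qed.

Lemma ufib_star1 : cstar ufib1 = ufib1.
Proof. by apply: inc_inj; rewrite inc_ufib_star inc_ufib1 (fstar_one EP CP). Qed.

(* [h^2 + (1 - l)^2 = 1] for commuting self-adjoint [h], [l], so
   [z (1 - l) + h] is unitary for [z = i, -i]. *)
Lemma ufib_unitary (z : R[i]) (h l : ufib) : z^* = - z -> z * z = -1 ->
  cstar h = h -> cstar l = l -> cmul h l = cmul l h ->
  l + l = cmul h h + cmul l l ->
  cmul (cstar (z *: (ufib1 - l) + h)) (z *: (ufib1 - l) + h) = ufib1.
Proof.
move=> zs zz hs ls hl ll.
pose a := ufib1 - l.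
have as_ : cstar a = a by rewrite /a cstarB ufib_star1 ls.
have ah : cmul a h = cmul h a.
  by rewrite /a (lin_sub (cmul_linl _)) (lin_sub (cmul_linr _)) ufib_mul1 ufib_mulr1 hl.
have aa : cmul a a + cmul h h = ufib1.
  rewrite /a (lin_sub (cmul_linl _)) !(lin_sub (cmul_linr _)) ufib_mul1 !ufib_mulr1 ufib_mul1.
  have -> : cmul h h = l + l - cmul l l by rewrite ll addrK.
  by rewrite opprB -!addrA addKr [cmul l l + _]addrCA subrr addr0 addNr addr0.
rewrite (conj_lin_add (@cstar_conjlin _ ufib)) cstarZ as_ hs zs.
rewrite (lin_add (cmul_linl _)) !(lin_add (cmul_linr _)).
rewrite !(lin_scale (cmul_linl _)) !(lin_scale (cmul_linr _)) scalerA mulNr zz opprK scale1r.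
rewrite ah scaleNr -addrA [- _ + _]addrA addNr add0r.
exact: aa.
Qed.

End UnitFiber.

Section UnitSections.
Variables (R : realType) (E : scFellBundle R).
Let G := sc_base E.
Let EP := sc_fell E.
Let CP := sc_categorical E.
Let one := @sc_one R E.
Implicit Types (f g h u w : sections E) (N : sections E -> R).

(** Left multiplication by a field over the unit space. No continuity or support is asked of [w], so
    the unitary fields, which act as multipliers, are allowed. *)
Definition unit_mul w g : sections E := fun x =>
  fibcoord x (fmul (inc (w (gr x))) (inc (g x))).

Lemma inc_unit_mul w g x : inc (unit_mul w g x) = fmul (inc (w (gr x))) (inc (g x)).
Proof.
rewrite inc_fibcoord//; apply: (bproj_fmul EP); rewrite !bproj_inc ?gsrE//.
by rewrite gmul_unitl//; exact: unit_gr.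
Qed.

Lemma conv_units f g : (forall x, f x <> 0 -> units G x) ->
  convolution f g = unit_mul f g.
Proof.
move=> fu; apply: functional_extensionality_dep => x; rewrite /convolution.
rewrite (fsum_single (i := gr x)) /=; last 2 first.
- exact: gsrE.
- move=> h hx hn; apply: contrapT => nz; have [f0|f0] := pselect (f (ginv h) = 0).
    apply: nz; rewrite f0 (lin_0 (fmul_linl EP _ _)) ?bproj_inc ?gmulKg//.
    by rewrite gsVE grME.
  by apply: hn; have u := fu _ f0; rewrite -hx -[h]ginvK (ginv_unit u) (gs_unit u).
have ur := unit_gr x.
by rewrite ginv_unit// gmul_unitl.
Qed.

(** In each term the field is evaluated twice at the same unit [gr h], since [h x] and [h] have the
    same range, and [w^* w] cancels. *)
Lemma conv_unitary w g :
  (forall y, units G y -> fmul (fstar (inc (w y))) (inc (w y)) = one y) ->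
  convolution (sec_star (unit_mul w g)) (unit_mul w g) = convolution (sec_star g) g.
Proof.
move=> wu; apply: functional_extensionality_dep => x; apply: eq_fsbigr => h.
move=> /set_mem /= hx; congr fibcoord.
have ur := unit_gr h.
have c1 : bcomposable (inc (w (gr h))) (inc (g h)).
  by rewrite /bcomposable /composable !bproj_inc gsrE.
have c2 : bcomposable (inc (w (gr h))) (inc (g (gmul h x))).
  by rewrite /bcomposable /composable !bproj_inc gsrE grME.
have c3 : bcomposable (fstar (inc (w (gr h)))) (inc (w (gr h))).
  by rewrite /bcomposable /composable (bproj_star EP) bproj_inc gsVE.
have c4 : bcomposable (fstar (inc (g h))) (fstar (inc (w (gr h)))).
  by rewrite /bcomposable /composable !(bproj_star EP) !bproj_inc gsVE grVE gsrE.
rewrite !inc_sec_star// ginvK !inc_unit_mul (fstarM EP)// grME//.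
rewrite -(fmulA EP)//; last first.
  rewrite /bcomposable /composable (bproj_mul EP)// (bproj_star EP) !bproj_inc.
  by rewrite gsVE [RHS]grME ?gsrE ?grME.
rewrite (fmulA EP (a := fstar (inc (w (gr h)))))//.
by rewrite wu// (fmul_onel CP)// grME.
Qed.

Lemma cstar_seminorm0 N : is_cstar_seminorm N -> N (fun=> 0) = 0.
Proof.
move=> NP; have := sn_scale NP 0 (Cc0 E).
have -> : (fun g : G => 0 *: (0 : fib E g)) = (fun=> 0).
  by apply: functional_extensionality_dep => x; rewrite scaler0.
by rewrite normr0 mul0r => /(@complexI R _ 0).
Qed.

Lemma cstar_seminormZ N (r : R) f : is_cstar_seminorm N -> 0 <= r -> in_Cc f ->
  N (fun x => r%:C *: f x) = r * N f.
Proof.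
move=> NP r0 Cf; have := sn_scale NP r%:C Cf.
by rewrite normcR ger0_norm// -rmorphM => /complexI.
Qed.

(** By the C*-identity [N] is determined by [g^* g], which multiplication by [w] leaves
    unchanged. *)
Lemma unitary_norm N w g : is_cstar_seminorm N -> in_Cc g -> in_Cc (unit_mul w g) ->
  (forall y, units G y -> fmul (fstar (inc (w y))) (inc (w y)) = one y) ->
  N (unit_mul w g) = N g.
Proof.
move=> NP Cg Cw wu; have := sn_identity NP Cw.
rewrite conv_unitary// (sn_identity NP Cg) => /eqP.
by rewrite eqrXn2 ?(sn_ge0 NP)// => /eqP.
Qed.

(* The fields [w_z = z (1 - l) + h], [z = i, -i], are unitary and average to [h]. *)
Lemma unit_contraction_norm N h l g : is_cstar_seminorm N ->
  in_Cc h -> in_Cc l -> in_Cc g ->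
  (forall x, h x <> 0 -> units G x) -> (forall x, l x <> 0 -> units G x) ->
  (forall y (uy : units G y), [/\ @cstar _ (ufib uy) (h y) = h y,
     @cstar _ (ufib uy) (l y) = l y,
     @cmul _ (ufib uy) (h y) (l y) = @cmul _ (ufib uy) (l y) (h y) &
     l y + l y = @cmul _ (ufib uy) (h y) (h y) + @cmul _ (ufib uy) (l y) (l y)]) ->
  N (convolution h g) <= N g.
Proof.
move=> NP Ch Cl Cg hu lu hl.
pose w (z : R[i]) : sections E := fun y => z *: (unit_section one y - l y) + h y.
(* The field [w z] need not lie in [in_Cc], but its product with [g] is [z (g - l g) + h g], a
   combination of sections that do. *)
have wE z : unit_mul (w z) g =
    sec_lin z (sec_lin (-1) (convolution l g) g) (convolution h g).
  apply: functional_extensionality_dep => x.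
  rewrite (conv_units _ lu) (conv_units _ hu) /sec_lin /unit_mul /w.
  have Ml : linear (fun v : fib E (gr x) => fibcoord x (fmul (inc v) (inc (g x)))).
    by apply: (fmul_linl EP); rewrite ?bproj_inc ?gsrE// gmul_unitl//; exact: unit_gr.
  rewrite (lin_add Ml) (lin_scale Ml) (lin_sub Ml) (inc_unit_section CP); last first.
    exact: unit_gr.
  by rewrite (fmul_onel CP)// incK scaleN1r [- _ + _]addrC.
have Cw z : in_Cc (unit_mul (w z) g).
  by rewrite wE; do 2?apply: Cc_lin => //; apply: Cc_conv.
have wN z : z^* = - z -> z * z = -1 -> N (unit_mul (w z) g) = N g.
  move=> zs zz; apply: unitary_norm => // y uy; have [h1 l1 hl1 ll1] := hl y uy.
  have := ufib_unitary zs zz h1 l1 hl1 ll1.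
  move=> /(congr1 (fun v : fib E y => inc v)).
  move=> wE'; rewrite -(inc_ufib_star uy) -(inc_ufib_mul uy).
  exact: etrans wE' (inc_ufib1 uy).
have ii : 'i * 'i = -1 :> R[i] by rewrite -expr2 sqrCi.
have ci : 'i^* = - 'i :> R[i] by rewrite conjCi.
have Ni := wN _ ci ii.
have Nmi : N (unit_mul (w (- 'i)) g) = N g.
  by apply: wN; [rewrite rmorphN; congr (- _)|rewrite mulrNN].
pose q : R[i] := 2^-1.
(* In the average of the fields for [i] and [-i] the imaginary parts cancel. *)
have -> : convolution h g = sec_lin 1 (fun x => q *: unit_mul (w 'i) g x)
    (fun x => q *: unit_mul (w (- 'i)) g x).
  apply: functional_extensionality_dep => x; rewrite !wE /sec_lin scale1r -scalerDr.
  rewrite [- 'i *: _]scaleNr addrACA subrr add0r -mulr2n -scaler_nat scalerA.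
  by rewrite /q mulVf ?pnatr_eq0// scale1r.
have qE : q = (2^-1 : R)%:C by rewrite fmorphV rmorph_nat.
apply: le_trans (sn_add NP _ _) _; [exact: Cc_scale|exact: Cc_scale|].
rewrite qE !cstar_seminormZ ?invr_ge0// Ni Nmi.
by rewrite mulrC -splitr.
Qed.

Section SmallSelfAdjoint.
Variables (V : set G) (h : sections E).
Hypotheses (oV : open V) (Vu : V `<=` units G) (hV : in_CcU V h).
Hypotheses (hsa : forall y, units G y -> ufib_star (h y) = h y).
Hypothesis hle : forall y, `|h y| <= 2^-1.
Local Notation q := (2^-1 : R[i]).

(** The algebra structure [ufib] needs a proof that the base point is a unit, hence the case
    distinction. *)
Definition sqrt_sections n : sections E := fun y =>
  match pselect (units G y) with
  | left uy => @sqrt_seq R (ufib uy) (h y) n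
  | right _ => 0
  end.

Lemma sqrt_sectionsS n y : units G y -> sqrt_sections n.+1 y =
  q *: (ufib_mul (h y) (h y) + ufib_mul (sqrt_sections n y) (sqrt_sections n y)).
Proof. by rewrite /sqrt_sections; case: pselect. Qed.

Lemma cvg_near_inc (a b : sections E) x : V x ->
  (forall y, V y -> inc (a y) = inc (b y)) ->
  (fun t => inc (b t)) @ x --> inc (b x) -> (fun t => inc (a t)) @ x --> inc (a x).
Proof.
move=> Vx ab; rewrite ab//; apply: cvg_trans; apply: near_eq_cvg.
have nV : nbhs x V by exact: open_nbhs_nbhs.
by apply: filterS nV => t Vt; rewrite ab.
Qed.

Lemma sqrt_sections_cvg n x : V x ->
  (fun t => inc (sqrt_sections n t)) @ x --> inc (sqrt_sections n x).
Proof.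
have EU := fell_usc EP.
have hc y : V y -> (fun t => inc (h t)) @ y --> inc (h y).
  by move=> Vy; apply: (CcU_cvg _ oV hV Vy).
have mulc (a : sections E) y : V y -> (fun t => inc (a t)) @ y --> inc (a y) ->
    (fun t => inc (ufib_mul (a t) (a t))) @ y --> inc (ufib_mul (a y) (a y)).
  move=> Vy ca; rewrite inc_ufib_mul; last exact: Vu.
  have c t : V t -> bcomposable (inc (a t)) (inc (a t)).
    by move=> /Vu ut; rewrite /bcomposable /composable !bproj_inc gr_unit.
  have nV : nbhs y V by exact: open_nbhs_nbhs.
  have nc : \forall t \near nbhs y, bcomposable (inc (a t)) (inc (a t)).
    by apply: filterS nV; exact: c.
  have := @fmul_cvg _ _ _ EP _ (nbhs y) (fun t => inc (a t)) (fun t => inc (a t))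
    _ _ (nbhs_filter y) (c y Vy) nc ca ca.
  apply: cvg_trans; apply: near_eq_cvg.
  by apply: filterS nV => t Vt; rewrite inc_ufib_mul//; exact: Vu.
elim: n x => [|n IH] x Vx.
  (* Continuity of the zero section is read off from [0 *: h]. *)
  apply: (@cvg_near_inc _ (fun y => 0 *: h y)) => //.
    move=> y Vy; rewrite scale0r; congr inc.
    by rewrite /sqrt_sections; case: pselect.
  by apply: (bscale_cvg (p := id) EU (z := fun=> 0)); [exact: (@cvg_cst R[i]^o)|exact: hc].
apply: (@cvg_near_inc _ (fun y => q *: (ufib_mul (h y) (h y) +
    ufib_mul (sqrt_sections n y) (sqrt_sections n y)))) => //.
  by move=> y Vy; rewrite sqrt_sectionsS//; exact: Vu.
apply: (bscale_cvg (p := id) EU (z := fun=> q)); first exact: (@cvg_cst R[i]^o).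
apply: (badd_cvg (p := id) EU); first by apply: mulc => //; exact: hc.
by apply: mulc => //; exact: IH.
Qed.

(** The fibrewise limits form a continuous section because the error of the iterates is the same in
    all fibres, and these iterates are continuous. *)
Lemma sqrt_limit_section : exists l : sections E, [/\ in_CcU V l,
  forall y, l y <> 0 -> units G y &
  forall y (uy : units G y), [/\ @cstar _ (ufib uy) (h y) = h y,
     @cstar _ (ufib uy) (l y) = l y,
     @cmul _ (ufib uy) (h y) (l y) = @cmul _ (ufib uy) (l y) (h y) &
     l y + l y = @cmul _ (ufib uy) (h y) (h y) + @cmul _ (ufib uy) (l y) (l y)]].
Proof.
have ex y : exists l : fib E y,
    (forall uy : units G y, [/\ @cstar _ (ufib uy) l = l,
     @cmul _ (ufib uy) (h y) l = @cmul _ (ufib uy) l (h y),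
     l + l = @cmul _ (ufib uy) (h y) (h y) + @cmul _ (ufib uy) l l &
     forall n, `|l - sqrt_sections n y| <= 2 * q ^+ n]) /\
    (~ units G y -> l = 0).
  have [uy|nu] := pselect (units G y); last by exists 0; split.
  have [l [l1 l2 l3 l4]] := @sqrt_limit R (ufib uy) (h y) (hsa uy) (hle y).
  exists l; split=> // uy'; rewrite (Prop_irrelevance uy' uy); split=> // n.
  rewrite /sqrt_sections; case: pselect => // uy''.
  by rewrite (Prop_irrelevance uy'' uy).
pose l y := projT1 (cid (ex y)); have lP y := projT2 (cid (ex y)).
exists l; split.
- split.
    apply: continuous_within_at => x Vx.
    apply: (bundle_cvg_approx (p := id) (fell_usc EP)) => // eps eps0.
    have e2 : 0 < eps / 2 by rewrite divr_gt0.
    have [n Hn] := exp_half_small e2.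
    have lt_eps t : V t -> `|l t - sqrt_sections n t| < eps.
      move=> /Vu ut; have [/(_ ut)[_ _ _ /(_ n)] H _] := lP t.
      by apply: le_lt_trans H _; rewrite mulrC -ltr_pdivlMr.
    exists (sqrt_sections n), (sqrt_sections n x); split.
    + exact: sqrt_sections_cvg.
    + have nV : nbhs x V by exact: open_nbhs_nbhs.
      by apply: filterS nV; exact: lt_eps.
    + exact: lt_eps.
  have [_ [K [cK KV h0]]] := hV; exists K; split=> // y nK.
  have [lP1 lP2] := lP y; have [uy|nu] := pselect (units G y); last exact: lP2.
  have [_ _ _ H] := lP1 uy; apply: (@small_eq0 _ _ _ 2) => n.
  (* Where [h] vanishes the whole iteration stays at 0, so [l] has its support in the compact set of
     [h]. *)
  have s0 : sqrt_sections n y = 0.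
    elim: n => [|n IH]; first by rewrite /sqrt_sections; case: pselect.
    rewrite sqrt_sectionsS// IH h0//.
    by rewrite (lin_0 ((ufib_mul_bilinear uy).1 0)) addr0 scaler0.
  by have := H n; rewrite s0 subr0.
- by move=> y ly; apply: contrapT => nu; apply: ly; case: (lP y) => _ /(_ nu).
- move=> y uy; have [/(_ uy)[l1 l2 l3 _] _] := lP y; split=> //; exact: hsa.
Qed.

(** The contraction estimate with [g = h] gives [N (h^* h) <= N h], that is [N h ^+ 2 <= N h]. *)
Lemma small_sa_norm N : is_cstar_seminorm N -> N h <= 1.
Proof.
move=> NP; have [l [lV lu lP]] := sqrt_limit_section.
have bV : open_bisection V.
  have [_ s r] := bisection_units G.
  by split=> //; [exact: sub_set_inj Vu s|exact: sub_set_inj Vu r].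
have Ch := CcU_Cc bV hV; have Cl := CcU_Cc bV lV.
have hu x : h x <> 0 -> units G x by move=> /(CcU_out hV)/Vu.
have := unit_contraction_norm NP Ch Cl Ch hu lu lP.
have hs : sec_star h = h.
  apply: functional_extensionality_dep => x; apply: inc_inj.
  rewrite inc_sec_star//; have [ux|nu] := pselect (units G x).
    rewrite ginv_unit// -[in RHS](hsa ux) inc_ufib_star//.
  have z y : ~ units G y -> h y = 0 by move=> ny; apply: contrapT => /hu.
  rewrite (z x)// (z (ginv x)); last first.
    by move=> u; apply: nu; rewrite -[x]ginvK ginv_unit.
  have p : bproj (fstar (inc (0 : fib E (ginv x)))) = x.
    by rewrite (bproj_star EP) bproj_inc ginvK.
  rewrite -(inc_fibcoord p); congr inc.
  exact: (conj_lin_0 (fstar_conjlin EP (ginvK x))).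
rewrite -{1}hs (sn_identity NP Ch) expr2 => H.
rewrite leNgt; apply/negP => h1; move: H; rewrite leNgt => /negP; apply.
by rewrite ltr_pMl// (lt_trans ltr01).
Qed.

End SmallSelfAdjoint.

Lemma cstar_seminorm_bounded f : in_Cc f ->
  exists M : R, forall N, is_cstar_seminorm N -> N f <= M.
Proof.
move: f; apply: Cc_ind => [|z U u f bU uU Cf [M HM]].
  by exists 0 => N NP; rewrite cstar_seminorm0.
have Cu := CcU_Cc bU uU.
have [M' HM'] : exists M : R, forall N, is_cstar_seminorm N -> N u <= M; last first.
  exists (complex.Re `|z| * M' + M) => N NP.
  have -> : sec_lin z u f = sec_lin 1 (fun x => z *: u x) f.
    by apply: functional_extensionality_dep => x; rewrite /sec_lin scale1r.
  apply: le_trans (sn_add NP _ Cf) _; first exact: Cc_scale.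
  apply: lerD; last exact: HM.
  have := sn_scale NP z Cu; rewrite [in RHS](ge0_Re (normr_ge0 z)) -rmorphM.
  move=> /complexI ->; apply: ler_wpM2l; last exact: HM'.
  by rewrite -lecR -ge0_Re; exact: normr_ge0.
have oU : open U by case: bU.
have [V [bV kV Vprod]] := CcU_conv EP (bisection_inv bU) bU (CcU_star EP oU uU) uU.
set k := convolution _ _ in kV.
have oV : open V by case: bV.
(* An arrow of [V] is [a v] with [a^-1] and [v] in [U] of equal range, so [v] is the inverse of
   [a]. *)
have Vu : V `<=` units G.
  move=> _ /Vprod[a [v [/= Ua Uv av ->]]].
  have <- : ginv a = v.
    by case: bU => _ _; apply; rewrite ?inE// grVE.
  by rewrite (gmulgV (egroupoidP G)); exact: unit_gr.
have ks : sec_star k = k.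
  by rewrite /k sec_star_conv ?sec_starK//; apply: Cc_rfin; exact: Cc_star.
have [_ [K [cK KV k0]]] := kV.
have kc x : K x -> (fun y => inc (k y)) @ x --> inc (k x).
  by move=> /KV Vx; apply: (CcU_cvg _ oV kV Vx).
have {M HM} [M HM] := bundle_bounded (fell_usc EP) cK kc.
(* Scaled so that [r] times the bound [M] is at most 1/2; the absolute value and the added 1 keep
   [r] positive whatever [M] is. *)
pose r : R := (2 * (`|M| + 1))^-1.
have M1 : 0 < `|M| + 1 by rewrite ltr_wpDl.
have r0 : 0 < r by rewrite invr_gt0 mulr_gt0.
pose h : sections E := fun x => r%:C *: k x.
have hV : in_CcU V h.
  split; last by exists K; split=> // g nK; rewrite /h k0// scaler0.
  apply: continuous_within_at => x Vx.
  apply: (bscale_cvg (p := id) (fell_usc EP)); first exact: (@cvg_cst R[i]^o).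
  exact: (CcU_cvg _ oV kV Vx).
have hsa y : units G y -> ufib_star (h y) = h y.
  move=> uy; have E1 : ufib_star (k y) = k y.
    apply: inc_inj; rewrite inc_ufib_star// -[in RHS]ks inc_sec_star//.
    by rewrite ginv_unit.
  have := cstarZ r%:C (k y : ufib uy); rewrite /= /h => ->.
  rewrite conj_Creal; last by apply: ger0_real; rewrite lecR ltW.
  by congr (_ *: _).
have hle y : `|h y| <= 2^-1.
  rewrite normrZ normcR gtr0_norm//.
  have -> : (2^-1 : R[i]) = (2^-1 : R)%:C by rewrite fmorphV rmorph_nat.
  have -> : (2^-1 : R) = r * (`|M| + 1).
    by rewrite /r invfM mulrVK// unitfE gt_eqF.
  rewrite rmorphM ler_pM2l ?ltcR//.
  have [Ky|nK] := pselect (K y); last by rewrite k0// normr0 lecR ltW.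
  apply: le_trans (HM y Ky) _; rewrite lecR.
  by apply: le_trans (ler_norm M) _; rewrite lerDl.
(* From [N k <= r^-1] one gets [N u ^+ 2 <= r^-1]. The summand 1 covers the case [N u <= 1];
   otherwise [N u] is at most its square. *)
exists (1 + r^-1) => N NP.
have Ck : in_Cc k by exact: CcU_Cc kV.
have := small_sa_norm oV Vu hV hsa hle NP.
rewrite /h (cstar_seminormZ NP (ltW r0) Ck) mulrC -ler_pdivlMr// div1r.
rewrite /k (sn_identity NP Cu) => H.
have N0 := sn_ge0 NP Cu.
have [N1|N1] := leP (N u) 1; first by apply: le_trans N1 _; rewrite lerDl invr_ge0 ltW.
apply: (@le_trans _ _ (N u ^+ 2)).
  by rewrite expr2 ler_pMl// ?ltW// (lt_trans ltr01).
by apply: le_trans H _; rewrite lerDr.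
Qed.

End UnitSections.

(** * Completion of a seminormed *-algebra *)

(** The norm is only a seminorm. Its vanishing at 0 and its positivity are not axioms: they follow
    from homogeneity and subadditivity. *)
Record preCstar (R : realType) := PreCstar {
  pc_space :> lmodType R[i] ;
  pc_norm : pc_space -> R ;
  pc_mul : pc_space -> pc_space -> pc_space ;
  pc_star : pc_space -> pc_space ;
  pc_normD : forall u v, pc_norm (u + v) <= pc_norm u + pc_norm v ;
  pc_normZ : forall z u, (pc_norm (z *: u))%:C = `|z| * (pc_norm u)%:C ;
  pc_mul_bilinear : is_bilinear pc_mul ;
  pc_mulA : associative pc_mul ;
  pc_mul_norm : forall u v, pc_norm (pc_mul u v) <= pc_norm u * pc_norm v ;
  pc_star_conj_linear : is_conj_linear pc_star ;
  pc_starK : involutive pc_star ;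
  pc_starM : forall u v, pc_star (pc_mul u v) = pc_mul (pc_star v) (pc_star u) ;
  pc_star_norm : forall u, pc_norm (pc_star u) = pc_norm u ;
  pc_identity : forall u, pc_norm (pc_mul (pc_star u) u) = pc_norm u ^+ 2 }.

Section PreCstarTheory.
Variables (R : realType) (P : preCstar R).
Implicit Types u v w : P.

Lemma pc_norm0 : pc_norm (0 : P) = 0.
Proof.
have := pc_normZ 0 (0 : P); rewrite scale0r normr0 mul0r.
exact: (@complexI R _ 0).
Qed.

Lemma pc_normN u : pc_norm (- u) = pc_norm u.
Proof.
have := pc_normZ (-1) u; rewrite scaleN1r normrN normr1 mul1r.
exact: complexI.
Qed.

Lemma pc_norm_ge0 u : 0 <= pc_norm u.
Proof.
have := pc_normD u (- u); rewrite subrr pc_norm0 pc_normN -mulr2n.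
by rewrite pmulrn_lge0.
Qed.

Lemma pc_distC u v : pc_norm (u - v) = pc_norm (v - u).
Proof. by rewrite -pc_normN opprB. Qed.

Lemma pc_dist_trans u v w : pc_norm (u - w) <= pc_norm (u - v) + pc_norm (v - w).
Proof. by rewrite -{1}(subrK v u) -addrA; exact: pc_normD. Qed.

Lemma pc_dist_norm u v : `|pc_norm u - pc_norm v| <= pc_norm (u - v).
Proof.
rewrite ler_norml lerNl opprB !lerBlDr; apply/andP; split.
  by rewrite pc_distC -{1}(subrK u v); exact: pc_normD.
by rewrite -{1}(subrK v u); exact: pc_normD.
Qed.

Lemma pc_mul_dist u u' v v' : pc_norm (pc_mul u v - pc_mul u' v') <=
  pc_norm (u - u') * pc_norm v + pc_norm u' * pc_norm (v - v').
Proof.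
have [ll lr] := @pc_mul_bilinear R P.
apply: le_trans (pc_dist_trans _ (pc_mul u' v) _) _; apply: lerD.
  by rewrite -(lin_sub (ll v)); exact: pc_mul_norm.
by rewrite -(lin_sub (lr u')); exact: pc_mul_norm.
Qed.

Lemma pc_starB u v : pc_star (u - v) = pc_star u - pc_star v.
Proof.
have := @pc_star_conj_linear R P (-1) v u.
by rewrite rmorphN rmorph1 !scaleN1r ![- _ + _]addrC.
Qed.

Lemma pc_star_dist u v : pc_norm (pc_star u - pc_star v) = pc_norm (u - v).
Proof. by rewrite -pc_starB pc_star_norm. Qed.

End PreCstarTheory.

Definition is_cauchy_seq (R : realType) (P : preCstar R) (u : nat -> P) : Prop :=
  forall eps : R, 0 < eps -> exists n0, forall m n, (n0 <= m)%N -> (n0 <= n)%N ->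
    pc_norm (u m - u n) < eps.

Record cseq (R : realType) (P : preCstar R) := Cseq {
  cseq_fun :> nat -> P ;
  cseqP : is_cauchy_seq cseq_fun }.

Section CauchySequences.
Variables (R : realType) (P : preCstar R).
Implicit Types u v w : cseq P.

Lemma cseq_eq u v : (forall n, u n = v n) -> u = v.
Proof.
case: u => u up; case: v => v vp /= uv.
have E : u = v by apply: funext.
by move: up; rewrite E => up; f_equal; exact: Prop_irrelevance.
Qed.

(** One estimate for all termwise operations: each is Lipschitz in its arguments, for products with
    a constant taken from bounds on the two sequences. *)
Lemma is_cauchy_lip (u v w : nat -> P) (K : R) : is_cauchy_seq u ->
  is_cauchy_seq v -> 0 < K ->
  (forall m n, pc_norm (w m - w n) <=
     K * (pc_norm (u m - u n) + pc_norm (v m - v n))) ->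
  is_cauchy_seq w.
Proof.
move=> cu cv K0 H eps eps0.
have e2 : 0 < eps / K / 2 by rewrite !divr_gt0.
have [n1 H1] := cu _ e2; have [n2 H2] := cv _ e2.
exists (maxn n1 n2) => m n; rewrite !geq_max => /andP[m1 m2] /andP[n1' n2'].
apply: le_lt_trans (H m n) _; rewrite mulrC -ltr_pdivlMr//.
by rewrite [ltRHS]splitr ltrD ?H1 ?H2.
Qed.

Lemma cseq_bounded u : exists2 K : R, 0 < K & forall n, pc_norm (u n) <= K.
Proof.
have [n0 H] := cseqP u ltr01.
have [M HM] : exists M : R, forall n, (n < n0)%N -> pc_norm (u n) <= M.
  elim: n0 {H} => [|n [M HM]]; first by exists 0.
  exists (Num.max M (pc_norm (u n))) => m; rewrite ltnS leq_eqVlt.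
  by move=> /orP[/eqP ->|/HM h]; rewrite le_max ?lexx ?orbT// h.
exists (`|M| + pc_norm (u n0) + 1) => [|n].
  by rewrite ltr_wpDl// addr_ge0// pc_norm_ge0.
have [nn0|n0n] := ltnP n n0.
  apply: le_trans (HM n nn0) _; apply: le_trans (ler_norm _) _.
  by rewrite -addrA lerDl addr_ge0// pc_norm_ge0.
rewrite -(subrK (u n0) (u n)); apply: le_trans (pc_normD _ _) _.
rewrite addrC -addrA [leRHS]addrC.
apply: le_trans (lerD (lexx _) (ltW (H n n0 n0n (leqnn _)))) _.
by rewrite lerDl.
Qed.

Program Definition cseq_const (x : P) : cseq P := @Cseq R P (fun=> x) _.
Next Obligation.
by move=> x eps eps0; exists 0%N => m n _ _; rewrite subrr pc_norm0.
Qed.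

Program Definition cseq_add u v : cseq P := @Cseq R P (fun n => u n + v n) _.
Next Obligation.
move=> u v; apply: (is_cauchy_lip (cseqP u) (cseqP v) ltr01) => m n.
by rewrite mul1r opprD addrACA; exact: pc_normD.
Qed.

Program Definition cseq_opp u : cseq P := @Cseq R P (fun n => - u n) _.
Next Obligation.
move=> u; apply: (is_cauchy_lip (cseqP u) (cseqP u) ltr01) => m n.
by rewrite -opprD pc_normN mul1r lerDl pc_norm_ge0.
Qed.

Program Definition cseq_scale (z : R[i]) u : cseq P := @Cseq R P (fun n => z *: u n) _.
Next Obligation.
move=> z u; have K0 : 0 < complex.Re `|z| + 1.
  by rewrite ltr_wpDl// -lecR -ge0_Re; exact: normr_ge0.
apply: (is_cauchy_lip (cseqP u) (cseqP u) K0) => m n.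
have -> : pc_norm (z *: u m - z *: u n) = complex.Re `|z| * pc_norm (u m - u n).
  apply: (@complexI R); rewrite -scalerBr pc_normZ.
  by rewrite {1}(ge0_Re (normr_ge0 z)) -rmorphM.
apply: ler_pM; rewrite ?pc_norm_ge0 ?lerDl ?pc_norm_ge0//.
by rewrite -lecR -ge0_Re; exact: normr_ge0.
Qed.

Program Definition cseq_mul u v : cseq P := @Cseq R P (fun n => pc_mul (u n) (v n)) _.
Next Obligation.
move=> u v; have [K K0 uK] := cseq_bounded u; have [L L0 vL] := cseq_bounded v.
apply: (is_cauchy_lip (cseqP u) (cseqP v) (addr_gt0 K0 L0)) => m n.
apply: le_trans (pc_mul_dist _ _ _ _) _; rewrite mulrDr; apply: lerD.
  rewrite mulrC ler_wpM2r ?pc_norm_ge0//; apply: le_trans (vL _) _.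
  by rewrite lerDr ltW.
rewrite ler_wpM2r ?pc_norm_ge0//; apply: le_trans (uK _) _.
by rewrite lerDl ltW.
Qed.

Program Definition cseq_star u : cseq P := @Cseq R P (fun n => pc_star (u n)) _.
Next Obligation.
move=> u; apply: (is_cauchy_lip (cseqP u) (cseqP u) ltr01) => m n.
by rewrite pc_star_dist mul1r lerDl pc_norm_ge0.
Qed.

End CauchySequences.

HB.instance Definition _ (R : realType) (P : preCstar R) := gen_eqMixin (cseq P).
HB.instance Definition _ (R : realType) (P : preCstar R) := gen_choiceMixin (cseq P).

Section CseqModule.
Variables (R : realType) (P : preCstar R).

Lemma cseq_addA : associative (@cseq_add R P).
Proof. by move=> u v w; apply: cseq_eq => n /=; rewrite addrA. Qed.

Lemma cseq_addC : commutative (@cseq_add R P).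
Proof. by move=> u v; apply: cseq_eq => n /=; rewrite addrC. Qed.

Lemma cseq_add0 : left_id (cseq_const 0) (@cseq_add R P).
Proof. by move=> u; apply: cseq_eq => n /=; rewrite add0r. Qed.

Lemma cseq_addN : left_inverse (cseq_const 0) (@cseq_opp R P) (@cseq_add R P).
Proof. by move=> u; apply: cseq_eq => n /=; rewrite addNr. Qed.

HB.instance Definition _ := GRing.isZmodule.Build (cseq P)
  cseq_addA cseq_addC cseq_add0 cseq_addN.

Lemma cseq_scaleA (a b : R[i]) (u : cseq P) :
  cseq_scale a (cseq_scale b u) = cseq_scale (a * b) u.
Proof. by apply: cseq_eq => n /=; rewrite scalerA. Qed.

Lemma cseq_scale1 : left_id 1 (@cseq_scale R P).
Proof. by move=> u; apply: cseq_eq => n /=; rewrite scale1r. Qed.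

Lemma cseq_scaleDr : right_distributive (@cseq_scale R P) +%R.
Proof. by move=> z u v; apply: cseq_eq => n /=; rewrite scalerDr. Qed.

Lemma cseq_scaleDl (u : cseq P) : {morph (@cseq_scale R P)^~ u : a b / a + b}.
Proof. by move=> a b; apply: cseq_eq => n /=; rewrite scalerDl. Qed.

HB.instance Definition _ := GRing.Zmodule_isLmodule.Build R[i] (cseq P)
  cseq_scaleA cseq_scale1 cseq_scaleDr cseq_scaleDl.

End CseqModule.

Lemma real_seq_le (R : realType) (f g : nat -> R) (a b : R) :
  (f n : R^o) @[n --> \oo] --> a -> (g n : R^o) @[n --> \oo] --> b ->
  (\forall n \near \oo, f n <= g n) -> a <= b.
Proof. by move=> fa gb; exact: (@ler_cvg_to _ _ _ R f g a b fa gb). Qed.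

Section CseqNorm.
Variables (R : realType) (P : preCstar R).
Implicit Types u v w : cseq P.

Definition cseq_norm u : R := lim ((fun n => pc_norm (u n) : R^o) @ \oo).

Lemma cseq_norm_cvg u : (fun n => pc_norm (u n) : R^o) @ \oo --> cseq_norm u.
Proof.
apply: cauchy_cvg; apply: cauchy_exP => eps eps0.
have [n0 H] := cseqP u eps0; exists (pc_norm (u n0)); exists n0 => // n /= n0n.
rewrite -ball_normE /=; apply: le_lt_trans (pc_dist_norm _ _) _.
exact: H.
Qed.

Arguments cseq_norm_cvg : clear implicits.

Lemma cseq_norm_lim u (r : R) : (fun n => pc_norm (u n) : R^o) @ \oo --> r ->
  cseq_norm u = r.
Proof. exact/cvg_lim/norm_hausdorff. Qed.

Lemma cseq_norm_const x : cseq_norm (cseq_const x) = pc_norm x.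
Proof. by apply: cseq_norm_lim; exact: (@cvg_cst R^o (pc_norm x) nat \oo _). Qed.

Lemma cseq_norm_le u (r : R) : (\forall n \near \oo, pc_norm (u n) <= r) ->
  cseq_norm u <= r.
Proof. by move=> H; exact: real_seq_le (cseq_norm_cvg u) (@cvg_cst R^o r _ _ _) H. Qed.

Lemma cseq_normD u v : cseq_norm (u + v) <= cseq_norm u + cseq_norm v.
Proof.
apply: real_seq_le (cseq_norm_cvg _) (cvgD (cseq_norm_cvg u) (cseq_norm_cvg v)) _.
by apply: nearW => n; exact: pc_normD.
Qed.

Lemma cseq_normZ z u : (cseq_norm (z *: u))%:C = `|z| * (cseq_norm u)%:C.
Proof.
rewrite (ge0_Re (normr_ge0 z)) -rmorphM; congr (_%:C); apply: cseq_norm_lim.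
have -> : (fun n => pc_norm ((z *: u) n) : R^o) =
    (fun n => complex.Re `|z| * pc_norm (u n)).
  apply/funext => n; apply: (@complexI R); rewrite pc_normZ.
  by rewrite {1}(ge0_Re (normr_ge0 z)) -rmorphM.
by apply: cvgM; [exact: cvg_cst|exact: cseq_norm_cvg].
Qed.

Lemma cseq_mul_bilinear : is_bilinear (@cseq_mul R P).
Proof.
have [ll lr] := @pc_mul_bilinear R P.
by split=> u z v w; apply: cseq_eq => n /=; [exact: ll|exact: lr].
Qed.

Lemma cseq_mulA : associative (@cseq_mul R P).
Proof. by move=> u v w; apply: cseq_eq => n /=; exact: pc_mulA. Qed.

Lemma cseq_mul_norm u v : cseq_norm (cseq_mul u v) <= cseq_norm u * cseq_norm v.
Proof.
apply: real_seq_le (cseq_norm_cvg _) (cvgM (cseq_norm_cvg u) (cseq_norm_cvg v)) _.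
by apply: nearW => n; exact: pc_mul_norm.
Qed.

Lemma cseq_star_conj_linear : is_conj_linear (@cseq_star R P).
Proof. by move=> z u v; apply: cseq_eq => n /=; exact: pc_star_conj_linear. Qed.

Lemma cseq_starK : involutive (@cseq_star R P).
Proof. by move=> u; apply: cseq_eq => n /=; exact: pc_starK. Qed.

Lemma cseq_starM u v :
  cseq_star (cseq_mul u v) = cseq_mul (cseq_star v) (cseq_star u).
Proof. by apply: cseq_eq => n /=; exact: pc_starM. Qed.

Lemma cseq_star_norm u : cseq_norm (cseq_star u) = cseq_norm u.
Proof.
by congr (lim (_ @ \oo)); apply/funext => n /=; exact: pc_star_norm.
Qed.

Lemma cseq_identity u : cseq_norm (cseq_mul (cseq_star u) u) = cseq_norm u ^+ 2.
Proof.
apply: cseq_norm_lim; rewrite expr2.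
have -> : (fun n => pc_norm (cseq_mul (cseq_star u) u n) : R^o) =
    (fun n => pc_norm (u n)) \* (fun n => pc_norm (u n)).
  by apply/funext => n; rewrite /= pc_identity expr2.
by apply: cvgM; exact: cseq_norm_cvg.
Qed.

(** Cauchy sequences form again a seminormed *-algebra, so completing it reduces to dividing by null
    vectors. *)
Definition cseq_preCstar : preCstar R :=
  PreCstar cseq_normD cseq_normZ cseq_mul_bilinear cseq_mulA cseq_mul_norm
    cseq_star_conj_linear cseq_starK cseq_starM cseq_star_norm cseq_identity.

End CseqNorm.

(** * Quotient by the null vectors *)

Section NullQuotient.
Variables (R : realType) (P : preCstar R).

(* The quotient by the null vectors is realised on the image of a choice of
   representatives. *)
Definition null_canon (u : P) : P := xget 0 [set v | pc_norm (u - v) = 0].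

Lemma null_canonP u : pc_norm (u - null_canon u) = 0.
Proof.
rewrite /null_canon; case: xgetP => // /(_ u) /=.
by rewrite subrr pc_norm0.
Qed.

Lemma null_canon_eq u v : pc_norm (u - v) = 0 -> null_canon u = null_canon v.
Proof.
move=> uv; have E : [set w | pc_norm (u - w) = 0] = [set w | pc_norm (v - w) = 0].
  apply/seteqP; split=> w /= H; apply/eqP; rewrite eq_le pc_norm_ge0 andbT.
    by apply: le_trans (pc_dist_trans _ u _) _; rewrite pc_distC uv H addr0.
  by apply: le_trans (pc_dist_trans _ v _) _; rewrite uv H addr0.
by rewrite /null_canon E.
Qed.

Lemma null_canonK u : null_canon (null_canon u) = null_canon u.
Proof. by apply/esym/null_canon_eq; exact: null_canonP. Qed.

End NullQuotient.

Record nullquot (R : realType) (P : preCstar R) := NullQuot {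
  nq_repr : P ;
  nq_reprP : null_canon nq_repr = nq_repr }.

Section NullQuotientType.
Variables (R : realType) (P : preCstar R).
Implicit Types (u v : P) (x y : nullquot P).

Definition nq_pi u : nullquot P := NullQuot (null_canonK u).

Lemma nq_eq x y : nq_repr x = nq_repr y -> x = y.
Proof.
case: x => u uP; case: y => v vP /= uv.
by move: uP; rewrite uv => uP; f_equal; exact: Prop_irrelevance.
Qed.

Lemma nq_piP u v : nq_pi u = nq_pi v <-> pc_norm (u - v) = 0.
Proof.
split=> [/(congr1 (@nq_repr R P)) /= uv|uv].
  apply/eqP; rewrite eq_le pc_norm_ge0 andbT.
  apply: le_trans (pc_dist_trans _ (null_canon u) _) _.
  by rewrite null_canonP {1}uv pc_distC null_canonP addr0.
by apply: nq_eq => /=; exact: null_canon_eq.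
Qed.

Lemma nq_reprK x : nq_pi (nq_repr x) = x.
Proof. by apply: nq_eq => /=; exact: nq_reprP. Qed.

Lemma nq_repr_pi u : pc_norm (nq_repr (nq_pi u) - u) = 0.
Proof. by apply/nq_piP; exact: nq_reprK. Qed.

Definition nq_add x y := nq_pi (nq_repr x + nq_repr y).
Definition nq_opp x := nq_pi (- nq_repr x).
Definition nq_scale (z : R[i]) x := nq_pi (z *: nq_repr x).
Definition nq_mul x y := nq_pi (pc_mul (nq_repr x) (nq_repr y)).
Definition nq_star x := nq_pi (pc_star (nq_repr x)).
Definition nq_norm x : R[i] := (pc_norm (nq_repr x))%:C.

Lemma nq_piD u v : nq_add (nq_pi u) (nq_pi v) = nq_pi (u + v).
Proof.
apply/nq_piP/eqP; rewrite eq_le pc_norm_ge0 andbT opprD addrACA.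
by apply: le_trans (pc_normD _ _) _; rewrite !nq_repr_pi addr0.
Qed.

Lemma nq_piN u : nq_opp (nq_pi u) = nq_pi (- u).
Proof. by apply/nq_piP; rewrite -opprD pc_normN nq_repr_pi. Qed.

Lemma nq_piZ z u : nq_scale z (nq_pi u) = nq_pi (z *: u).
Proof.
apply/nq_piP; apply: (@complexI R); rewrite -scalerBr pc_normZ nq_repr_pi.
by rewrite mulr0.
Qed.

Lemma nq_piM u v : nq_mul (nq_pi u) (nq_pi v) = nq_pi (pc_mul u v).
Proof.
apply/nq_piP/eqP; rewrite eq_le pc_norm_ge0 andbT.
by apply: le_trans (pc_mul_dist _ _ _ _) _; rewrite !nq_repr_pi mul0r mulr0 addr0.
Qed.

Lemma nq_piS u : nq_star (nq_pi u) = nq_pi (pc_star u).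
Proof. by apply/nq_piP; rewrite pc_star_dist nq_repr_pi. Qed.

Lemma nq_norm_pi u : nq_norm (nq_pi u) = (pc_norm u)%:C.
Proof.
congr (_%:C); apply/eqP; rewrite -subr_eq0 -normr_eq0 eq_le normr_ge0 andbT.
by apply: le_trans (pc_dist_norm _ _) _; rewrite nq_repr_pi.
Qed.

(** Together with the compatibility of [nq_pi] with the operations, this reduces each law of the
    quotient to the law for representatives. *)
Lemma nq_ind (Q : nullquot P -> Prop) : (forall u, Q (nq_pi u)) -> forall x, Q x.
Proof. by move=> H x; rewrite -(nq_reprK x). Qed.

Lemma nq_addA : associative nq_add.
Proof.
by elim/nq_ind=> u; elim/nq_ind=> v; elim/nq_ind=> w; rewrite !nq_piD addrA.
Qed.

Lemma nq_addC : commutative nq_add.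
Proof. by elim/nq_ind=> u; elim/nq_ind=> v; rewrite !nq_piD addrC. Qed.

Lemma nq_add0 : left_id (nq_pi 0) nq_add.
Proof. by elim/nq_ind=> u; rewrite !nq_piD add0r. Qed.

Lemma nq_addN : left_inverse (nq_pi 0) nq_opp nq_add.
Proof. by elim/nq_ind=> u; rewrite nq_piN nq_piD addNr. Qed.

Lemma nq_scaleA a b x : nq_scale a (nq_scale b x) = nq_scale (a * b) x.
Proof. by elim/nq_ind: x => u; rewrite !nq_piZ scalerA. Qed.

Lemma nq_scale1 : left_id 1 nq_scale.
Proof. by elim/nq_ind=> u; rewrite nq_piZ scale1r. Qed.

Lemma nq_scaleDr : right_distributive nq_scale nq_add.
Proof.
by move=> z; elim/nq_ind=> u; elim/nq_ind=> v; rewrite !(nq_piZ, nq_piD) scalerDr.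
Qed.

Lemma nq_scaleDl x a b : nq_scale (a + b) x = nq_add (nq_scale a x) (nq_scale b x).
Proof. by elim/nq_ind: x => u; rewrite !(nq_piZ, nq_piD) scalerDl. Qed.

End NullQuotientType.

HB.instance Definition _ (R : realType) (P : preCstar R) := gen_eqMixin (nullquot P).
HB.instance Definition _ (R : realType) (P : preCstar R) := gen_choiceMixin (nullquot P).
HB.instance Definition _ (R : realType) (P : preCstar R) :=
  GRing.isZmodule.Build (nullquot P)
    (@nq_addA R P) (@nq_addC R P) (@nq_add0 R P) (@nq_addN R P).
HB.instance Definition _ (R : realType) (P : preCstar R) :=
  GRing.Zmodule_isLmodule.Build R[i] (nullquot P)
    (@nq_scaleA R P) (@nq_scale1 R P) (@nq_scaleDr R P) (@nq_scaleDl R P).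

Section NullQuotientNorm.
Variables (R : realType) (P : preCstar R).
Implicit Types x y : nullquot P.

Lemma nq_normD x y : nq_norm (x + y) <= nq_norm x + nq_norm y.
Proof.
elim/nq_ind: x => u; elim/nq_ind: y => v.
rewrite -[nq_pi u + _]/(nq_add _ _) nq_piD !nq_norm_pi -rmorphD lecR.
exact: pc_normD.
Qed.

Lemma nq_normZ z x : nq_norm (z *: x) = `|z| * nq_norm x.
Proof.
elim/nq_ind: x => u; rewrite -[z *: _]/(nq_scale _ _) nq_piZ !nq_norm_pi.
exact: pc_normZ.
Qed.

Lemma nq_norm_eq0 x : nq_norm x = 0 -> x = 0.
Proof.
elim/nq_ind: x => u; rewrite nq_norm_pi => /(@complexI R _ 0) u0.
by apply/nq_piP; rewrite subr0.
Qed.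

End NullQuotientNorm.

HB.instance Definition _ (R : realType) (P : preCstar R) :=
  Lmodule_isNormed.Build R[i] (nullquot P)
    (@nq_normD R P) (@nq_normZ R P) (@nq_norm_eq0 R P).
Lemma realCD (R : realType) (a b : R) : (a + b)%:C = a%:C + b%:C :> R[i].
Proof. exact: rmorphD. Qed.

Lemma dist_lt_add (K : numDomainType) (V : normedZmodType K) (b a c : V) (r s : K) :
  `|a - b| <= r -> `|b - c| < s -> `|a - c| < r + s.
Proof.
move=> ab bc; rewrite -(subrK b a) -addrA.
by apply: le_lt_trans (ler_normD _ _) _; exact: ler_ltD.
Qed.

Section Completion.
Variables (R : realType) (P : preCstar R).
Local Notation Q := (nullquot (cseq_preCstar P)).
Implicit Types (u v : P) (x y : Q).

Definition pc_embed v : Q := nq_pi (cseq_const v : cseq_preCstar P).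

Lemma nq_piB (P' : preCstar R) (a b : P') : nq_pi a - nq_pi b = nq_pi (a - b).
Proof.
by rewrite -[nq_pi a - _]/(nq_add _ (nq_opp _)) nq_piN nq_piD.
Qed.

Lemma nq_normE (P' : preCstar R) (a : P') : `|nq_pi a| = (pc_norm a)%:C.
Proof. exact: nq_norm_pi. Qed.

Lemma pc_embed_norm v : `|pc_embed v| = (pc_norm v)%:C.
Proof. by rewrite nq_normE; congr (_%:C); exact: cseq_norm_const. Qed.

Lemma pc_embed_dist u v : `|pc_embed u - pc_embed v| = (pc_norm (u - v))%:C.
Proof.
rewrite nq_piB nq_normE -(cseq_norm_const (u - v)).
by congr ((cseq_norm _)%:C); apply: cseq_eq.
Qed.

Lemma nq_pi_tail (w : cseq P) (r : R) : 0 < r ->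
  \forall n \near \oo, `|nq_pi (w : cseq_preCstar P) - pc_embed (w n)| <= r%:C.
Proof.
move=> r0; have [n0 H] := cseqP w r0; exists n0 => // n /= n0n.
rewrite nq_piB nq_normE lecR; apply: cseq_norm_le.
by exists n0 => // m /= n0m; apply/ltW/H.
Qed.

Lemma pc_embed_dense x (r : R) : 0 < r -> exists v, `|x - pc_embed v| <= r%:C.
Proof.
move=> r0; elim/nq_ind: x => w; have [n _ H] := nq_pi_tail w r0.
by exists (w n); exact: H (leqnn n).
Qed.

(** Vectors [v n] of the original algebra are chosen near the filter. Two sets of the filter meet,
    so [v] is a Cauchy sequence, and its class is the limit. *)
Lemma completion_complete (F : set_system Q) : ProperFilter F -> cauchy F -> cvg F.
Proof.
move=> FF /cauchyP cF; pose q : R := 2^-1.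
have q0 n : 0 < q ^+ n by rewrite exprn_gt0// invr_gt0.
(* One [q ^+ n] is the radius of a ball in the filter; the other is the distance from its centre to
   the original algebra. *)
have ex n : exists v, F (ball (pc_embed v) (q ^+ n + q ^+ n)%:C).
  have [|x Fx] := cF (q ^+ n)%:C; first by rewrite ltcR.
  have [v xv] := pc_embed_dense x (q0 n); exists v.
  apply: filterS Fx => y; rewrite -!ball_normE /= => xy.
  rewrite distrC in xv; rewrite realCD; exact: (dist_lt_add xv xy).
pose v n := projT1 (cid (ex n)).
have vF n : F (ball (pc_embed (v n)) (q ^+ n + q ^+ n)%:C) := projT2 (cid (ex n)).
have small (eps : R) : 0 < eps -> exists n0, forall n, (n0 <= n)%N ->
    q ^+ n + q ^+ n < eps.
  move=> eps0; have e2 : 0 < (eps / 2)%:C :> R[i] by rewrite ltcR divr_gt0.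
  have [n0] := exp_half_small e2.
  have -> : (2^-1 : R[i]) ^+ n0 = (q ^+ n0)%:C.
    by rewrite rmorphXn /= fmorphV rmorph_nat.
  rewrite ltcR => H; exists n0 => n n0n; rewrite [ltRHS]splitr.
  have Hn : q ^+ n <= q ^+ n0.
    by apply: ler_wiXn2l => //; rewrite ?invr_ge0// invf_le1// ler1n.
  by apply: ltrD; exact: le_lt_trans Hn H.
have vc : is_cauchy_seq v.
  move=> eps eps0; have e2 : 0 < eps / 2 by rewrite divr_gt0.
  have [n0 H] := small _ e2; exists n0 => m n n0m n0n.
  have [y []] := filter_ex (filterI (vF m) (vF n)).
  rewrite -!ball_normE /= => ym yn; rewrite -ltcR -pc_embed_dist.
  rewrite distrC in yn; apply: lt_trans (dist_lt_add (ltW ym) yn) _.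
  by rewrite -realCD ltcR [ltRHS]splitr; apply: ltrD; exact: H.
pose w : cseq P := Cseq vc.
apply/cvg_ex; exists (nq_pi (w : cseq_preCstar P)); apply/cvg_ballP => eps eps0.
have E := ge0_Re (ltW eps0); move: eps0; rewrite E ltcR => r0.
set r := complex.Re eps in r0 *.
have r2 : 0 < r / 2 by rewrite divr_gt0.
have [n0 H] := small _ r2; have [n1 _ H1] := nq_pi_tail w r2.
apply: filterS (vF (maxn n0 n1)) => y; rewrite -!ball_normE /= => Hy.
rewrite [r]splitr realCD.
apply: (dist_lt_add (H1 _ (leq_maxr n0 n1))).
apply: lt_trans Hy _; rewrite ltcR; apply: H; exact: leq_maxl.
Qed.

End Completion.

HB.instance Definition _ (R : realType) (P : preCstar R) :=
  Uniform_isComplete.Build (nullquot (cseq_preCstar P)) (@completion_complete R P).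

Section CompletionCstar.
Variables (R : realType) (P : preCstar R).
Local Notation Q := (nullquot (cseq_preCstar P)).

Lemma pc_embed_linear z (u v : P) :
  pc_embed (z *: u + v) = z *: pc_embed u + pc_embed v.
Proof.
rewrite -[RHS]/(nq_add (nq_scale _ _) _) nq_piZ nq_piD.
by congr nq_pi; exact: cseq_eq.
Qed.

Lemma pc_embedM (u v : P) :
  pc_embed (pc_mul u v) = nq_mul (pc_embed u) (pc_embed v).
Proof. by rewrite nq_piM; congr nq_pi; exact: cseq_eq. Qed.

Lemma pc_embedS (u : P) :
  pc_embed (pc_star u) = nq_star (pc_embed u).
Proof. by rewrite nq_piS; congr nq_pi; exact: cseq_eq. Qed.

Lemma nq_mul_bilinear : is_bilinear (@nq_mul R (cseq_preCstar P)).
Proof.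
have [ll lr] := @pc_mul_bilinear R (cseq_preCstar P).
split=> [y z x x'|x z y y'].
  elim/nq_ind: x => u; elim/nq_ind: x' => u'; elim/nq_ind: y => v.
  rewrite -[z *: _ + _]/(nq_add (nq_scale _ _) _) -[RHS]/(nq_add (nq_scale _ _) _).
  by rewrite !(nq_piM, nq_piZ, nq_piD); congr nq_pi; exact: ll.
elim/nq_ind: x => u; elim/nq_ind: y' => v'; elim/nq_ind: y => v.
rewrite -[z *: _ + _]/(nq_add (nq_scale _ _) _) -[RHS]/(nq_add (nq_scale _ _) _).
by rewrite !(nq_piM, nq_piZ, nq_piD); congr nq_pi; exact: lr.
Qed.

Lemma nq_mulA : associative (@nq_mul R (cseq_preCstar P)).
Proof.
elim/nq_ind=> u; elim/nq_ind=> v; elim/nq_ind=> w; rewrite !nq_piM.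
by congr nq_pi; exact: pc_mulA.
Qed.

Lemma nq_mul_norm (x y : Q) : `|nq_mul x y| <= `|x| * `|y|.
Proof.
elim/nq_ind: x => u; elim/nq_ind: y => v; rewrite nq_piM !nq_normE -rmorphM lecR.
exact: pc_mul_norm.
Qed.

Lemma nq_star_conj_linear : is_conj_linear (@nq_star R (cseq_preCstar P)).
Proof.
move=> z; elim/nq_ind=> u; elim/nq_ind=> v.
rewrite -[z *: _ + _]/(nq_add (nq_scale _ _) _) -[RHS]/(nq_add (nq_scale _ _) _).
by rewrite !(nq_piS, nq_piZ, nq_piD); congr nq_pi; exact: pc_star_conj_linear.
Qed.

Lemma nq_starK : involutive (@nq_star R (cseq_preCstar P)).
Proof. by elim/nq_ind=> u; rewrite !nq_piS pc_starK. Qed.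

Lemma nq_starM (x y : Q) : nq_star (nq_mul x y) = nq_mul (nq_star y) (nq_star x).
Proof.
by elim/nq_ind: x => u; elim/nq_ind: y => v; rewrite !(nq_piS, nq_piM) pc_starM.
Qed.

Lemma nq_identity (x : Q) : `|nq_mul (nq_star x) x| = `|x| ^+ 2.
Proof.
by elim/nq_ind: x => u; rewrite nq_piS nq_piM !nq_normE pc_identity rmorphXn.
Qed.

Definition completion : cstarAlgebra R :=
  @CstarAlgebra R Q _ _ nq_mul_bilinear nq_mulA nq_mul_norm
    nq_star_conj_linear nq_starK nq_starM nq_identity.

End CompletionCstar.

Record preHom (R : realType) (P P' : preCstar R) := PreHom {
  ph :> P -> P' ;
  ph_linear : linear ph ;
  ph_mul : forall u v, ph (pc_mul u v) = pc_mul (ph u) (ph v) ;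
  ph_star : forall u, ph (pc_star u) = pc_star (ph u) ;
  ph_norm : forall u, pc_norm (ph u) <= pc_norm u }.

Lemma contraction_continuous (K : numFieldType) (V W : normedModType K) (f : V -> W) :
  linear f -> (forall x, `|f x| <= `|x|) -> continuous f.
Proof.
move=> fl fn x; apply/cvgrPdist_lt => e e0; near=> y.
rewrite -(lin_sub fl); apply: le_lt_trans (fn _) _.
by near: y; exact: cvgr_dist_lt.
Unshelve. all: by end_near. Qed.

Section Extension.
Variables (R : realType) (P P' : preCstar R) (f : preHom P P').

Lemma ph_dist u v : pc_norm (f u - f v) <= pc_norm (u - v).
Proof.
have -> : f u - f v = f (u - v) by rewrite (lin_sub (@ph_linear _ _ _ f)).
exact: ph_norm.
Qed.

Program Definition cseq_map (u : cseq P) : cseq P' := @Cseq R P' (fun n => f (u n)) _.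
Next Obligation.
move=> u eps eps0; have [n0 H] := cseqP u eps0.
by exists n0 => m n m0 n0'; apply: le_lt_trans (ph_dist _ _) (H _ _ m0 n0').
Qed.

Lemma cseq_map_norm (u : cseq P) : cseq_norm (cseq_map u) <= cseq_norm u.
Proof.
apply: (real_seq_le (@cseq_norm_cvg _ _ (cseq_map u)) (@cseq_norm_cvg _ _ u)).
by apply: nearW => n; exact: ph_norm.
Qed.

Lemma cseq_map_linear : linear cseq_map.
Proof. by move=> z u v; apply: cseq_eq => n /=; exact: ph_linear. Qed.

Local Notation Q := (nullquot (cseq_preCstar P)).
Local Notation Q' := (nullquot (cseq_preCstar P')).

Definition completion_map (x : Q) : Q' :=
  nq_pi (cseq_map (nq_repr x) : cseq_preCstar P').

(** Independence of the representative: a contraction sends null vectors to null vectors. *)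
Lemma completion_map_pi (u : cseq P) :
  completion_map (nq_pi (u : cseq_preCstar P)) = nq_pi (cseq_map u : cseq_preCstar P').
Proof.
apply/nq_piP/eqP; rewrite eq_le pc_norm_ge0 andbT.
have := cseq_map_norm (nq_repr (nq_pi (u : cseq_preCstar P)) - u).
rewrite (lin_sub cseq_map_linear) => /le_trans; apply.
by rewrite (_ : cseq_norm _ = 0)//; exact: (@nq_repr_pi R (cseq_preCstar P) u).
Qed.

Lemma completion_map_linear : linear completion_map.
Proof.
move=> z; elim/nq_ind=> u; elim/nq_ind=> v.
rewrite -[z *: _ + _]/(nq_add (nq_scale _ _) _) -[RHS]/(nq_add (nq_scale _ _) _).
rewrite nq_piZ nq_piD !completion_map_pi nq_piZ nq_piD; congr nq_pi; exact: cseq_map_linear.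
Qed.

Lemma completion_map_mul (x y : Q) :
  completion_map (nq_mul x y) = nq_mul (completion_map x) (completion_map y).
Proof.
elim/nq_ind: x => u; elim/nq_ind: y => v; rewrite nq_piM !completion_map_pi nq_piM.
by congr nq_pi; apply: cseq_eq => n /=; exact: ph_mul.
Qed.

Lemma completion_map_star (x : Q) : completion_map (nq_star x) = nq_star (completion_map x).
Proof.
elim/nq_ind: x => u; rewrite nq_piS !completion_map_pi nq_piS.
by congr nq_pi; apply: cseq_eq => n /=; exact: ph_star.
Qed.

Definition completion_hom : starHom (completion P) (completion P') :=
  @StarHom R (completion P) (completion P') completion_map
    completion_map_linear completion_map_mul completion_map_star.

Lemma completion_map_embed v : completion_map (pc_embed v) = pc_embed (f v).
Proof. by rewrite completion_map_pi; congr nq_pi; apply: cseq_eq. Qed.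

Lemma completion_map_norm (x : Q) : `|completion_map x| <= `|x|.
Proof.
elim/nq_ind: x => u; rewrite completion_map_pi !nq_normE lecR.
exact: cseq_map_norm.
Qed.

Lemma completion_hom_continuous : continuous (completion_hom : completion P -> completion P').
Proof. exact: contraction_continuous completion_map_linear completion_map_norm. Qed.

End Extension.

(** * The full C*-algebra of a Fell bundle *)

Section MaximalSeminorm.
Variables (R : realType) (E : scFellBundle R).
Implicit Types (f u : sections E) (N : sections E -> R).
Let EP := sc_fell E.

(** Makes the set in [max_seminorm] nonempty and, as one of the competitors, gives
    [max_seminorm_ge0]. *)
Lemma cstar_seminorm_zero : is_cstar_seminorm (fun _ : sections E => 0 : R).
Proof.
split=> [//|f u _ _|z f _|f u _ _|//|f _].
- by rewrite addr0.
- by rewrite mulr0.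
- by rewrite mulr0.
- by rewrite expr2 mulr0.
Qed.

(** By [cstar_seminorm_bounded] this is, on [in_Cc], a genuine supremum and not the default value of
    [sup]. *)
Definition max_seminorm f : R := sup [set N f | N in @is_cstar_seminorm R _ E].

Lemma max_seminorm_has_sup f : in_Cc f ->
  has_sup [set N f | N in @is_cstar_seminorm R _ E].
Proof.
move=> Cf; split; first by exists 0, (fun=> 0) => //; exact: cstar_seminorm_zero.
have [M HM] := cstar_seminorm_bounded Cf.
by exists M => _ [N NP <-]; exact: HM.
Qed.

Lemma max_seminorm_ub N f : is_cstar_seminorm N -> in_Cc f -> N f <= max_seminorm f.
Proof.
move=> NP Cf; apply: ub_le_sup; last by exists N.
by have [] := max_seminorm_has_sup Cf.
Qed.

Lemma max_seminorm_le f (r : R) : in_Cc f ->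
  (forall N, is_cstar_seminorm N -> N f <= r) -> max_seminorm f <= r.
Proof.
move=> Cf H; apply: ge_sup; first by have [] := max_seminorm_has_sup Cf.
by move=> _ [N NP <-]; exact: H.
Qed.

Lemma max_seminorm_ge0 f : in_Cc f -> 0 <= max_seminorm f.
Proof. exact: max_seminorm_ub cstar_seminorm_zero. Qed.

Lemma max_seminormP : is_cstar_seminorm max_seminorm.
Proof.
have cv f u : in_Cc f -> in_Cc u -> in_Cc (convolution f u) by exact: Cc_conv.
have st f : in_Cc f -> in_Cc (sec_star f) by exact: Cc_star.
have muln f u : in_Cc f -> in_Cc u ->
    max_seminorm (convolution f u) <= max_seminorm f * max_seminorm u.
  move=> Cf Cu; apply: max_seminorm_le; first exact: cv.
  move=> N NP; apply: le_trans (sn_mul NP Cf Cu) _.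
  by apply: ler_pM; rewrite ?(sn_ge0 NP)//; exact: max_seminorm_ub.
have star_le f : in_Cc f -> max_seminorm (sec_star f) <= max_seminorm f.
  move=> Cf; apply: max_seminorm_le; first exact: st.
  by move=> N NP; rewrite (sn_star NP Cf); exact: max_seminorm_ub.
have starE f : in_Cc f -> max_seminorm (sec_star f) = max_seminorm f.
  move=> Cf; apply/eqP; rewrite eq_le star_le//= -{1}(sec_starK EP f).
  by apply: star_le; exact: st.
have scale_le (r : R) (z : R[i]) f : in_Cc f -> `|z| = r%:C ->
    max_seminorm (fun x => z *: f x) <= r * max_seminorm f.
  move=> Cf zr; apply: max_seminorm_le; first exact: Cc_scale.
  move=> N NP; rewrite -lecR (sn_scale NP _ Cf) zr -rmorphM lecR.
  apply: ler_wpM2l; last exact: max_seminorm_ub.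
  by rewrite -lecR -zr normr_ge0.
split=> //.
- exact: max_seminorm_ge0.
- move=> f u Cf Cu; apply: max_seminorm_le; first exact: Cc_lin.
  move=> N NP; apply: le_trans (sn_add NP Cf Cu) _.
  by apply: lerD; exact: max_seminorm_ub.
- move=> z f Cf; rewrite (ge0_Re (normr_ge0 z)) -rmorphM; congr (_%:C).
  set r := complex.Re `|z|; have zr : `|z| = r%:C by exact: ge0_Re.
  apply/eqP; rewrite eq_le (scale_le r)//=.
  have [->|z0] := eqVneq r 0; first by rewrite mul0r max_seminorm_ge0//; exact: Cc_scale.
  have r0 : 0 < r by rewrite lt_neqAle eq_sym z0 -lecR -zr normr_ge0.
  have zn0 : z != 0 by rewrite -normr_eq0 zr; apply: contra z0 => /eqP/(@complexI R _ 0)/eqP.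
  (* The lower bound for scaling is the upper bound applied to the inverse scalar. *)
  have {1}-> : f = (fun x => z^-1 *: (z *: f x)).
    by apply: functional_extensionality_dep => x; rewrite scalerA mulVf// scale1r.
  rewrite -ler_pdivlMl//; apply: scale_le; first exact: Cc_scale.
  by rewrite normfV zr fmorphV.
- move=> f Cf; apply/eqP; rewrite eq_le; apply/andP; split.
    by apply: le_trans (muln _ _ (st _ Cf) Cf) _; rewrite starE// expr2.
  (* A bound on each [N f ^+ 2] becomes one on the supremum of the [N f] after taking the square
     root of the right side. *)
  rewrite -[leRHS]sqr_sqrtr; last by apply: max_seminorm_ge0; exact: cv (st _ Cf) Cf.
  rewrite lerXn2r ?nnegrE ?sqrtr_ge0 ?max_seminorm_ge0//.
  apply: max_seminorm_le => // N NP.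
  rewrite -(@ler_sqr _ (N f)) ?nnegrE ?sqrtr_ge0 ?(sn_ge0 NP)//.
  rewrite sqr_sqrtr; last by apply: max_seminorm_ge0; exact: cv (st _ Cf) Cf.
  by rewrite -(sn_identity NP Cf); apply: max_seminorm_ub => //; exact: cv (st _ Cf) Cf.
Qed.

Lemma max_seminorm_maximal : is_maximal_cstar_seminorm max_seminorm.
Proof. by split; [exact: max_seminormP|move=> N NP f Cf; exact: max_seminorm_ub]. Qed.

End MaximalSeminorm.

(** Membership in [in_Cc] is bundled so that these sections can carry a module structure, as
    [preCstar] requires. *)
Record ccSection (R : realType) (E : scFellBundle R) := CcSection {
  cc_sec :> sections E ;
  cc_secP : in_Cc cc_sec }.

HB.instance Definition _ (R : realType) (E : scFellBundle R) := gen_eqMixin (ccSection E).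
HB.instance Definition _ (R : realType) (E : scFellBundle R) :=
  gen_choiceMixin (ccSection E).

Section CcModule.
Variables (R : realType) (E : scFellBundle R).
Implicit Types f u v : ccSection E.

Lemma cc_eq f u : (forall x, cc_sec f x = cc_sec u x) -> f = u.
Proof.
case: f => f fP; case: u => u uP /= fu.
have E0 : f = u by apply: functional_extensionality_dep.
by move: fP; rewrite E0 => fP; f_equal; exact: Prop_irrelevance.
Qed.

Definition cc_zero : ccSection E := CcSection (Cc0 E).
Definition cc_lin z f u : ccSection E := CcSection (Cc_lin z (cc_secP f) (cc_secP u)).
Definition cc_scale z f : ccSection E := CcSection (Cc_scale z (cc_secP f)).

Lemma cc_addA : associative (cc_lin 1).
Proof. by move=> f u v; apply: cc_eq => x; rewrite /= /sec_lin !scale1r addrA. Qed.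

Lemma cc_addC : commutative (cc_lin 1).
Proof. by move=> f u; apply: cc_eq => x; rewrite /= /sec_lin !scale1r addrC. Qed.

Lemma cc_add0 : left_id cc_zero (cc_lin 1).
Proof. by move=> f; apply: cc_eq => x; rewrite /= /sec_lin scale1r add0r. Qed.

Lemma cc_addN : left_inverse cc_zero (cc_scale (-1)) (cc_lin 1).
Proof. by move=> f; apply: cc_eq => x; rewrite /= /sec_lin scale1r scaleN1r addNr. Qed.

HB.instance Definition _ := GRing.isZmodule.Build (ccSection E)
  cc_addA cc_addC cc_add0 cc_addN.

Lemma cc_scaleA (a b : R[i]) f : cc_scale a (cc_scale b f) = cc_scale (a * b) f.
Proof. by apply: cc_eq => x /=; rewrite scalerA. Qed.

Lemma cc_scale1 : left_id 1 cc_scale.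
Proof. by move=> f; apply: cc_eq => x /=; rewrite scale1r. Qed.

Lemma cc_scaleDr : right_distributive cc_scale +%R.
Proof.
by move=> z f u; apply: cc_eq => x; rewrite /= /sec_lin !scale1r scalerDr.
Qed.

Lemma cc_scaleDl f : {morph cc_scale^~ f : a b / a + b}.
Proof. by move=> a b; apply: cc_eq => x; rewrite /= /sec_lin scale1r scalerDl. Qed.

HB.instance Definition _ := GRing.Zmodule_isLmodule.Build R[i] (ccSection E)
  cc_scaleA cc_scale1 cc_scaleDr cc_scaleDl.

Lemma cc_linE z f u : z *: f + u = cc_lin z f u.
Proof. by apply: cc_eq => x; rewrite /= /sec_lin scale1r. Qed.

Definition cc_mul f u : ccSection E := CcSection (Cc_conv (cc_secP f) (cc_secP u)).
Definition cc_star f : ccSection E := CcSection (Cc_star (cc_secP f)).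
Definition cc_norm f : R := max_seminorm f.

End CcModule.

Section FullCstar.
Variables (R : realType) (E : scFellBundle R).
Implicit Types f u v : ccSection E.
Let EP := sc_fell E.
Let NP := max_seminormP E.

Lemma cc_normD f u : cc_norm (f + u) <= cc_norm f + cc_norm u.
Proof. exact: (sn_add NP (cc_secP f) (cc_secP u)). Qed.

Lemma cc_normZ z f : (cc_norm (z *: f))%:C = `|z| * (cc_norm f)%:C.
Proof. exact: (sn_scale NP z (cc_secP f)). Qed.

Lemma cc_mul_bilinear : is_bilinear (@cc_mul R E).
Proof.
split=> [u z f g|f z u v]; rewrite !cc_linE; apply: cc_eq => x /=.
  by rewrite conv_linl//; apply: Cc_rfin; exact: cc_secP.
by rewrite conv_linr//; apply: Cc_rfin; exact: cc_secP.
Qed.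

Lemma cc_mulA : associative (@cc_mul R E).
Proof.
move=> f u v; apply: cc_eq => x /=.
by rewrite convA//; apply: Cc_rfin; exact: cc_secP.
Qed.

Lemma cc_mul_norm f u : cc_norm (cc_mul f u) <= cc_norm f * cc_norm u.
Proof. exact: (sn_mul NP (cc_secP f) (cc_secP u)). Qed.

Lemma cc_star_conj_linear : is_conj_linear (@cc_star R E).
Proof.
by move=> z f u; rewrite !cc_linE; apply: cc_eq => x; rewrite /= sec_star_lin.
Qed.

Lemma cc_starK : involutive (@cc_star R E).
Proof. by move=> f; apply: cc_eq => x; rewrite /= (sec_starK EP). Qed.

Lemma cc_starM f u : cc_star (cc_mul f u) = cc_mul (cc_star u) (cc_star f).
Proof.
apply: cc_eq => x /=; rewrite (sec_star_conv EP)//; apply: Cc_rfin.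
exact: cc_secP.
Qed.

Lemma cc_star_norm f : cc_norm (cc_star f) = cc_norm f.
Proof. exact: (sn_star NP (cc_secP f)). Qed.

Lemma cc_identity f : cc_norm (cc_mul (cc_star f) f) = cc_norm f ^+ 2.
Proof. exact: (sn_identity NP (cc_secP f)). Qed.

Definition cc_preCstar : preCstar R :=
  PreCstar cc_normD cc_normZ cc_mul_bilinear cc_mulA cc_mul_norm
    cc_star_conj_linear cc_starK cc_starM cc_star_norm cc_identity.

Definition full_cstar : cstarAlgebra R := completion cc_preCstar.

(** The value 0 outside [in_Cc] is arbitrary; [is_full_cstar] constrains the map on [in_Cc] only. *)
Definition full_iota (f : sections E) : full_cstar :=
  if pselect (in_Cc f) is left Cf then pc_embed (CcSection Cf : cc_preCstar) else 0.

Lemma full_iotaE (f : ccSection E) : full_iota f = pc_embed (f : cc_preCstar).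
Proof.
rewrite /full_iota; case: pselect => [Cf|]; last by have := cc_secP f.
by congr pc_embed; apply: cc_eq.
Qed.

Lemma full_iota_dense : dense (full_iota @` @in_Cc _ _ E).
Proof.
move=> O [x Ox] oO.
have /nbhs_ballP[e /= e0 xO] : nbhs x O by exact: open_nbhs_nbhs.
have E0 := ge0_Re (ltW e0); move: e0; rewrite E0 ltcR => r0.
have r2 : 0 < complex.Re e / 2 by rewrite divr_gt0.
have [v xv] := pc_embed_dense x r2.
exists (pc_embed v); split; last by exists (cc_sec v); [exact: cc_secP|exact: full_iotaE].
apply: xO; rewrite -ball_normE /=; apply: le_lt_trans xv _.
by rewrite E0 ltcR ltr_pdivrMr// ltr_pMr// ltr1n.
Qed.

Lemma full_iotaP : is_full_cstar full_iota.
Proof.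
split.
- move=> z f u Cf Cu; rewrite -[f]/(cc_sec (CcSection Cf)) -[u]/(cc_sec (CcSection Cu)).
  rewrite -[sec_lin _ _ _]/(cc_sec (cc_lin z (CcSection Cf) (CcSection Cu))) !full_iotaE.
  by rewrite -cc_linE; exact: (@pc_embed_linear R cc_preCstar).
- move=> f u Cf Cu; rewrite -[f]/(cc_sec (CcSection Cf)) -[u]/(cc_sec (CcSection Cu)).
  rewrite -[convolution _ _]/(cc_sec (cc_mul (CcSection Cf) (CcSection Cu))) !full_iotaE.
  exact: (@pc_embedM R cc_preCstar).
- move=> f Cf; rewrite -[f]/(cc_sec (CcSection Cf)).
  rewrite -[sec_star _]/(cc_sec (cc_star (CcSection Cf))) !full_iotaE.
  exact: (@pc_embedS R cc_preCstar).
- exists (@max_seminorm R E); first exact: max_seminorm_maximal.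
  move=> f Cf; rewrite -[f]/(cc_sec (CcSection Cf)) full_iotaE.
  exact: (@pc_embed_norm R cc_preCstar).
- exact: full_iota_dense.
Qed.

End FullCstar.

Section InducedHom.
Variables (R : realType) (E F : scFellBundle R) (A : psFellActor E F).

Lemma seminorm_pullback (Phi0 : sections E -> sections F) (N : sections F -> R) :
  is_Cc_star_hom Phi0 -> is_cstar_seminorm N -> is_cstar_seminorm (N \o Phi0).
Proof.
move=> [hC hl hm hs] NP; split=> /=.
- by move=> f Cf; apply: (sn_ge0 NP); exact: hC.
- by move=> f u Cf Cu; rewrite hl//; apply: (sn_add NP); exact: hC.
- move=> z f Cf; have -> : Phi0 (fun g => z *: f g) = fun g => z *: Phi0 f g.
    (* With scalar -1 and both arguments 0, linearity reads [Phi0 0 = - Phi0 0 + Phi0 0]. *)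
    have Phi00 : Phi0 (fun=> 0) = fun=> 0.
      have := hl (-1) _ _ (Cc0 E) (Cc0 E).
      rewrite (_ : sec_lin _ _ _ = fun=> 0).
        move=> ->; apply: functional_extensionality_dep => x.
        by rewrite /sec_lin scaleN1r addNr.
      by apply: functional_extensionality_dep => x; rewrite /sec_lin scaler0 addr0.
    rewrite (_ : (fun g => z *: f g) = sec_lin z f (fun=> 0)).
      rewrite hl ?Phi00//; last exact: Cc0.
      by apply: functional_extensionality_dep => x; rewrite /sec_lin addr0.
    by apply: functional_extensionality_dep => x; rewrite /sec_lin addr0.
  by apply: (sn_scale NP); exact: hC.
- by move=> f u Cf Cu; rewrite hm//; apply: (sn_mul NP); exact: hC.
- by move=> f Cf; rewrite hs//; apply: (sn_star NP); exact: hC.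
- move=> f Cf; rewrite hm ?hs//; last exact: Cc_star.
  by apply: (sn_identity NP); exact: hC.
Qed.

Let hA : is_Cc_star_hom (actor_hom A) := proj1 (actor_hom_Phi0 A).

Definition cc_hom (f : ccSection E) : ccSection F :=
  CcSection (Cc_hom_Cc hA (cc_secP f)).

Lemma cc_hom_linear : linear cc_hom.
Proof.
move=> z f u; rewrite !cc_linE; apply: cc_eq => x /=.
by rewrite (Cc_hom_linear hA)//; exact: cc_secP.
Qed.

Lemma cc_hom_mul f u : cc_hom (cc_mul f u) = cc_mul (cc_hom f) (cc_hom u).
Proof.
by apply: cc_eq => x /=; rewrite (Cc_hom_mul hA)//; exact: cc_secP.
Qed.

Lemma cc_hom_star f : cc_hom (cc_star f) = cc_star (cc_hom f).
Proof.
by apply: cc_eq => x /=; rewrite (Cc_hom_star hA)//; exact: cc_secP.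
Qed.

(** The maximal seminorm of the target, pulled back along the homomorphism, competes in the supremum
    defining the one of the source. This contractivity is what allows the extension to
    completions. *)
Lemma cc_hom_norm f : cc_norm (cc_hom f) <= cc_norm f.
Proof.
apply: (@max_seminorm_ub R E (@max_seminorm R F \o actor_hom A)); last exact: cc_secP.
by apply: seminorm_pullback => //; exact: max_seminormP.
Qed.

Definition cc_preHom : preHom (cc_preCstar E) (cc_preCstar F) :=
  @PreHom R (cc_preCstar E) (cc_preCstar F) cc_hom
    cc_hom_linear cc_hom_mul cc_hom_star cc_hom_norm.

Definition full_hom : starHom (full_cstar E) (full_cstar F) := completion_hom cc_preHom.

Lemma full_homP :
  is_extension (@full_iota R E) (@full_iota R F) (actor_hom A) full_hom.
Proof.
split; first exact: completion_hom_continuous.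
move=> f Cf; rewrite -[f]/(cc_sec (CcSection Cf)) full_iotaE.
rewrite -[actor_hom A _]/(cc_sec (cc_hom (CcSection Cf))) full_iotaE.
exact: (@completion_map_embed _ _ _ cc_preHom).
Qed.

End InducedHom.

Lemma extension_comp (R : realType) (E F D : scFellBundle R)
    (CE CF CD : cstarAlgebra R) (iE : sections E -> CE) (iF : sections F -> CF)
    (iD : sections D -> CD) (PhiA0 : sections E -> sections F)
    (PhiB0 : sections F -> sections D) (PhiBA0 : sections E -> sections D)
    (PhiA : starHom CE CF) (PhiB : starHom CF CD) (PhiBA : starHom CE CD) :
  is_full_cstar iE -> (forall f, in_Cc f -> in_Cc (PhiA0 f)) ->
  (forall f, in_Cc f -> PhiBA0 f = PhiB0 (PhiA0 f)) ->
  is_extension iE iF PhiA0 PhiA -> is_extension iF iD PhiB0 PhiB ->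
  is_extension iE iD PhiBA0 PhiBA -> forall a, PhiB (PhiA a) = PhiBA a.
Proof.
move=> iEP CA eBA [cA eA] [cB eB] [cBA eBA'].
apply: (@extension_uniq R E CE CD iE (starHom_comp PhiA PhiB) PhiBA) => //.
  by move=> x; apply: continuous_comp; [exact: cA|exact: cB].
by move=> f Cf /=; rewrite eA// eB ?eBA' ?eBA//; exact: CA.
Qed.
Theorem proposition4p20 (R : realType) :
  (forall (E F D : scFellBundle R) (A : psFellActor E F) (B : psFellActor F D)
      (BA : psFellActor E D), is_composite A B BA ->
    forall (PhiA0 : sections E -> sections F) (PhiB0 : sections F -> sections D)
      (PhiBA0 : sections E -> sections D),
      is_Phi0 A PhiA0 -> is_Phi0 B PhiB0 -> is_Phi0 BA PhiBA0 ->
      (forall f, in_Cc f -> PhiBA0 f = PhiB0 (PhiA0 f)) /\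
      (forall (CE CF CD : cstarAlgebra R) (iE : sections E -> CE)
          (iF : sections F -> CF) (iD : sections D -> CD),
        is_full_cstar iE -> is_full_cstar iF -> is_full_cstar iD ->
        forall (PhiA : starHom CE CF) (PhiB : starHom CF CD)
          (PhiBA : starHom CE CD),
          is_extension iE iF PhiA0 PhiA -> is_extension iF iD PhiB0 PhiB ->
          is_extension iE iD PhiBA0 PhiBA ->
          forall a, PhiB (PhiA a) = PhiBA a)) /\
  (exists (idm : forall E : scFellBundle R, psFellActor E E)
      (comp : forall E F D : scFellBundle R,
        psFellActor E F -> psFellActor F D -> psFellActor E D)
      (Cst : scFellBundle R -> cstarAlgebra R)
      (iota : forall E : scFellBundle R, sections E -> Cst E)
      (Phi : forall E F : scFellBundle R,
        psFellActor E F -> starHom (Cst E) (Cst F)),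
    [/\ forall E F D (A : psFellActor E F) (B : psFellActor F D),
          is_composite A B (comp E F D A B),
        forall E, is_full_cstar (iota E),
        forall E F (A : psFellActor E F), exists2 Phi0 : sections E -> sections F,
          is_Phi0 A Phi0 & is_extension (iota E) (iota F) Phi0 (Phi E F A) &
        is_functor idm comp (@starHom_id R) (@starHom_comp R) Phi]).
Proof.
split=> [E F D A B BA cBA PhiA0 PhiB0 PhiBA0 hA hB hBA|].
  have CA f : in_Cc f -> in_Cc (PhiA0 f) by exact: Cc_hom_Cc hA.1 f.
  have eBA f : in_Cc f -> PhiBA0 f = PhiB0 (PhiA0 f).
    move=> Cf; have Cf' := CA f Cf.
    by rewrite (Phi0_uniq hBA Cf) (Phi0_uniq hB Cf') (Phi0_uniq hA Cf) (actor_hom_comp cBA).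
  split=> // CE CF CD iE iF iD iEP _ _ PhiA PhiB PhiBA.
  exact: extension_comp iEP CA eBA.
exists (@id_psFellActor R), (@comp_psFellActor R), (@full_cstar R), (@full_iota R),
  (@full_hom R); split.
- by move=> E F D A B; exact: comp_psFellActorP.
- by move=> E; exact: full_iotaP.
- move=> E F A; exists (actor_hom A); first exact: actor_hom_Phi0.
  exact: full_homP.
- split; [exact: fell_category|exact: starHom_category| |].
    (* The induced map and the identity are both continuous and agree on the dense image of
       [in_Cc]. *)
    move=> E; apply: starHom_eq; have [c e] := full_homP (id_psFellActor E).
    apply: (extension_uniq (full_iotaP E)) => //; first by move=> x; exact: cvg_id.
    by move=> f Cf; rewrite e// actor_hom_id.
  move=> E F D A B; apply: starHom_eq => a; apply/esym.
  have eAB f : in_Cc f ->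
      actor_hom (comp_psFellActor A B) f = actor_hom B (actor_hom A f).
    by move=> Cf; apply: actor_hom_comp => //; exact: comp_psFellActorP.
  exact: (extension_comp (full_iotaP E) (@Cc_actor_hom _ _ _ A) eAB (full_homP A)
    (full_homP B) (full_homP (comp_psFellActor A B)) a).
Qed.
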